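(* Let $\dot L$ be a Lévy white noise on the space of Fourier hyperfunctions $\mathcal{Q}$. Let $p,q$ be two real polynomials in $d$ variables such that the rational function $\xi\mapsto q(i\xi)/p(i\xi)$ has a holomorphic extension in a strip $\{z\in\mathbb{C}^d:\|\Im z\|<\varepsilon\}$ for some $\varepsilon>0$. Then there exists a stationary generalized random process $s$ in $\mathcal{Q}$ such that $p(D)s=q(D)\dot L$, i.e. $\langle s,p(D)^*\varphi\rangle=\langle\dot L,q(D)^*\varphi\rangle$ for all $\varphi\in\mathcal{P}_*$. Moreover, if $p(i\cdot)$ has no zeroes in the strip $\{z\in\mathbb{C}^d:\|\Im z\|<\varepsilon\}$, then the solution is unique.
   Context: Notation: $\lambda^d$ is Lebesgue measure on $\mathbb{R}^d$; $D^\alpha=\partial_{x_1}^{\alpha_1}\cdots\partial_{x_d}^{\alpha_d}$; for $p(z)=\sum_\alpha p_\alpha z^\alpha$, $p(D)=\sum_\alpha p_\alpha D^\alpha$, and its formal adjoint is $p(D)^*=p(-D)$ (likewise for $q$). The space $\mathcal{P}_*$ consists of all $\varphi\in C^\infty(\mathbb{R}^d,\mathbb{C})$ which have, for some $\delta>0$, an analytic continuation on the strip $A_\delta:=\{z\in\mathbb{C}^d:\|\Im z\|<\delta\}$ such that $\sup_{z\in A_l}|\exp((\delta-\varepsilon')\|z\|)\varphi(z)|<\infty$ for all $0<\varepsilon',l<\delta$. It is equipped with its inductive topology (it is nuclear): a sequence $(\varphi_n)\subset\mathcal{P}_*$ converges to $0$ iff there is $\delta>0$ such that every $\varphi_n$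 has an analytic continuation in $A_\delta$ and $\sup_{z\in A_{\delta/2}}|\exp(\tfrac{\delta}{2}\|z\|)\varphi_n(z)|\to0$. Its topological dual is $\mathcal{Q}$, the space of Fourier hyperfunctions. For a test function space $A$ with dual $A'$ (here $A=\mathcal{P}_*$, $A'=\mathcal{Q}$), an $A'$-valued generalized random process is a measurable mapping from a probability space $(\Omega,\mathcal{F})$ (with probability measure $\mathcal{P}$) to $(A',C(A'))$, where $C(A')$ is the $\sigma$-field generated by the cylindrical sets $\{u\in A':\langle u,\varphi_j\rangle\in B,\ j=1,\dots,n\}$, $\varphi_1,\dots,\varphi_n\in A$, $B$ Borel. Its characteristic functional is $\widehat{\mathcal{P}}_s(\varphi)=\int_{A'}\exp(i\langle u,\varphi\rangle)\,d\mathcal{P}_s(u)$, $\mathcal{P}_s$ being the law of $s$. A Lévy white noise $\dot L$ on $A'$ with characteristic triplet $(a,\gamma,\nu)$ is an $A'$-valued generalized random process whose characteristic functional is $\exp\big(\int_{\mathbb{R}^d}\psi(\varphi(x))\lambda^d(dx)\big)$ for (real-valued on $\mathbb{R}^d$) $\varphi\in A$, where $\psi(z)=i\gamma z-\frac12az^2+\int_{\mathbb{R}}(e^{ixz}-1-ixz\mathbf{1}_{|x|\le1})\nu(dx)$, $a\ge0$, $\gamma\in\mathbb{R}$, and $\nu$ is a Lévy measure ($\nu(\{0\})=0$, $\int\min(1,x^2)\nu(dx)<\infty$). For complex-valued $\varphi$, $\langle\dot L,\varphi\rangle:=\langle\dot L,\Re\varphi\rangle+i\langle\dot L,\Im\varphi\rangle$,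 where $\Re\varphi,\Im\varphi$ are the real and imaginary parts of $\varphi$ on $\mathbb{R}^d$. A generalized random process $s$ is stationary if for every $t\in\mathbb{R}^d$ the process $s(\cdot+t)$, defined by $\langle s(\cdot+t),\varphi\rangle:=\langle s,\varphi(\cdot-t)\rangle$, has the same law as $s$. *)

(* Defs.v *)
From HB Require Import structures.
From mathcomp Require Import all_boot all_order all_algebra.
From mathcomp Require Import -(notations) mpoly.
From mathcomp Require Import all_classical all_reals all_analysis.
From mathcomp Require Import complex ring lra.
Set Implicit Arguments.
Unset Strict Implicit.
Unset Printing Implicit Defensive.
Import Order.TTheory GRing.Theory Num.Theory.
Import numFieldNormedType.Exports.
Local Open Scope classical_set_scope.
Local Open Scope complex_scope.
Local Open Scope ring_scope.

Local Notation "`| z |c" := (ComplexField.Normc.normc z) (at level 0, format "`| z |c").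

(* [R[i]^o] carries the normed-module structure of the numFieldType [R[i]];
   this makes it available on [R[i]] itself, hence on ['rV[R[i]]_n]. *)
HB.instance Definition _ (R : realType) := NormedModule.copy R[i] R[i]^o.

Section complex_space.
Context {R : realType} {n : nat}.
Implicit Types (x t : 'rV[R]_n) (z w : 'rV[R[i]]_n).

Definition toC x : 'rV[R[i]]_n := map_mx (real_complex R) x.

(* Euclidean norms; the norm of the library on ['rV_n] is the sup norm. *)
Definition cnorm z : R := Num.sqrt (\sum_j `|z ord0 j|c ^+ 2).
Definition im_norm z : R := Num.sqrt (\sum_j complex.Im (z ord0 j) ^+ 2).

Definition strip (delta : R) : set 'rV[R[i]]_n := [set z | im_norm z < delta].

(* complex Frechet differentiability, i.e. holomorphy, on a set *)
Definition holomorphic_on (A : set 'rV[R[i]]_n) (f : 'rV[R[i]]_n -> R[i]) :=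
  forall z, A z -> differentiable f z.

Lemma l2_triangle (u v : 'I_n -> R) :
  Num.sqrt (\sum_j (u j + v j) ^+ 2) <=
  Num.sqrt (\sum_j u j ^+ 2) + Num.sqrt (\sum_j v j ^+ 2).
Proof.
have s0 (f : 'I_n -> R) : 0 <= \sum_j f j ^+ 2.
  by apply: sumr_ge0 => j _; exact: sqr_ge0.
set U := Num.sqrt (\sum_j u j ^+ 2); set V := Num.sqrt (\sum_j v j ^+ 2).
have U2 : U ^+ 2 = \sum_j u j ^+ 2 by rewrite sqr_sqrtr.
have V2 : V ^+ 2 = \sum_j v j ^+ 2 by rewrite sqr_sqrtr.
have U0 : 0 <= U by exact: sqrtr_ge0.
have V0 : 0 <= V by exact: sqrtr_ge0.
suff CS : \sum_j u j * v j <= U * V.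
  rewrite -(ler_pXn2r (_ : (0 < 2)%N)) ?nnegrE ?sqrtr_ge0 ?addr_ge0//.
  rewrite sqr_sqrtr// sqrrD U2 V2.
  under eq_bigr do rewrite sqrrD.
  by rewrite !big_split/= lerD2r lerD2l -mulr2n ler_wMn2r.
have eq0 (f g : 'I_n -> R) : \sum_j f j ^+ 2 = 0 -> \sum_j f j * g j = 0.
  move=> /eqP; rewrite psumr_eq0 => [/allP f0|j _]; last exact: sqr_ge0.
  apply: big1 => j _; have := f0 j (mem_index_enum _) => /=.
  by rewrite sqrf_eq0 => /eqP ->; rewrite mul0r.
have [Uz|Un] := eqVneq U 0.
  by rewrite (eq0 u v) ?mulr_ge0// -U2 Uz expr0n.
have [Vz|Vn] := eqVneq V 0.
  under eq_bigr do rewrite mulrC.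
  by rewrite (eq0 v u) ?mulr_ge0// -V2 Vz expr0n.
have Up : 0 < U by rewrite lt_neqAle eq_sym Un.
have Vp : 0 < V by rewrite lt_neqAle eq_sym Vn.
rewrite -(ler_pM2l (_ : 0 < U * V *+ 2)) ?mulrn_wgt0 ?mulr_gt0//.
have : 0 <= \sum_j (V * u j - U * v j) ^+ 2 by exact: s0.
have -> : \sum_j (V * u j - U * v j) ^+ 2 = \sum_j
    (V ^+ 2 * u j ^+ 2 + U ^+ 2 * v j ^+ 2 - U * V *+ 2 * (u j * v j)).
  by apply: eq_bigr => j _; ring.
rewrite sumrB big_split/= -!mulr_sumr -U2 -V2.
set S := \sum_j _ => h; rewrite -subr_ge0 (le_trans h)//.
by rewrite le_eqVlt; apply/orP; left; apply/eqP; ring.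
Qed.

Lemma cnorm_triangle z w : cnorm (z + w) <= cnorm z + cnorm w.
Proof.
apply: le_trans (l2_triangle _ _).
apply: ler_wsqrtr; apply: ler_sum => j _; rewrite mxE ler_pXn2r ?nnegrE//.
- exact: le_normcD.
- by case: (_ + _) => a b; exact: sqrtr_ge0.
- by rewrite addr_ge0//; [case: (z _ _)|case: (w _ _)] => a b; exact: sqrtr_ge0.
Qed.

Lemma im_norm_shift z x : im_norm (z - toC x) = im_norm z.
Proof.
rewrite /im_norm; congr Num.sqrt; apply: eq_bigr => j _; rewrite !mxE.
by case: (z _ _) => a b /=; rewrite subr0.
Qed.

End complex_space.

Section test_functions.
Context {R : realType} {n : nat}.
Implicit Types (phi psi : 'rV[R]_n -> R[i]) (f g : 'rV[R[i]]_n -> R[i]).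

(* Derivatives of complex-valued functions of a real variable are taken on the
   real and imaginary parts, [R[i]] not being a normed module over [R]. *)
Definition partial (j : 'I_n) phi : 'rV[R]_n -> R[i] := fun x =>
  'D_(delta_mx ord0 j) (fun y => complex.Re (phi y)) x +i*
  'D_(delta_mx ord0 j) (fun y => complex.Im (phi y)) x.

Definition Cdifferentiable phi (x : 'rV[R]_n) :=
  differentiable (fun y => complex.Re (phi y)) x /\
  differentiable (fun y => complex.Im (phi y)) x.

(* phi is C^oo: all its iterated partial derivatives exist and are
   differentiable *)
Definition smooth phi := forall (s : seq 'I_n) (x : 'rV[R]_n),
  Cdifferentiable (foldr partial phi s) x.

(* f is holomorphic on A_delta, and exp((delta - e)|z|)|f(z)| is bounded on
   A_l for all 0 < e, l < delta *)
Definition in_step (delta : R) f :=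
  holomorphic_on (strip delta) f /\
  forall e l : R, 0 < e < delta -> 0 < l < delta ->
  exists M : R, forall z, strip l z ->
    expR ((delta - e) * cnorm z) * `|f z|c <= M.

Definition extends f phi := forall x, f (toC x) = phi x.

Definition Pstar : {pred 'rV[R]_n -> R[i]} := [pred phi |
  `[< smooth phi /\
      exists2 delta : R, 0 < delta & exists2 f, in_step delta f & extends f phi >]].

Lemma in_stepW (d d' : R) f : 0 < d' <= d -> in_step d f -> in_step d' f.
Proof.
move=> /andP[d0 dd] [hf bf]; split=> [z zd|e l /andP[e0 ed] /andP[l0 ld]].
  by apply: hf; exact: lt_le_trans zd dd.
have [||M hM] := bf (d - d' + e) l; [lra|lra|exists M => z zl].
by have := hM z zl; rewrite (_ : d - (d - d' + e) = d' - e)//; ring.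
Qed.

Lemma normcE_ge0 (z : R[i]) : 0 <= `|z|c.
Proof. by case: z => a b; exact: sqrtr_ge0. Qed.

Lemma in_step_linear (d : R) (a : R[i]) f g :
  in_step d f -> in_step d g -> in_step d (a *: f + g).
Proof.
move=> [hf bf] [hg bg]; split=> [z zd|e l he hl].
  by apply: differentiableD; [apply: differentiableZ; exact: hf|exact: hg].
have [M hM] := bf e l he hl; have [N hN] := bg e l he hl.
exists (`|a|c * M + N) => z zl; set E := expR _.
have E0 : 0 <= E := expR_ge0 _.
apply: le_trans (_ : E * (`|a|c * `|f z|c + `|g z|c) <= _).
  rewrite ler_wpM2l// -ComplexField.Normc.normcM.
  exact: (le_normcD (a * f z) (g z)).
rewrite mulrDr lerD ?hN// mulrCA ler_wpM2l ?normcE_ge0//; exact: hM.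
Qed.

Lemma Re_linear (a z w : R[i]) : complex.Re (a * z + w) =
  complex.Re a * complex.Re z - complex.Im a * complex.Im z + complex.Re w.
Proof. by case: a z w => [a b] [c d] [u v]. Qed.

Lemma Im_linear (a z w : R[i]) : complex.Im (a * z + w) =
  complex.Re a * complex.Im z + complex.Im a * complex.Re z + complex.Im w.
Proof. by case: a z w => [a b] [c d] [u v]. Qed.

Lemma Cdifferentiable_linear a phi psi x : Cdifferentiable phi x ->
  Cdifferentiable psi x -> Cdifferentiable (a *: phi + psi) x.
Proof.
move=> [rp ip] [rq iq]; split.
  rewrite (_ : (fun y => _) = complex.Re a *: (fun y => complex.Re (phi y)) -
    complex.Im a *: (fun y => complex.Im (phi y)) + (fun y => complex.Re (psi y))).
    by apply: differentiableD => //; apply: differentiableB; exact: differentiableZ.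
  by apply/funext => y; exact: Re_linear.
rewrite (_ : (fun y => _) = complex.Re a *: (fun y => complex.Im (phi y)) +
  complex.Im a *: (fun y => complex.Re (phi y)) + (fun y => complex.Im (psi y))).
  by apply: differentiableD => //; apply: differentiableD; exact: differentiableZ.
by apply/funext => y; exact: Im_linear.
Qed.

Lemma partial_linear j a phi psi :
  (forall x, Cdifferentiable phi x) -> (forall x, Cdifferentiable psi x) ->
  partial j (a *: phi + psi) = a *: partial j phi + partial j psi.
Proof.
move=> dp dq; apply/funext => x; rewrite /partial.
have [/diff_derivable rp /diff_derivable ip] := dp x.
have [/diff_derivable rq /diff_derivable iq] := dq x.
set v := delta_mx _ _.
apply/eqP; rewrite eq_complex; apply/andP; split; apply/eqP.
  rewrite Re_linear/= (_ : (fun y => _) =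
    complex.Re a *: (fun y => complex.Re (phi y)) -
    complex.Im a *: (fun y => complex.Im (phi y)) +
    (fun y => complex.Re (psi y))); last first.
    by apply/funext => y; exact: Re_linear.
  rewrite deriveD//; last by apply: derivableB; exact: derivableZ.
  by rewrite deriveB ?deriveZ//; exact: derivableZ.
rewrite Im_linear/= (_ : (fun y => _) =
  complex.Re a *: (fun y => complex.Im (phi y)) +
  complex.Im a *: (fun y => complex.Re (phi y)) +
  (fun y => complex.Im (psi y))); last first.
  by apply/funext => y; exact: Im_linear.
rewrite deriveD//; last by apply: derivableD; exact: derivableZ.
by rewrite deriveD ?deriveZ//; exact: derivableZ.
Qed.

Lemma smooth_linear a phi psi :
  smooth phi -> smooth psi -> smooth (a *: phi + psi).
Proof.
move=> sp sq s; suff -> : foldr partial (a *: phi + psi) s =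
    a *: foldr partial phi s + foldr partial psi s.
  by move=> x; exact: Cdifferentiable_linear.
elim: s => [//|j s IH] /=; rewrite IH partial_linear//.
Qed.

Lemma partial0 j : partial j 0 = 0.
Proof.
apply/funext => x; rewrite /partial /=.
by rewrite !(derive_cst (0 : R)).
Qed.

Lemma smooth0 : smooth 0.
Proof.
move=> s x; rewrite (_ : foldr partial 0 s = 0).
  by split; exact: differentiable_cst.
by elim: s => [//|j s IH] /=; rewrite IH partial0.
Qed.

Lemma Pstar_submod_closed : submod_closed Pstar.
Proof.
split=> [|a phi psi /asboolP[sp [d d0 [f df ef]]] /asboolP[sq [d' d'0 [g dg eg]]]].
  apply/asboolP; split; first exact: smooth0.
  exists 1 => //; exists 0 => //; split=> [z _|e l _ _].
    exact: differentiable_cst.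
  by exists 0 => z _; rewrite (_ : `|_|c = 0) ?mulr0//; exact: ComplexField.Normc.normc0.
apply/asboolP; split; first exact: smooth_linear.
exists (Num.min d d'); first by rewrite lt_min d0.
exists (a *: f + g) => [|x]; last by rewrite -[LHS]/(a * f _ + g _) ef eg.
by apply: in_step_linear; [apply: in_stepW df|apply: in_stepW dg];
  rewrite lt_min d0 d'0 ge_min lexx ?orbT.
Qed.

HB.instance Definition _ := GRing.isSubmodClosed.Build _ _ Pstar
  Pstar_submod_closed.

Record testfun := Testfun { testfun_val :> 'rV[R]_n -> R[i];
  testfunP : testfun_val \in Pstar }.

HB.instance Definition _ := [isSub for testfun_val].
HB.instance Definition _ := [Choice of testfun by <:].
HB.instance Definition _ := [SubChoice_isSubLmodule of testfun by <:].

End test_functions.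
Arguments testfun : clear implicits.

Section inductive_topology.
Context {R : realType} {n : nat}.
Implicit Types (phi psi : testfun R n) (U V : set (testfun R n)).

(* V contains a ball of one of the seminorms
     phi |-> sup_(z in A_l) exp((delta - e)|z|)|phi(z)|
   on the space of those phi that extend to A_delta; this family of seminorms
   is directed. *)
Definition step_nbhs0 (delta : R) V := exists e l c : R,
  [/\ 0 < e < delta, 0 < l < delta, 0 < c &
  forall phi f, in_step delta f -> extends f phi ->
    (forall z, strip l z -> expR ((delta - e) * cnorm z) * `|f z|c <= c) ->
    V phi].

Definition absolutely_convex V := forall phi psi (a b : R[i]),
  V phi -> V psi -> `|a|c + `|b|c <= 1 -> V (a *: phi + b *: psi).

(* the neighborhoods of 0 that generate the finest locally convex topology
   making all the inclusions of the steps continuous *)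
Definition inductive_nbhs0 V :=
  absolutely_convex V /\ forall delta : R, 0 < delta -> step_nbhs0 delta V.

Definition inductive_open U := forall phi, U phi ->
  exists2 V, inductive_nbhs0 V & forall psi, V psi -> U (phi + psi).

Lemma inductive_nbhs0I U V :
  inductive_nbhs0 U -> inductive_nbhs0 V -> inductive_nbhs0 (U `&` V).
Proof.
move=> [cU sU] [cV sV]; split.
  by move=> phi psi a b [Up Vp] [Uq Vq] ab; split; [exact: cU|exact: cV].
move=> d d0; have [e [l [c [he hl c0 hU]]]] := sU d d0.
have [e' [l' [c' [he' hl' c'0 hV]]]] := sV d d0.
move: (he) (he') (hl) (hl') => /andP[e0 ed] /andP[e'0 e'd] /andP[l0 ld] /andP[l'0 l'd].
exists (Num.min e e'), (Num.max l l'), (Num.min c c').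
have sub (b k m : R) (f : 'rV[R[i]]_n -> R[i]) z :
    Num.min e e' <= b -> k <= Num.max l l' -> Num.min c c' <= m ->
    (forall z, strip (Num.max l l') z ->
      expR ((d - Num.min e e') * cnorm z) * `|f z|c <= Num.min c c') ->
    strip k z -> expR ((d - b) * cnorm z) * `|f z|c <= m.
  move=> hb hk hm hf zk; apply: le_trans hm.
  apply: le_trans (hf z (lt_le_trans zk hk)).
  rewrite ler_wpM2r ?normcE_ge0// ler_expR ler_wpM2r ?sqrtr_ge0//.
  by rewrite lerD2l lerN2.
split=> [|||phi f df ef hf].
- by rewrite lt_min e0 e'0 gt_min ed.
- by rewrite lt_max l0 gt_max ld l'd.
- by rewrite lt_min c0 c'0.
split; [apply: (hU phi f df ef)|apply: (hV phi f df ef)] => z zl;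
  by apply: (sub _ _ _ _ _ _ _ _ hf zl); rewrite ?ge_min ?le_max ?lexx ?orbT.
Qed.

Lemma inductive_nbhs0T : inductive_nbhs0 setT.
Proof.
split=> // d d0; exists (d / 2), (d / 2), 1.
by split=> //; rewrite divr_gt0//= ltr_pdivrMr// ltr_pMr// ltr1n.
Qed.

Lemma inductive_openT : inductive_open setT.
Proof. by move=> phi _; exists setT => //; exact: inductive_nbhs0T. Qed.

Lemma inductive_openI : setI_closed inductive_open.
Proof.
move=> U V oU oV phi [/oU[U' nU' hU] /oV[V' nV' hV]].
exists (U' `&` V'); first exact: inductive_nbhs0I.
by move=> psi [/hU ? /hV ?].
Qed.

Lemma inductive_open_bigU (I : Type) (F : I -> set (testfun R n)) :
  (forall i, inductive_open (F i)) -> inductive_open (\bigcup_i F i).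
Proof.
move=> oF phi [i _ /oF[V nV hV]]; exists V => // psi /hV ?.
by exists i.
Qed.

HB.instance Definition _ := isOpenTopological.Build (testfun R n)
  inductive_openT inductive_openI inductive_open_bigU.

Lemma inductive_openE : (open : set (set (testfun R n))) = inductive_open.
Proof. by []. Qed.

End inductive_topology.

(* the topological dual of P_* *)
Record hyperfunction (R : realType) (n : nat) := Hyperfunction {
  hyper_val :> {linear testfun R n -> R[i]};
  hyper_continuous : continuous hyper_val }.

Section hyperfunctions.
Context {R : realType} {n : nat}.
Implicit Types (u : hyperfunction R n).

Lemma hyperfunctionP u (v : hyperfunction R n) : u =1 v -> u = v.
Proof.
case: u v => [u cu] [v cv] /= /funext.
case: u v cu cv => [u [[mu1] [mu2]]] [v [[mv1] [mv2]]] /= cu cv uv.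
subst v; rewrite (Prop_irrelevance mv1 mu1) (Prop_irrelevance mv2 mu2) in cv *.
by rewrite (Prop_irrelevance cu cv).
Qed.

HB.instance Definition _ := gen_eqMixin (hyperfunction R n).
HB.instance Definition _ := gen_choiceMixin (hyperfunction R n).

Lemma hyper0_continuous :
  continuous ((\0 : {linear testfun R n -> R[i]}) : testfun R n -> R[i]).
Proof. by move=> phi; exact: cst_continuous. Qed.

HB.instance Definition _ := isPointed.Build (hyperfunction R n)
  (Hyperfunction hyper0_continuous).

(* the pairing <u, phi> for a function phi : R^d -> C lying in P_*; it is only
   used on such functions (P_* is stable under differentiation), and the
   value 0 outside P_* is a dummy *)
Definition pairing u (phi : 'rV[R]_n -> R[i]) : R[i] :=
  oapp (u : testfun R n -> R[i]) 0 (insub phi).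

Lemma pairingE u (phi : testfun R n) : pairing u phi = u phi.
Proof. by rewrite /pairing valK. Qed.

(* the translate phi(. - t) of a test function *)
Definition shiftf (t : 'rV[R]_n) (phi : 'rV[R]_n -> R[i]) : 'rV[R]_n -> R[i] :=
  fun x => phi (x - t).

Lemma shift_derive (t v x : 'rV[R]_n) (h : 'rV[R]_n -> R) :
  'D_v (fun y => h (y - t)) x = 'D_v h (x - t).
Proof.
rewrite /derive /=.
under [X in lim (fmap X _)]eq_fun do rewrite -addrA.
by [].
Qed.

Lemma shift_Cdifferentiable t (phi : 'rV[R]_n -> R[i]) :
  (forall x, Cdifferentiable phi x) -> forall x, Cdifferentiable (shiftf t phi) x.
Proof.
move=> dp x; have [dr di] := dp (x - t).
have ds : differentiable (fun y : 'rV[R]_n => y - t) x.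
  by apply: differentiableB => //; exact: differentiable_cst.
split.
  exact: (differentiable_comp ds dr).
exact: (differentiable_comp ds di).
Qed.

Lemma shift_smooth t (phi : 'rV[R]_n -> R[i]) :
  smooth phi -> smooth (shiftf t phi).
Proof.
move=> sp s; rewrite (_ : foldr _ _ s = shiftf t (foldr partial phi s)).
  exact: shift_Cdifferentiable.
elim: s => [//|j s IH] /=; rewrite IH; apply/funext => x.
by rewrite /partial /shiftf !(shift_derive t _ x (fun y => _ (foldr partial phi s y))).
Qed.

Lemma shift_holomorphic t (d : R) (f : 'rV[R[i]]_n -> R[i]) :
  holomorphic_on (strip d) f ->
  holomorphic_on (strip d) (fun z => f (z - toC t)).
Proof.
move=> hf z zd.
have ds : differentiable (fun y : 'rV[R[i]]_n => y - toC t) z.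
  by apply: differentiableB => //; exact: differentiable_cst.
apply: (differentiable_comp ds); apply: hf.
by rewrite /strip /= im_norm_shift.
Qed.

Lemma shift_bound t (k c : R) (f : 'rV[R[i]]_n -> R[i]) (z : 'rV[R[i]]_n) :
  0 <= k -> expR (k * cnorm (z - toC t)) * `|f (z - toC t)|c <= c ->
  expR (k * cnorm z) * `|f (z - toC t)|c <= expR (k * cnorm (toC t)) * c.
Proof.
move=> k0 h; apply: le_trans (_ : expR (k * cnorm (toC t)) *
  (expR (k * cnorm (z - toC t)) * `|f (z - toC t)|c) <= _); last first.
  by rewrite ler_wpM2l ?expR_ge0.
rewrite mulrA ler_wpM2r ?normcE_ge0// -expRD ler_expR -mulrDr ler_wpM2l//.
by have := cnorm_triangle (toC t) (z - toC t); rewrite addrC subrK.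
Qed.

Lemma shift_in_step t (d : R) (f : 'rV[R[i]]_n -> R[i]) :
  in_step d f -> in_step d (fun z => f (z - toC t)).
Proof.
move=> [hf bf]; split=> [|e l he hl]; first exact: shift_holomorphic.
have [M hM] := bf e l he hl.
exists (expR ((d - e) * cnorm (toC t)) * M) => z zl.
apply: shift_bound; first by rewrite subr_ge0; case/andP: he => _ /ltW.
by apply: hM; rewrite /strip /= im_norm_shift.
Qed.

Lemma shift_extends t (f : 'rV[R[i]]_n -> R[i]) phi : extends f phi ->
  extends (fun z => f (z - toC t)) (shiftf t phi).
Proof.
move=> ef x; rewrite /shiftf -ef; congr f.
by apply/rowP => j; rewrite !mxE rmorphB.
Qed.

Lemma shift_Pstar t (phi : testfun R n) : shiftf t phi \in Pstar.
Proof.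
have /asboolP[sp [d d0 [f df ef]]] := testfunP phi.
apply/asboolP; split; first exact: shift_smooth.
exists d => //; exists (fun z => f (z - toC t)); first exact: shift_in_step.
exact: shift_extends.
Qed.

Definition shift_testfun t (phi : testfun R n) : testfun R n :=
  Testfun (shift_Pstar t phi).

Lemma shift_testfun_linear t : linear (shift_testfun t).
Proof. by move=> a phi psi; apply/val_inj. Qed.

HB.instance Definition _ t := GRing.isLinear.Build _ _ _ _ (shift_testfun t)
  (shift_testfun_linear t).

Lemma shift_testfun_continuous t : continuous (shift_testfun t).
Proof.
apply/continuousP => U; rewrite !inductive_openE => oU phi /oU[V [cV sV] hV].
exists (shift_testfun t @^-1` V) => [|psi /hV]; last by rewrite /= linearD.
split=> [f g a b Vf Vg ab|d d0]; first by rewrite /= linearP linearZ; exact: cV.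
have [e [l [c [he hl c0 hc]]]] := sV d d0.
exists e, l, (expR (- ((d - e) * cnorm (toC t))) * c); split=> //.
  by rewrite mulr_gt0// expR_gt0.
move=> psi f df ef hf /=.
apply: (hc _ _ (shift_in_step t df)); first exact: shift_extends.
move=> z zl; rewrite -[leRHS]mul1r -(expRxMexpNx_1 ((d - e) * cnorm (toC t))) -mulrA.
apply: shift_bound; first by rewrite subr_ge0; case/andP: he => _ /ltW.
by apply: hf; rewrite /strip /= im_norm_shift.
Qed.

Lemma shift_hyper_continuous t u :
  continuous ((u \o shift_testfun t : {linear testfun R n -> R[i]})
    : testfun R n -> R[i]).
Proof.
move=> phi; apply: continuous_comp; first exact: shift_testfun_continuous.
exact: hyper_continuous.
Qed.

(* <u(. + t), phi> = <u, phi(. - t)> *)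
Definition shift_hyper t u : hyperfunction R n :=
  Hyperfunction (@shift_hyper_continuous t u).

(* sets {u | <u, phi_j> \in B, j = 1..k}, with B Borel in C *)
Definition cylinder : set (set (hyperfunction R n)) :=
  [set A | exists k (phi : 'I_k -> testfun R n) (B : set R[i]),
    <<s [set O : set R[i] | open O] >> B /\
    A = [set u : hyperfunction R n | forall j, B (u (phi j))]].

End hyperfunctions.

(* the measurable space (Q, C(Q)) *)
Definition Qcyl (R : realType) (n : nat) :=
  g_sigma_algebraType (@cylinder R n).
HB.instance Definition _ (R : realType) (n : nat) := Measurable.on (Qcyl R n).

Section lebesgue_step.
Context {R : realType} (n : nat).
Definition tcons (x : measurableTypeR R * n.-tuple (measurableTypeR R)) :
    n.+1.-tuple (measurableTypeR R) := [tuple of x.1 :: x.2].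

Lemma measurable_tcons : measurable_fun setT tcons.
Proof. exact: measurable_cons. Qed.

Variable m : {sigma_finite_measure set (n.-tuple (measurableTypeR R)) -> \bar R}.

(* image of lambda^1 \x m under the identification of R * R^n with R^(n+1) *)
Definition lebesgue_step : set (n.+1.-tuple (measurableTypeR R)) -> \bar R :=
  pushforward (lebesgue_measure \x m)%E tcons.

Let pm := [the {measure set _ -> \bar R} of (lebesgue_measure \x m)%E].

Let lebesgue_step0 : lebesgue_step set0 = 0%E.
Proof. by rewrite /lebesgue_step /pushforward preimage_set0 (measure0 pm). Qed.

Let lebesgue_step_ge0 A : (0 <= lebesgue_step A)%E.
Proof. exact: (measure_ge0 pm). Qed.

Let lebesgue_step_sigma_additive : semi_sigma_additive lebesgue_step.
Proof.
have mT A : measurable A -> measurable (tcons @^-1` A).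
  by move=> mA; rewrite -[X in measurable X]setTI; exact: measurable_tcons.
move=> F mF tF mUF; rewrite /lebesgue_step /pushforward preimage_bigcup.
apply: (@measure_semi_sigma_additive _ _ _ pm
  (fun k => tcons @^-1` F k)) => [k||]; first exact: mT.
- apply/trivIsetP => /= i j _ _ ij; rewrite -preimage_setI.
  by move/trivIsetP : tF => /(_ _ _ _ _ ij) ->//; rewrite preimage_set0.
- by rewrite -preimage_bigcup; exact: mT.
Qed.

HB.instance Definition _ := isMeasure.Build _ _ _ lebesgue_step
  lebesgue_step0 lebesgue_step_ge0 lebesgue_step_sigma_additive.

Let lebesgue_step_sigma_finite : sigma_finite setT lebesgue_step.
Proof.
have /sigma_finiteP[F [TF ndF Foo]] := sigma_finiteT (@lebesgue_measure R).
have /sigma_finiteP[G [TG ndG Goo]] := sigma_finiteT m.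
have mg : measurable_fun setT (fun t : n.+1.-tuple (measurableTypeR R) =>
    (thead t, [tuple of behead t])).
  by apply: measurable_fun_pair; [exact: measurable_tnth|exact: measurable_behead].
exists (fun k => (fun t => (thead t, [tuple of behead t])) @^-1` (F k `*` G k)).
  rewrite predeqE => t; split=> // _.
  have : [set: measurableTypeR R] (thead t) by [].
  rewrite TF => -[i _ Fi].
  have : [set: n.-tuple (measurableTypeR R)] [tuple of behead t] by [].
  rewrite TG => -[j _ Gj].
  exists (maxn i j) => //; split=> /=.
  - by move: Fi; exact/subsetPset/ndF/leq_maxl.
  - by move: Gj; exact/subsetPset/ndG/leq_maxr.
move=> k; have [mF Fk] := Foo k; have [mG Gk] := Goo k; split.
  by rewrite -[_ @^-1` _]setTI; apply: mg => //; exact: measurableX.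
rewrite /lebesgue_step /pushforward -comp_preimage (_ : _ \o _ = id).
  by rewrite preimage_id product_measure1E// lte_mul_pinfty// ge0_fin_numE.
by apply/funext => -[x t]; congr pair; apply/val_inj.
Qed.

HB.instance Definition _ :=
  Measure_isSigmaFinite.Build _ _ _ lebesgue_step lebesgue_step_sigma_finite.

End lebesgue_step.

(* Lebesgue measure on R^n, with R^n encoded as n-tuples for measure theory *)
Fixpoint lebesgue_tuple {R : realType} (n : nat) :
    {sigma_finite_measure set (n.-tuple (measurableTypeR R)) -> \bar R} :=
  if n is k.+1 then lebesgue_step (lebesgue_tuple k) else \d_([tuple]).

Definition row_of_tuple (R : realType) n (t : n.-tuple (measurableTypeR R)) :
  'rV[R]_n := \row_j tnth t j.

Section complex_integral.
Context {R : realType}.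

Definition cexp (z : R[i]) : R[i] :=
  (expR (complex.Re z))%:C * (cos (complex.Im z) +i* sin (complex.Im z)).

Context {d : measure_display} {T : measurableType d}.
Implicit Types (mu : {measure set T -> \bar R}) (f : T -> R[i]).

Definition Cintegrable mu f :=
  mu.-integrable setT (fun x => (complex.Re (f x))%:E) /\
  mu.-integrable setT (fun x => (complex.Im (f x))%:E).

Definition Cintegral mu f : R[i] :=
  Rintegral mu setT (fun x => complex.Re (f x)) +i*
  Rintegral mu setT (fun x => complex.Im (f x)).

End complex_integral.

Section levy.
Context {R : realType}.
Implicit Types (a gamma : R) (nu : {measure set (measurableTypeR R) -> \bar R}).

Definition levy_measure nu :=
  nu [set 0] = 0%E /\ (\int[nu]_x (Num.min 1 ((x : R) ^+ 2))%:E < +oo)%E.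

Definition levy_exponent a gamma nu (z : R[i]) : R[i] :=
  'i * gamma%:C * z - (a / 2)%:C * z ^+ 2 +
  Cintegral nu (fun x : measurableTypeR R => cexp ('i * (x : R)%:C * z) - 1 -
    'i * (x : R)%:C * z * (\1_[set y : R | `|y| <= 1] (x : R))%:C).

End levy.

Section processes.
Context {R : realType} {n : nat} {d : measure_display} {Omega : measurableType d}.
Implicit Types (P : probability Omega R) (s L : {mfun Omega >-> Qcyl R n}).

Definition char_functional P s (phi : testfun R n) : R[i] :=
  Cintegral (distribution P s)
    (fun u : Qcyl R n => cexp ('i * (u : hyperfunction R n) phi)).

Definition real_testfun (phi : testfun R n) :=
  forall x, complex.Im (phi x) = 0.

Definition real_hyperfunction (u : hyperfunction R n) :=
  forall phi, real_testfun phi -> complex.Im (u phi) = 0.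

(* The values of L on real test functions are real (otherwise exp(i<u, phi>)
   need not be integrable); being complex linear, [L w] then satisfies
   <L, phi> = <L, Re phi> + i <L, Im phi>. Integrability of psi o phi is part of
   the definition because the exponent is meaningless without it, and [Rintegral]
   would return a dummy value. *)
Definition levy_white_noise P (a gamma : R)
    (nu : {measure set (measurableTypeR R) -> \bar R}) L :=
  [/\ 0 <= a, levy_measure nu, forall w, real_hyperfunction (L w) &
  forall phi, real_testfun phi ->
    let psi_phi t := levy_exponent a gamma nu (phi (row_of_tuple t)) in
    Cintegrable (lebesgue_tuple n) psi_phi /\
    char_functional P L phi = cexp (Cintegral (lebesgue_tuple n) psi_phi)].

Definition stationary P s := forall (t : 'rV[R]_n) (A : set (Qcyl R n)),
  measurable A ->
  pushforward P (fun w => shift_hyper t (s w) : Qcyl R n) A =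
  distribution P s A.

End processes.

Section differential_operators.
Context {R : realType} {n : nat}.
Implicit Types (p q : mpoly n R).

Definition Dmonom (m : multinom n) (phi : 'rV[R]_n -> R[i]) :
    'rV[R]_n -> R[i] :=
  foldr (fun j => iter (m j) (partial j)) phi (enum 'I_n).

(* the formal adjoint p(D)^* = p(-D) *)
Definition Dadjoint p (phi : 'rV[R]_n -> R[i]) : 'rV[R]_n -> R[i] := fun x =>
  \sum_(m <- msupp p) (mcoeff m p)%:C * (-1) ^+ mdeg m * Dmonom m phi x.

Definition mpoly_at_i p (z : 'rV[R[i]]_n) : R[i] :=
  mmap (real_complex R) (fun j => 'i * z ord0 j) p.

Definition solves p q {d} {Omega : measurableType d}
    (L s : {mfun Omega >-> Qcyl R n}) :=
  forall w (phi : testfun R n),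
    pairing (s w) (Dadjoint p phi) = pairing (L w) (Dadjoint q phi).

End differential_operators.

(* Main.v *)
Require Import Defs.
From HB Require Import structures.
From mathcomp Require Import all_boot all_order all_algebra.
From mathcomp Require Import -(notations) mpoly.
From mathcomp Require Import all_classical all_reals all_analysis.
From mathcomp Require Import measurable_realfun.
From mathcomp Require Import complex ring lra.
Set Implicit Arguments.
Unset Strict Implicit.
Unset Printing Implicit Defensive.
Import Order.TTheory GRing.Theory Num.Theory.
Import numFieldNormedType.Exports.
Local Open Scope classical_set_scope.
Local Open Scope complex_scope.
Local Open Scope ring_scope.

(** The solution is [s = L \o T] for a continuous real operator [T] on the test
    functions that satisfies [T (p(-D) phi) = q(-D) phi] and commutes with
    translations. On the Fourier side [p(-D)] is multiplication by [p(i xi)], so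
    [T] has to be the Fourier multiplier by the holomorphic extension [h] of
    [q(i xi) / p(i xi)]; [mult h] is this operator, and [realify] averages it with
    its complex conjugate, so that real test functions go to real ones ([p] and [q]
    being real, the average solves the same equation).

    Three facts make [T] act on the test functions. First, the test functions are
    the functions with a holomorphic extension to a tube [|Im z_j| < de] bounded by
    [M exp(- de sum_j |Re z_j|)] ([Pstar_good], [good_Pstar]), and the Fourier
    transform, taken one coordinate at a time, preserves this class with control of
    the constants: decay comes from a shift of the line of integration (Goursat),
    holomorphy from differentiation under the integral sign ([FText_ecl]); inversion
    is proved by Gaussian regularization ([inversion1]). Second, multiplication by
    [h] preserves the class if [h] grows slower than every exponential in some tube
    ([bop_mul]). Third, [h] does so: along a suitable polynomial curve through [z]
    the polynomial [p] has a leading coefficient [A] independent of [z], and the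
    maximum principle applied to [h] times the reversed polynomial gives
    [|A h(z)| <= sup |h p| = sup |q|] on a curve around [z] ([malgrange],
    [tempered_ratio]). Continuity of [T] for the inductive topology is then a
    matter of constants ([lift_continuous]).

    Stationarity: [T] commutes with translations and the integral of the Levy
    exponent is translation invariant, so [s] and its translates have the same
    characteristic functional. The law of a real process is determined by this
    functional ([law_unique]): it gives the expectations of all trigonometric
    polynomials in finitely many coordinates, and indicators of orthants are iterated
    bounded limits of those ([orthant_law]).

    Uniqueness: if [p(i .)] has no zero in the strip, [1/p] is a multiplier too, so
    [p(-D)] is onto the test functions, and the equation prescribes [s w] on its
    range. *)

Notation nc := ComplexField.Normc.normc.

(** * Differentiability in epsilon-delta form *)
Section epsdelta.
Context {K : numFieldType} {V W : normedModType K}.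

Lemma diff_eps (f : V -> W) x : differentiable f x ->
  forall e, 0 < e -> exists2 d, 0 < d &
    forall h, `|h| < d -> `|f (x + h) - f x - 'd f x h| <= e * `|h|.
Proof.
move=> df e e0.
have /eqaddoP/(_ _ e0) := diff_locally df.
move=> /nbhs_ballP[d d0 hd]; exists d => // h hlt.
have /hd : ball 0 d h by rewrite -ball_normE /ball_/= sub0r normrN.
have -> : (f \o shift x - (cst (f x) + 'd f x)) h = f (h + x) - (f x + 'd f x h).
  by [].
by rewrite [h + x]addrC opprD addrA.
Qed.

Lemma eps_diff (f : V -> W) x (df : {linear V -> W}) : continuous df ->
  (forall e, 0 < e -> exists2 d, 0 < d &
    forall h, `|h| < d -> `|f (x + h) - f x - df h| <= e * `|h|) ->
  differentiable f x /\ 'd f x = df :> (V -> W).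
Proof.
move=> cdf H.
have E : f \o shift x = cst (f x) + df +o_ 0 id.
  apply/eqaddoP => e e0; have [d d0 hd] := H e e0.
  apply/nbhs_ballP; exists d => // h; rewrite -ball_normE /ball_ /= sub0r normrN.
  move=> /hd; have -> : (f \o shift x - (cst (f x) + df)) h =
      f (h + x) - (f x + df h) by [].
  by rewrite [h + x]addrC opprD addrA.
have dfE := diff_unique cdf E.
split=> //; apply/diff_locallyP; rewrite dfE; split => //.
Qed.

End epsdelta.

Section complex_norm.
Context {R : realType}.
Implicit Types z w : R[i].

Lemma nc_ge0 z : 0 <= nc z. Proof. by case: z => a b; exact: sqrtr_ge0. Qed.
Hint Resolve nc_ge0 : core.
Lemma normCE z : `|z| = (nc z)%:C. Proof. by case: z. Qed.
Lemma ncD z w : nc (z + w) <= nc z + nc w. Proof. exact: le_normcD. Qed.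
Lemma ncN z : nc (- z) = nc z. Proof. exact: normcN. Qed.
Lemma ncB z w : nc (z - w) <= nc z + nc w.
Proof. by rewrite -[nc w]ncN; exact: ncD. Qed.
Lemma ncBC z w : nc (z - w) = nc (w - z). Proof. by rewrite -ncN opprB. Qed.
Lemma ncM z w : nc (z * w) = nc z * nc w.
Proof. exact: ComplexField.Normc.normcM. Qed.
Lemma ncV z : nc (z^-1) = (nc z)^-1.
Proof. exact: ComplexField.Normc.normcV. Qed.
Lemma nc0 : nc (0 : R[i]) = 0. Proof. exact: ComplexField.Normc.normc0. Qed.
Lemma nc1 : nc (1 : R[i]) = 1. Proof. exact: ComplexField.Normc.normc1. Qed.
Lemma nc_eq0 z : (nc z == 0) = (z == 0).
Proof.
apply/eqP/eqP => [|->]; last exact: nc0.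
exact: ComplexField.Normc.eq0_normc.
Qed.
Lemma ncX z k : nc (z ^+ k) = nc z ^+ k.
Proof. by elim: k => [|k IH]; rewrite ?expr0 ?nc1// !exprS ncM IH. Qed.
Lemma nc_real (x : R) : nc x%:C = `|x|.
Proof. by rewrite /= expr0n/= addr0 sqrtr_sqr. Qed.
Lemma nc_i (x y : R) : nc (x +i* y) = Num.sqrt (x ^+ 2 + y ^+ 2).
Proof. by []. Qed.
Lemma nc_ii : nc ('i%C : R[i]) = 1.
Proof. by rewrite nc_i expr0n expr1n add0r sqrtr1. Qed.
Lemma Re_le z : `|complex.Re z| <= nc z.
Proof.
case: z => a b /=; rewrite -sqrtr_sqr ler_wsqrtr// lerDl; exact: sqr_ge0.
Qed.
Lemma Im_le z : `|complex.Im z| <= nc z.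
Proof.
case: z => a b /=; rewrite -sqrtr_sqr ler_wsqrtr// lerDr; exact: sqr_ge0.
Qed.
Lemma nc_le z : nc z <= `|complex.Re z| + `|complex.Im z|.
Proof.
case: z => a b /=.
rewrite -[leRHS]ger0_norm ?addr_ge0// -sqrtr_sqr ler_wsqrtr//.
rewrite sqrrD -!normrX !(ger0_norm (sqr_ge0 _)) lerD2r lerDl.
by rewrite mulrn_wge0// mulr_ge0.
Qed.
Lemma ncJ z : nc (z^*) = nc z.
Proof. by case: z => a b /=; rewrite sqrrN. Qed.
Lemma ltcR0 (x : R) : ((0 : R[i]) < x%:C) = (0 < x).
Proof. by rewrite (ltcR 0 x). Qed.
Lemma posCE (e : R[i]) : 0 < e -> exists2 r : R, 0 < r & e = r%:C.
Proof. by case: e => a b; rewrite ltcE/= => /andP[/eqP -> a0]; exists a. Qed.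

Lemma normCz_lt z (d : R) : (`|z| < d%:C) = (nc z < d).
Proof. by rewrite normCE ltcR. Qed.

Definition rnorm n (z : 'rV[R[i]]_n) : R := complex.Re `|z|.

Lemma rnormE n (z : 'rV[R[i]]_n) : `|z| = (rnorm z)%:C.
Proof. by rewrite /rnorm RRe_real// normr_real. Qed.

Lemma rnorm_ge0 n (z : 'rV[R[i]]_n) : 0 <= rnorm z.
Proof. by rewrite -ler0c -rnormE. Qed.

Lemma nc_rnorm n (z : 'rV[R[i]]_n) j : nc (z ord0 j) <= rnorm z.
Proof.
rewrite -lecR -rnormE -normCE; change (`|z ord0 j| <= mx_norm z).
rewrite mx_normE -[leLHS]nngE num_le.
exact: (le_bigmax _ (fun ij : 'I_1 * 'I_n => `|z ij.1 ij.2|%:nng) (ord0, j)).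
Qed.

Lemma rnorm_le n (z : 'rV[R[i]]_n) e : 0 <= e ->
  (forall j, nc (z ord0 j) <= e) -> rnorm z <= e.
Proof.
move=> e0 ze; rewrite -lecR -rnormE; change (mx_norm z <= e%:C); rewrite mx_normE.
have e0' : 0 <= (e%:C : R[i]) by rewrite ler0c.
rewrite -[leRHS]/(NngNum e0')%:num num_le; apply/bigmax_leP; split => //.
by move=> [i j] _; rewrite -num_le/= (ord1 i) normCE lecR.
Qed.

End complex_norm.
#[export] Hint Resolve nc_ge0 : core.
#[export] Hint Extern 0 (is_true (_ <= rnorm _)%R) => solve [apply: rnorm_ge0] : core.

(** Locked because unification otherwise unfolds ['d] into its definition by
    choice when comparing derivatives. *)
HB.lock Definition cder (R : realType) (f : R[i] -> R[i]) (z : R[i]) : R[i] := 'd f z 1.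

Section bridges.
Context {R : realType}.
Local Notation C := R[i].

Lemma linear_rV_continuous (K : numFieldType) n (l : {linear 'rV[K]_n -> K^o}) :
  continuous l.
Proof.
have lE : (l : 'rV[K]_n -> K^o) =
    \sum_(j < n) (fun u : 'rV[K]_n => u ord0 j * l (delta_mx ord0 j)).
  apply/funext => u; rewrite {1}(row_sum_delta u) linear_sum fct_sumE.
  by apply: eq_bigr => j _; rewrite linearZ.
rewrite lE => u; apply: differentiable_continuous.
apply: differentiable_sum => j.
apply: (@differentiableM _ _ (fun u : 'rV[K]_n => u ord0 j)).
  exact: differentiable_coord.
exact: differentiable_cst.
Qed.

Lemma holoE n (f : 'rV[C]_n -> C) z : differentiable f z ->
  forall e : R, 0 < e -> exists2 d : R, 0 < d &
    forall h, rnorm h < d -> nc (f (z + h) - f z - 'd f z h) <= e * rnorm h.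
Proof.
move=> df e e0; have := diff_eps df (e := e%:C); rewrite ltcR0 => /(_ e0)[d].
move=> /posCE[r r0 ->] H; exists r => // h hr.
have := H h; rewrite rnormE ltcR => /(_ hr).
by rewrite normCE -(rmorphM (real_complex R)) lecR.
Qed.

Lemma holoI n (f : 'rV[C]_n -> C) z (df : {linear 'rV[C]_n -> C}) :
  (forall e : R, 0 < e -> exists2 d : R, 0 < d &
    forall h, rnorm h < d -> nc (f (z + h) - f z - df h) <= e * rnorm h) ->
  differentiable f z /\ 'd f z = df :> ('rV[C]_n -> C).
Proof.
move=> H; apply: eps_diff; first exact: (@linear_rV_continuous _ _ df).
move=> e' /posCE[e e0 ->]; have [d d0 hd] := H e e0.
exists d%:C; first by rewrite ltcR0.
move=> h; rewrite !rnormE ltcR => /hd.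
by rewrite normCE -(rmorphM (real_complex R)) lecR.
Qed.

Lemma diffC1 (f : C -> C) z h : 'd f z h = h * cder f z.
Proof. by rewrite -[in LHS](mulr1 h) -[h * 1]/(h *: (1 : C^o)) linearZ unlock. Qed.

Lemma choloE (f : C -> C) z : differentiable f z ->
  forall e : R, 0 < e -> exists2 d : R, 0 < d &
    forall h, nc h < d -> nc (f (z + h) - f z - h * cder f z) <= e * nc h.
Proof.
move=> df e e0; have := diff_eps df (e := e%:C); rewrite ltcR0 => /(_ e0)[d].
move=> /posCE[r r0 ->] H; exists r => // h hr.
have := H h; rewrite diffC1 !normCE ltcR => /(_ hr).
by rewrite -(rmorphM (real_complex R)) lecR.
Qed.

Lemma choloI (f : C -> C) z (c : C) :
  (forall e : R, 0 < e -> exists2 d : R, 0 < d &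
    forall h, nc h < d -> nc (f (z + h) - f z - h * c) <= e * nc h) ->
  differentiable f z /\ cder f z = c.
Proof.
move=> H.
suff [? E] : differentiable f z /\
    'd f z = ( *:%R ^~ (c : C^o) : C -> C) :> (C -> C).
  by split=> //; rewrite unlock E scale1r.
have ml : linear (( *:%R ^~ (c : C^o)) : C -> C).
  by move=> k u v; rewrite scalerDl -scalerA.
pose ml1 := GRing.isLinear.Build _ _ _ _ _ ml.
pose l : {linear C -> C} := HB.pack (( *:%R ^~ (c : C^o)) : C -> C) ml1.
apply: (@eps_diff _ _ _ f z l).
  exact: (@scalel_continuous _ _ (c : C^o)).
move=> e' /posCE[e e0 ->]; have [d d0 hd] := H e e0.
exists d%:C; first by rewrite ltcR0.
move=> h; rewrite !normCE ltcR => /hd.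
by rewrite -(rmorphM (real_complex R)) lecR.
Qed.

End bridges.
(** * Complex exponential and restriction to real points *)
Section more_bridges.
Context {R : realType}.
Local Notation C := R[i].

Lemma Re_continuous : continuous (@complex.Re R : C -> R).
Proof.
move=> z A /nbhs_ballP[e e0 eA]; apply/nbhs_ballP; exists e%:C => /=.
  by rewrite ltcR0.
move=> w; rewrite -ball_normE /ball_/= normCE ltcR => h; apply: eA.
by rewrite -ball_normE /ball_/= -raddfB (le_lt_trans (Re_le _)).
Qed.

Lemma Im_continuous : continuous (@complex.Im R : C -> R).
Proof.
move=> z A /nbhs_ballP[e e0 eA]; apply/nbhs_ballP; exists e%:C => /=.
  by rewrite ltcR0.
move=> w; rewrite -ball_normE /ball_/= normCE ltcR => h; apply: eA.
by rewrite -ball_normE /ball_/= -raddfB (le_lt_trans (Im_le _)).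
Qed.

Lemma RtoC_continuous : continuous (fun x : R => x%:C : C).
Proof.
move=> x A /nbhs_ballP[e' /posCE[e e0 ->] eA]; apply/nbhs_ballP; exists e => //.
move=> y; rewrite -ball_normE /ball_/= => h; apply: eA.
by rewrite -ball_normE /ball_/= -rmorphB normCE nc_real ltcR.
Qed.

Lemma cexpD (z w : C) : cexp (z + w) = cexp z * cexp w.
Proof.
rewrite /cexp raddfD/= expRD raddfD/= cosD sinD !rmorphM/=.
set A := expR (complex.Re z); set B := expR (complex.Re w).
rewrite [X in _ = X]mulrACA; congr (_ * _).
by apply/eqP; rewrite eq_complex /=; apply/andP; split; apply/eqP; ring.
Qed.

Lemma nc_cexp (z : C) : nc (cexp z) = expR (complex.Re z).
Proof.
rewrite /cexp ncM nc_real ger0_norm ?expR_ge0// nc_i cos2Dsin2 sqrtr1 mulr1//.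
Qed.

Lemma cexp0 : cexp (0 : C) = 1.
Proof. by rewrite /cexp /= expR0 cos0 sin0 mul1r. Qed.

Lemma is_derive_eps (f : R -> R) (x c : R) : is_derive x 1 f c ->
  forall e : R, 0 < e -> exists2 d : R, 0 < d &
   forall h, `|h| < d -> `|f (x + h) - f x - h * c| <= e * `|h|.
Proof.
move=> [/derivable1_diffP df <-] e e0; have [d d0 H] := diff_eps df e0.
exists d => // h /H; congr (`|_ - _| <= _).
by rewrite -[in LHS](mulr1 h) -[h * 1]/(h *: (1 : R^o)) linearZ/= -deriveE.
Qed.

(** By [cexpD] only the origin matters; there the real expansions of [exp], [cos]
    and [sin] combine. *)
Lemma cexp_diff (z : C) : differentiable cexp z /\ cder cexp z = cexp z.
Proof.
apply: choloI => e e0.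
pose M := expR (complex.Re z).
have M0 : 0 < M by exact: expR_gt0.
pose e1 := Num.min 1 (e / (10%:R * M)).
have e10 : 0 < e1 by rewrite lt_min ltr01 divr_gt0// mulr_gt0.
have e11 : e1 <= 1 by rewrite ge_min lexx.
have e1e : 10%:R * M * e1 <= e.
  by rewrite -ler_pdivlMl ?mulr_gt0// mulrC ge_min lexx orbT.
clearbody e1.
have [d1 d10 H1] := is_derive_eps (is_derive_expR (0 : R)) e10.
have [d2 d20 H2] := is_derive_eps (is_derive_cos (0 : R)) e10.
have [d3 d30 H3] := is_derive_eps (is_derive_sin (0 : R)) e10.
exists (Num.min e1 (Num.min d1 (Num.min d2 d3))).
  by rewrite !lt_min e10 d10 d20.
move=> h; rewrite !lt_min => /and4P[he h1 h2 h3].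
rewrite cexpD (_ : _ - _ - _ = cexp z * (cexp h - 1 - h)); last by ring.
rewrite ncM nc_cexp -/M.
suff H : nc (cexp h - 1 - h) <= 10%:R * e1 * nc h.
  apply: le_trans (_ : M * (10%:R * e1 * nc h) <= _); first by rewrite ler_pM2l.
  have -> : M * (10%:R * e1 * nc h) = 10%:R * M * e1 * nc h by ring.
  apply: ler_wpM2r; [exact: nc_ge0|exact: e1e].
have hR := Re_le h; have hI := Im_le h.
have N0 := nc_ge0 h; set N := nc h in he h1 h2 h3 hR hI N0 *; clearbody N.
apply: le_trans (nc_le _) _; case: h hR hI => a b /= hR hI.
have {}H1 := H1 a (le_lt_trans hR h1).
have {}H2 := H2 b (le_lt_trans hI h2).
have {}H3 := H3 b (le_lt_trans hI h3).
move: H1 H2 H3; rewrite !add0r expR0 cos0 sin0 oppr0 mulr0 !subr0 ?addr0 !mulr1 => H1 H2 H3.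
have aE : `|expR a - 1| <= 2%:R * N.
  have -> : expR a - 1 = (expR a - 1 - a) + a by ring.
  apply: le_trans (ler_normD _ _) _.
  have : e1 * `|a| <= N by apply: le_trans hR; rewrite ler_piMl.
  lra.
have aE3 : `|expR a| <= 3%:R.
  have -> : expR a = (expR a - 1) + 1 by ring.
  by apply: le_trans (ler_normD _ _) _; rewrite normr1; lra.
have -> : expR a * cos b - 0 * sin b - 1 - a =
   expR a * (cos b - 1) + (expR a - 1 - a) by ring.
rewrite ?subr0 ?addr0.
have -> : expR a * sin b + 0 * cos b - b =
   expR a * (sin b - b) + (expR a - 1) * b by ring.
have ea : e1 * `|a| <= e1 * N by rewrite ler_wpM2l// ltW.
have eb : e1 * `|b| <= e1 * N by rewrite ler_wpM2l// ltW.
have T1 : `|expR a * (cos b - 1)| <= 3%:R * (e1 * N).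
  rewrite normrM ler_pM//; exact: le_trans H2 eb.
have T2 : `|expR a * (sin b - b)| <= 3%:R * (e1 * N).
  rewrite normrM ler_pM//; exact: le_trans H3 eb.
have T3 : `|(expR a - 1) * b| <= 2%:R * (e1 * N).
  rewrite normrM (le_trans (ler_pM _ _ aE hI))// -mulrA ler_pM2l//.
  by rewrite ler_wpM2r// ltW.
have : 0 <= e1 * N by rewrite mulr_ge0// ltW.
have := ler_normD (expR a * (cos b - 1)) (expR a - 1 - a).
have := ler_normD (expR a * (sin b - b)) ((expR a - 1) * b).
lra.
Qed.

Lemma rnorm_toC n (h : 'rV[R]_n) : rnorm (toC h) <= `|h|.
Proof.
apply: rnorm_le => // j; rewrite mxE nc_real.
change (`|h ord0 j| <= mx_norm h).
rewrite mx_normE -[leLHS]nngE num_le.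
exact: (le_bigmax _ (fun ij : 'I_1 * 'I_n => `|h ij.1 ij.2|%:nng) (ord0, j)).
Qed.

Lemma toCD n (x y : 'rV[R]_n) : toC (x + y) = toC x + toC y.
Proof. by apply/rowP => j; rewrite !mxE rmorphD. Qed.
Lemma toCZ n (a : R) (x : 'rV[R]_n) : toC (a *: x) = a%:C *: toC x.
Proof. by apply/rowP => j; rewrite !mxE rmorphM. Qed.
Lemma toC_delta n (j : 'I_n) : toC (delta_mx ord0 j : 'rV[R]_n) = delta_mx ord0 j.
Proof. by apply/rowP => k; rewrite !mxE; case: (_ && _). Qed.

(** The real partial derivatives of a function with a holomorphic extension are
    values of the complex differential: the expansion of [f] at [toC x] restricts to
    real increments, and [Re], [Im] are 1-Lipschitz. *)
Lemma diff_ext n (f : 'rV[C]_n -> C) (phi : 'rV[R]_n -> C) (x : 'rV[R]_n) :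
  differentiable f (toC x) -> extends f phi -> Cdifferentiable phi x /\
  forall j, partial j phi x = 'd f (toC x) (delta_mx ord0 j).
Proof.
move=> df ef; have E := holoE df.
have H (re : C -> R) : (forall z, `|re z| <= nc z) ->
    (forall z w, re (z + w) = re z + re w) -> (forall z w, re (z - w) = re z - re w) ->
    (forall k z, re (k%:C * z) = k * re z) ->
    differentiable (fun y => re (phi y)) x /\
    'd (fun y => re (phi y)) x = (fun v => re ('d f (toC x) (toC v))) :> ('rV[R]_n -> R).
  move=> hre reD reB reZ.
  have ml : linear (fun v : 'rV[R]_n => re ('d f (toC x) (toC v)) : R).
    move=> k u v; rewrite toCD toCZ linearD linearZ/=.
    by rewrite reD -[_ *: 'd f _ _]/(_ * _) reZ.
  pose ml1 := GRing.isLinear.Build _ _ _ _ _ ml.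
  pose l : {linear 'rV[R]_n -> R} := HB.pack (fun v : 'rV[R]_n => re ('d f (toC x) (toC v)) : R) ml1.
  apply: (@eps_diff _ _ _ _ x l).
    exact: (@linear_rV_continuous _ _ l).
  move=> e e0; have [d d0 Hd] := E e e0; exists d => // h hd.
  have := Hd (toC h) (le_lt_trans (rnorm_toC h) hd).
  rewrite -toCD !ef => h1.
  rewrite /l /= -!reB (le_trans (hre _))// (le_trans h1)//.
  by rewrite ler_pM2l// rnorm_toC.
have [dr Er] := H (@complex.Re R) (@Re_le R) (raddfD _) (raddfB _)
  ltac:(by move=> k [u v]; rewrite /= mul0r subr0).
have [di Ei] := H (@complex.Im R) (@Im_le R) (raddfD _) (raddfB _)
  ltac:(by move=> k [u v]; rewrite /= mul0r addr0).
split; first by split.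
move=> j; rewrite /partial !deriveE//.
by rewrite Er Ei toC_delta; case: ('d f _ _).
Qed.

End more_bridges.

(** * Integrals of complex-valued functions *)
Section cint.
Context {R : realType} {d : measure_display} {T : measurableType d}.
Variable mu : {measure set T -> \bar R}.
Local Notation C := R[i].
Implicit Types (D : set T) (f g : T -> C) (G : T -> R).

Definition cint D f : C :=
  Rintegral mu D (fun x => complex.Re (f x)) +i*
  Rintegral mu D (fun x => complex.Im (f x)).

Definition cmeas D f := measurable_fun D (fun x => complex.Re (f x)) /\
  measurable_fun D (fun x => complex.Im (f x)).

Definition cintable D f :=
  mu.-integrable D (fun x => (complex.Re (f x))%:E) /\
  mu.-integrable D (fun x => (complex.Im (f x))%:E).

Lemma eq_cint D f g : (forall x, D x -> f x = g x) -> cint D f = cint D g.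
Proof.
move=> fg; rewrite /cint; congr (_ +i* _);
by apply: eq_Rintegral => x /set_mem Dx; rewrite fg.
Qed.

Lemma eq_cintable D f g : measurable D -> (forall x, D x -> f x = g x) ->
  cintable D f -> cintable D g.
Proof.
move=> mD fg [h1 h2]; split; [apply: eq_integrable h1|apply: eq_integrable h2] => //;
by move=> x /set_mem Dx; rewrite fg.
Qed.

Lemma cintable_meas D f : cintable D f -> cmeas D f.
Proof. by move=> [/measurable_int/measurable_EFinP ? /measurable_int/measurable_EFinP]. Qed.

Lemma le_cintable D f G : measurable D -> cmeas D f ->
  mu.-integrable D (EFin \o G) -> (forall x, D x -> nc (f x) <= G x) -> cintable D f.
Proof.
move=> mD [mr mi] iG fG; split; apply: le_integrable iG => //.
- exact/measurable_EFinP.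
- move=> x Dx; rewrite /= lee_fin (le_trans (Re_le _))//.
  by rewrite (le_trans (fG x Dx))// ler_norm.
- exact/measurable_EFinP.
- move=> x Dx; rewrite /= lee_fin (le_trans (Im_le _))//.
  by rewrite (le_trans (fG x Dx))// ler_norm.
Qed.

Lemma cintD D f g : measurable D -> cintable D f -> cintable D g ->
  cint D (fun x => f x + g x) = cint D f + cint D g.
Proof.
move=> mD [fr fi] [gr gi]; rewrite /cint.
under eq_Rintegral do rewrite raddfD.
under [X in _ +i* X]eq_Rintegral do rewrite raddfD.
by rewrite !RintegralD.
Qed.

Lemma cintableD D f g : measurable D -> cintable D f -> cintable D g ->
  cintable D (fun x => f x + g x).
Proof.
move=> mD [fr fi] [gr gi]; split.
  under eq_fun do rewrite raddfD EFinD; exact: integrableD.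
under eq_fun do rewrite raddfD EFinD; exact: integrableD.
Qed.

Lemma RintZ D (c : R) G : measurable D -> mu.-integrable D (EFin \o G) ->
  mu.-integrable D (EFin \o (fun x => c * G x)).
Proof.
move=> mD iG; rewrite (_ : _ \o _ = (fun x => c%:E * (EFin \o G) x)%E)//.
exact: integrableZl.
Qed.

Lemma cintableZ D (c : C) f : measurable D -> cintable D f ->
  cintable D (fun x => c * f x).
Proof.
move=> mD [fr fi]; case: c => a b; split.
  rewrite (_ : (fun x => _) = ((fun x => (a * complex.Re (f x))%:E) \-
    (fun x => (b * complex.Im (f x))%:E))%E).
    by apply: integrableB => //; exact: RintZ.
  by apply/funext => x; rewrite -EFinB; case: (f x).
rewrite (_ : (fun x => _) = ((fun x => (a * complex.Im (f x))%:E) \+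
    (fun x => (b * complex.Re (f x))%:E))%E).
  by apply: integrableD => //; exact: RintZ.
by apply/funext => x; rewrite -EFinD; case: (f x).
Qed.

Lemma cintZ D (c : C) f : measurable D -> cintable D f ->
  cint D (fun x => c * f x) = c * cint D f.
Proof.
move=> mD [fr fi]; case: c => a b; rewrite /cint.
have -> : Rintegral mu D (fun x => complex.Re ((a +i* b) * f x)) =
   Rintegral mu D (fun x => a * complex.Re (f x) - b * complex.Im (f x)).
  by apply: eq_Rintegral => x _; case: (f x).
have -> : Rintegral mu D (fun x => complex.Im ((a +i* b) * f x)) =
   Rintegral mu D (fun x => a * complex.Im (f x) + b * complex.Re (f x)).
  by apply: eq_Rintegral => x _; case: (f x).
rewrite RintegralB ?RintegralD//; try exact: RintZ.
by rewrite !RintegralZl.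
Qed.

Lemma cintableN D f : measurable D -> cintable D f -> cintable D (fun x => - f x).
Proof.
move=> mD fi; apply: eq_cintable (cintableZ (-1) mD fi) => // x _.
by rewrite mulN1r.
Qed.

Lemma cintN D f : measurable D -> cintable D f -> cint D (fun x => - f x) = - cint D f.
Proof.
move=> mD fi; rewrite -mulN1r -cintZ//.
by apply: eq_cint => x _; rewrite mulN1r.
Qed.

Lemma cintableB D f g : measurable D -> cintable D f -> cintable D g ->
  cintable D (fun x => f x - g x).
Proof. by move=> mD fi gi; apply: cintableD => //; exact: cintableN. Qed.

Lemma cintB D f g : measurable D -> cintable D f -> cintable D g ->
  cint D (fun x => f x - g x) = cint D f - cint D g.
Proof. by move=> mD fi gi; rewrite cintD ?cintN//; exact: cintableN. Qed.

(** Rotating the integral to the positive real axis reduces the bound to the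
    integral of a real part. *)
Lemma cint_norm D f G : measurable D -> cintable D f ->
  mu.-integrable D (EFin \o G) -> (forall x, D x -> nc (f x) <= G x) ->
  nc (cint D f) <= Rintegral mu D G.
Proof.
move=> mD fi iG fG; have [z0|zn0] := eqVneq (cint D f) 0.
  rewrite z0 nc0; apply: Rintegral_ge0 => x Dx.
  exact: le_trans (nc_ge0 _) (fG x Dx).
set z := cint D f in zn0 *.
have nz0 : 0 < nc z by rewrite lt_neqAle nc_ge0 andbT eq_sym nc_eq0.
pose u := z^* / (nc z)%:C.
have nu : nc u = 1.
  by rewrite ncM ncV ncJ nc_real ger0_norm ?nc_ge0// divff ?gt_eqF.
have uz : u * z = (nc z)%:C.
  rewrite /u mulrAC mulrC [z^* * z]mulrC -sqr_normc normCE -!(rmorphXn, fmorphV).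
  by rewrite -rmorphM/= expr2 mulKf// gt_eqF.
have -> : nc z = Rintegral mu D (fun x => complex.Re (u * f x)).
  by rewrite -[LHS]/(complex.Re (nc z)%:C) -uz -cintZ.
apply: le_Rintegral => //; first by case: (cintableZ u mD fi).
move=> x Dx; apply: le_trans (fG x Dx).
by apply: le_trans (ler_norm _) _; rewrite (le_trans (Re_le _))// ncM nu mul1r.
Qed.

Definition clim (u : nat -> C) (l : C) :=
  forall e : R, 0 < e -> \forall n \near \oo, nc (u n - l) <= e.

Lemma clim_unique u l l' : clim u l -> clim u l' -> l = l'.
Proof.
move=> h h'; apply/eqP; rewrite -subr_eq0 -nc_eq0; apply/eqP.
apply/eqP; rewrite eq_le nc_ge0 andbT; apply/ler_addgt0Pr => e e0; rewrite add0r.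
have e2 : 0 < e / 2 by rewrite divr_gt0.
have [n [/= h1 h2]] := @filter_ex _ _ (eventually_filter) _ (filterI (h _ e2) (h' _ e2)).
rewrite (_ : l - l' = (u n - l') - (u n - l)); last by ring.
by rewrite (le_trans (ncB _ _))// (splitr e) lerD.
Qed.

Lemma cint_dct D (f_ : nat -> T -> C) f G : measurable D ->
  (forall n, cmeas D (f_ n)) -> cmeas D f ->
  mu.-integrable D (EFin \o G) ->
  (forall n x, D x -> nc (f_ n x) <= G x) ->
  (forall x, D x -> clim (f_ ^~ x) (f x)) ->
  clim (fun n => cint D (f_ n)) (cint D f).
Proof.
move=> mD mf_ mf iG fG cf.
have fG' x : D x -> nc (f x) <= G x.
  move=> Dx; apply/ler_addgt0Pr => e e0.
  have [n /= hn] := @filter_ex _ _ (eventually_filter) _ (cf x Dx _ e0).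
  rewrite (_ : f x = f_ n x - (f_ n x - f x)); last by ring.
  by rewrite (le_trans (ncB _ _))// lerD// fG.
have fi n : cintable D (f_ n) by exact: (le_cintable mD (mf_ n) iG (fG n)).
have fi' : cintable D f by exact: (le_cintable mD mf iG fG').
have [Hr _] : (forall e : R, 0 < e -> \forall n \near \oo,
   `|complex.Re (cint D (f_ n)) - complex.Re (cint D f)| <= e) /\ True.
  split=> //.
  have [_ _ ] := @dominated_convergence _ _ _ mu D mD (fun n x => (complex.Re (f_ n x))%:E)
     (fun x => (complex.Re (f x))%:E) (EFin \o G)
     (fun n => (measurable_EFinP _ _).2 (mf_ n).1) ((measurable_EFinP _ _).2 mf.1)
     ltac:(apply: aeW => x Dx; apply/fine_cvgP; split; [exact: nearW|apply/cvgrPdist_le => e e0;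
        apply: filterS (cf x Dx _ e0) => n hn /=; rewrite distrC -raddfB (le_trans (Re_le _))//])
     iG ltac:(apply: aeW => x n Dx /=; rewrite lee_fin (le_trans (Re_le _))// fG//).
  rewrite -[X in _ --> X](fineK (integrable_fin_num mD fi'.1)).
  move=> /fine_cvgP[_ /cvgrPdist_le h] e e0.
  by apply: filterS (h e e0) => n; rewrite distrC.
have [Hi _] : (forall e : R, 0 < e -> \forall n \near \oo,
   `|complex.Im (cint D (f_ n)) - complex.Im (cint D f)| <= e) /\ True.
  split=> //.
  have [_ _ ] := @dominated_convergence _ _ _ mu D mD (fun n x => (complex.Im (f_ n x))%:E)
     (fun x => (complex.Im (f x))%:E) (EFin \o G)
     (fun n => (measurable_EFinP _ _).2 (mf_ n).2) ((measurable_EFinP _ _).2 mf.2)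
     ltac:(apply: aeW => x Dx; apply/fine_cvgP; split; [exact: nearW|apply/cvgrPdist_le => e e0;
        apply: filterS (cf x Dx _ e0) => n hn /=; rewrite distrC -raddfB (le_trans (Im_le _))//])
     iG ltac:(apply: aeW => x n Dx /=; rewrite lee_fin (le_trans (Im_le _))// fG//).
  rewrite -[X in _ --> X](fineK (integrable_fin_num mD fi'.2)).
  move=> /fine_cvgP[_ /cvgrPdist_le h] e e0.
  by apply: filterS (h e e0) => n; rewrite distrC.
move=> e e0; have e2 : 0 < e / 2 by rewrite divr_gt0.
apply: filterS2 (Hr _ e2) (Hi _ e2) => n h1 h2.
by rewrite (le_trans (nc_le _))// !raddfB (splitr e) lerD.
Unshelve. all: by end_near. Qed.

End cint.
(** * Goursat theorem on rectangles *)
Section bisection.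
Context {R : realType}.

Lemma small_half (w d : R) : 0 < d -> exists n, w / 2 ^+ n < d.
Proof.
move=> d0; exists (Num.truncn `|w / d|).+1.
rewrite ltr_pdivrMr ?exprn_gt0// mulrC -ltr_pdivrMr//.
apply: le_lt_trans (ler_norm _) _.
apply: lt_le_trans (truncnS_gt _) _.
rewrite -natrX ler_nat ltnW//; exact: ltn_expl.
Qed.

(** A function of rectangles that is additive under subdivision and is
    [o(diameter^2)] at every point vanishes: otherwise repeated halving keeps at
    least a quarter of its modulus, and the nested rectangles shrink to a point where
    this contradicts the local bound. *)
Lemma bisection (Phi : R -> R -> R -> R -> R[i]) (a b c d : R) :
  a <= b -> c <= d ->
  (forall a' m b' c' d', a <= a' -> a' <= m -> m <= b' -> b' <= b -> c <= c' -> c' <= d' -> d' <= d ->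
     Phi a' b' c' d' = Phi a' m c' d' + Phi m b' c' d') ->
  (forall a' b' c' m d', a <= a' -> a' <= b' -> b' <= b -> c <= c' -> c' <= m -> m <= d' -> d' <= d ->
     Phi a' b' c' d' = Phi a' b' c' m + Phi a' b' m d') ->
  (forall x y, a <= x <= b -> c <= y <= d -> forall e : R, 0 < e -> exists2 r : R, 0 < r &
     forall a' b' c' d', a <= a' -> a' <= x -> x <= b' -> b' <= b ->
       c <= c' -> c' <= y -> y <= d' -> d' <= d -> b' - a' < r -> d' - c' < r ->
       nc (Phi a' b' c' d') <= e * ((b' - a') + (d' - c')) ^+ 2) ->
  Phi a b c d = 0.
Proof.
move=> ab cd Hx Hy Hl; apply: contrapT => /eqP Phi0.
have K0 : 0 < nc (Phi a b c d) by rewrite lt_neqAle nc_ge0 andbT eq_sym nc_eq0.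
pose ok (r : R * R * R * R) := let: (a', b', c', d') := r in
  [/\ a <= a', a' <= b', b' <= b, c <= c' & c' <= d' /\ d' <= d].
pose Phi' (r : R * R * R * R) := let: (a', b', c', d') := r in Phi a' b' c' d'.
pose rel (r r' : {r | ok r}) := let: (a1, b1, c1, d1) := proj1_sig r in
  let: (a2, b2, c2, d2) := proj1_sig r' in
  [/\ a1 <= a2, b2 <= b1, c1 <= c2, d2 <= d1 &
  [/\ b2 - a2 = (b1 - a1) / 2, d2 - c2 = (d1 - c1) / 2 &
      nc (Phi' (proj1_sig r)) <= 4 * nc (Phi' (proj1_sig r'))]].
have step r : {r' | rel r r'}.
  apply: cid; case: r => [[[[a1 b1] c1] d1] /=] okr.
  have [h1 h2 h3 h4 [h5 h6]] := okr.
  pose m := (a1 + b1) / 2; pose k := (c1 + d1) / 2.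
  have m1 : a1 <= m by rewrite /m; lra.
  have m2 : m <= b1 by rewrite /m; lra.
  have k1 : c1 <= k by rewrite /k; lra.
  have k2 : k <= d1 by rewrite /k; lra.
  have am := le_trans h1 m1; have mb := le_trans m2 h3.
  have ck := le_trans h4 k1; have kd := le_trans k2 h6.
  have E : Phi a1 b1 c1 d1 = Phi a1 m c1 k + Phi a1 m k d1 + (Phi m b1 c1 k + Phi m b1 k d1).
    by rewrite (Hx a1 m b1 c1 d1)// (Hy a1 m c1 k d1)// (Hy m b1 c1 k d1).
  have [H|H] := leP (nc (Phi a1 b1 c1 d1)) (4 * nc (Phi a1 m c1 k)).
    have okr' : ok (a1, m, c1, k) by split.
    exists (exist _ _ okr'); by split=> //=; split=> //; rewrite /m /k; lra.
  have [H'|H'] := leP (nc (Phi a1 b1 c1 d1)) (4 * nc (Phi a1 m k d1)).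
    have okr' : ok (a1, m, k, d1) by split.
    exists (exist _ _ okr'); by split=> //=; split=> //; rewrite /m /k; lra.
  have [H2|H2] := leP (nc (Phi a1 b1 c1 d1)) (4 * nc (Phi m b1 c1 k)).
    have okr' : ok (m, b1, c1, k) by split.
    exists (exist _ _ okr'); by split=> //=; split=> //; rewrite /m /k; lra.
  have [H3|H3] := leP (nc (Phi a1 b1 c1 d1)) (4 * nc (Phi m b1 k d1)).
    have okr' : ok (m, b1, k, d1) by split.
    exists (exist _ _ okr'); by split=> //=; split=> //; rewrite /m /k; lra.
  exfalso.
  have : nc (Phi a1 b1 c1 d1) <= nc (Phi a1 m c1 k) + nc (Phi a1 m k d1) +
       (nc (Phi m b1 c1 k) + nc (Phi m b1 k d1)).
    by rewrite {1}E (le_trans (ncD _ _))// lerD// ncD.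
  lra.
have ok0 : ok (a, b, c, d) by [].
have [F [F0 FS]] := dependent_choice step (exist _ _ ok0).
pose A n := (proj1_sig (F n)).1.1.1; pose B n := (proj1_sig (F n)).1.1.2.
pose Cc n := (proj1_sig (F n)).1.2; pose D n := (proj1_sig (F n)).2.
have FE n : proj1_sig (F n) = (A n, B n, Cc n, D n).
  by rewrite /A /B /Cc /D; case: (proj1_sig (F n)) => [[[]]].
have okn n : ok (A n, B n, Cc n, D n) by rewrite -FE; exact: proj2_sig (F n).
have AS n : [/\ A n <= A n.+1, B n.+1 <= B n, Cc n <= Cc n.+1, D n.+1 <= D n &
  [/\ B n.+1 - A n.+1 = (B n - A n) / 2, D n.+1 - Cc n.+1 = (D n - Cc n) / 2 &
      nc (Phi (A n) (B n) (Cc n) (D n)) <= 4 * nc (Phi (A n.+1) (B n.+1) (Cc n.+1) (D n.+1))]].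
  by have := FS n; rewrite /rel !FE.
have inv n : [/\ B n - A n = (b - a) / 2 ^+ n, D n - Cc n = (d - c) / 2 ^+ n &
    nc (Phi a b c d) / 4 ^+ n <= nc (Phi (A n) (B n) (Cc n) (D n))].
  elim: n => [|n [i1 i2 i3]].
    by rewrite /A /B /Cc /D F0/= !expr0 !divr1.
  have [_ _ _ _ [-> -> i4]] := AS n; rewrite i1 i2 !exprS !invfM; split.
  - by rewrite mulrCA mulrC.
  - by rewrite mulrCA mulrC.
  - by rewrite mulrCA ler_pdivrMl// (le_trans i3).
have monoA m n : (m <= n)%N -> A m <= A n.
  elim: n => [|n IH]; first by rewrite leqn0 => /eqP ->.
  rewrite leq_eqVlt ltnS => /predU1P[->//|/IH h]; apply: le_trans h _.
  by have [] := AS n.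
have monoB m n : (m <= n)%N -> B n <= B m.
  elim: n => [|n IH]; first by rewrite leqn0 => /eqP ->.
  rewrite leq_eqVlt ltnS => /predU1P[->//|/IH h]; apply: le_trans h.
  by have [] := AS n.
have monoC m n : (m <= n)%N -> Cc m <= Cc n.
  elim: n => [|n IH]; first by rewrite leqn0 => /eqP ->.
  rewrite leq_eqVlt ltnS => /predU1P[->//|/IH h]; apply: le_trans h _.
  by have [] := AS n.
have monoD m n : (m <= n)%N -> D n <= D m.
  elim: n => [|n IH]; first by rewrite leqn0 => /eqP ->.
  rewrite leq_eqVlt ltnS => /predU1P[->//|/IH h]; apply: le_trans h.
  by have [] := AS n.
have AB m n : A m <= B n.
  apply: le_trans (monoA _ _ (leq_maxl m n)) _.
  apply: le_trans (monoB _ _ (leq_maxr m n)).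
  by have [] := okn (maxn m n).
have CD m n : Cc m <= D n.
  apply: le_trans (monoC _ _ (leq_maxl m n)) _.
  apply: le_trans (monoD _ _ (leq_maxr m n)).
  by have [_ _ _ _ []] := okn (maxn m n).
pose x := sup (range A); pose y := sup (range Cc).
have Ax n : A n <= x.
  apply: ub_le_sup; last by exists n.
  by exists (B 0%N) => _ [k _ <-].
have xB n : x <= B n by apply: ge_sup => [|_ [k _ <-]//]; exists (A 0%N), 0%N.
have Cy n : Cc n <= y.
  apply: ub_le_sup; last by exists n.
  by exists (D 0%N) => _ [k _ <-].
have yD n : y <= D n by apply: ge_sup => [|_ [k _ <-]//]; exists (Cc 0%N), 0%N.
have [A0 B0 C0 D0] : [/\ A 0%N = a, B 0%N = b, Cc 0%N = c & D 0%N = d].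
  by rewrite /A /B /Cc /D F0.
set K := nc (Phi a b c d) in K0 inv.
pose S := (b - a) + (d - c).
have S0 : 0 <= S by rewrite /S; lra.
pose e := K / (2 * (S ^+ 2 + 1)).
have e0 : 0 < e by rewrite divr_gt0// mulr_gt0// ltr_wpDl// sqr_ge0.
have [r r0 Hr] := Hl x y ltac:(by rewrite -A0 -B0 Ax xB) ltac:(by rewrite -C0 -D0 Cy yD) e e0.
have [n nr] := small_half S r0.
have [i1 i2 i3] := inv n; have [q1 q2 q3 q4 [q5 q6]] := okn n.
have p0 : 0 < 2 ^+ n :> R by rewrite exprn_gt0.
have := Hr _ _ _ _ q1 (Ax n) (xB n) q3 q4 (Cy n) (yD n) q6.
have wr : (b - a) / 2 ^+ n < r.
  by apply: le_lt_trans nr; rewrite ler_pM2r ?invr_gt0// /S; lra.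
have hr : (d - c) / 2 ^+ n < r.
  by apply: le_lt_trans nr; rewrite ler_pM2r ?invr_gt0// /S; lra.
rewrite i1 i2 => /(_ wr hr) h; have := le_trans i3 h.
rewrite -mulrDl -/S expr_div_n -exprM mulnC exprM (_ : 2 ^+ 2 = 4 :> R); last by rewrite expr2; ring.
rewrite mulrA ler_pM2r ?invr_gt0 ?exprn_gt0//.
rewrite /e => h'; have : K * (2 * (S ^+ 2 + 1)) <= K * S ^+ 2.
  rewrite -ler_pdivlMr; last by rewrite mulr_gt0// ltr_wpDl// sqr_ge0.
  by rewrite mulrAC.
rewrite ler_pM2l//; have := sqr_ge0 S; lra.
Qed.
End bisection.
Section goursat.
Context {R : realType}.
Local Notation C := R[i].
Local Notation leb := (@lebesgue_measure R).

Definition LI (a b : R) (f : R -> C) : C := cint leb `[a, b] f.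

Lemma hcont (c : R) : continuous (fun t : R => t +i* c : C).
Proof.
move=> t; rewrite (_ : (fun t : R => _) = (fun t => t%:C + (0 +i* c))); last first.
  by apply/funext => u; rewrite /= -[RHS]/((_ + _) +i* (_ + _)) addr0 add0r.
by apply: cvgD; [exact: RtoC_continuous|exact: cvg_cst].
Qed.

Lemma vcont (b : R) : continuous (fun s : R => b +i* s : C).
Proof.
move=> t; rewrite (_ : (fun t : R => _) = (fun t => b%:C + 'i%C * t%:C)); last first.
  apply/funext => u; rewrite /= -[RHS]/((_ + _) +i* (_ + _)).
  by apply/eqP; rewrite eq_complex/=; apply/andP; split; apply/eqP; ring.
apply: cvgD; first exact: cvg_cst.
by apply: cvgM; [exact: cvg_cst|exact: RtoC_continuous].
Qed.

Lemma cont_within (a b : R) (f : R -> C) :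
  (forall t, a <= t <= b -> {for t, continuous f}) -> {within `[a, b], continuous f}.
Proof.
move=> H; apply: continuous_in_subspaceT => t; rewrite inE/= in_itv/= => /H.
by [].
Qed.

Lemma LI_intable (a b : R) (f : R -> C) :
  {within `[a, b], continuous f} -> cintable leb `[a, b] f.
Proof.
move=> cf; split; apply: continuous_compact_integrable => //.
- exact: segment_compact.
- by move=> t; apply: continuous_comp; [exact: cf|exact: Re_continuous].
- exact: segment_compact.
- by move=> t; apply: continuous_comp; [exact: cf|exact: Im_continuous].
Qed.

Lemma LI_split (a m b : R) (f : R -> C) : a <= m -> m <= b ->
  cintable leb `[a, b] f -> LI a b f = LI a m f + LI m b f.
Proof.
move=> am mb [fr fi]; rewrite /LI /cint.
have H (g : R -> R) : leb.-integrable `[a, b] (EFin \o g) ->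
   Rintegral leb `[a, b] g = Rintegral leb `[a, m] g + Rintegral leb `[m, b] g.
  move=> ig; have := @Rintegral_itvB _ g (BLeft a) (BRight b) m ig.
  rewrite !bnd_simp => /(_ am mb) E.
  rewrite -[X in _ + X]Rintegral_itv_obnd_cbnd; last first.
    by apply: integrableS ig => //; apply: subset_itv; rewrite bnd_simp.
  by rewrite -E addrC subrK.
by rewrite !H.
Qed.

Lemma LI_norm (a b M : R) (f : R -> C) : a <= b -> cintable leb `[a, b] f ->
  (forall t, a <= t <= b -> nc (f t) <= M) -> nc (LI a b f) <= M * (b - a).
Proof.
move=> ab fi fM; apply: le_trans (cint_norm (G := fun=> M) _ fi _ _) _ => //.
- apply: continuous_compact_integrable; first exact: segment_compact.
  by move=> ?; exact: cst_continuous.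
- rewrite Rintegral_cst//= lebesgue_measure_itv/= lte_fin.
  by move: ab; rewrite le_eqVlt => /predU1P[->|->]; rewrite ?ltxx ?subrr ?mulr0.
Qed.

Lemma LI_cst (a b : R) (k : C) : a <= b -> LI a b (fun=> k) = (b - a)%:C * k.
Proof.
move=> ab; rewrite /LI /cint !Rintegral_cst//= lebesgue_measure_itv/= lte_fin.
have -> : fine (if a < b then (b%:E - a%:E)%E else 0%E) = b - a.
  by move: ab; rewrite le_eqVlt => /predU1P[->|->]; rewrite ?ltxx ?subrr.
by case: k => u v; apply/eqP; rewrite eq_complex/=; apply/andP; split; apply/eqP; ring.
Qed.

Definition Phi (f : C -> C) (a b c d : R) : C :=
  LI a b (fun t => f (t +i* c) - f (t +i* d)) +
  'i%C * LI c d (fun s => f (b +i* s) - f (a +i* s)).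

(** The local bound required by [bisection] holds because the boundary integral
    of an affine function is zero. *)
Lemma goursat (f : C -> C) (al be : R) :
  (forall z, al < complex.Im z < be -> differentiable f z) ->
  forall a b c d, a <= b -> c <= d -> al < c -> d < be -> Phi f a b c d = 0.
Proof.
move=> df a b c d ab cd alc dbe.
have ch y a1 b1 : al < y -> y < be -> {within `[a1, b1], continuous (fun t => f (t +i* y))}.
  move=> hy yb; apply: cont_within => t _.
  apply: continuous_comp; first exact: hcont.
  by apply: differentiable_continuous; apply: df; rewrite /= hy yb.
have cv x c1 d1 : al < c1 -> d1 < be -> {within `[c1, d1], continuous (fun t => f (x +i* t))}.
  move=> hy yb; apply: cont_within => t /andP[ct td].
  apply: continuous_comp; first exact: vcont.
  apply: differentiable_continuous; apply: df => /=.
  by rewrite (lt_le_trans hy ct) (le_lt_trans td yb).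
have mI (u v : R) : measurable (`[u, v]%classic : set (measurableTypeR R)) by [].
have ih c1 d1 a1 b1 : al < c1 -> d1 < be -> c1 <= d1 ->
    cintable leb `[a1, b1] (fun t => f (t +i* c1) - f (t +i* d1)).
  move=> h1 h2 h3; apply: cintableB => //; apply: LI_intable; apply: ch => //.
    exact: le_lt_trans h3 h2.
  exact: lt_le_trans h1 h3.
have iv c1 d1 a1 b1 : al < c1 -> d1 < be ->
    cintable leb `[c1, d1] (fun s => f (b1 +i* s) - f (a1 +i* s)).
  by move=> h1 h2; apply: cintableB => //; apply: LI_intable; exact: cv.
apply: bisection => //.
- move=> a' m b' c' d' aa am mb bb cc cd' dd.
  have h1 := lt_le_trans alc cc; have h2 := le_lt_trans dd dbe.
  rewrite /Phi (LI_split am mb); last exact: ih.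
  rewrite addrACA -mulrDr; congr (_ + _ * _).
  rewrite -[RHS]cintD//; try exact: iv.
  by apply: eq_cint => s _; ring.
- move=> a' b' c' m d' aa ab' bb cc cm md dd.
  have h1 := lt_le_trans alc cc; have h2 := le_lt_trans dd dbe.
  have h3 := lt_le_trans h1 cm; have h4 := le_lt_trans md h2.
  rewrite /Phi (LI_split cm md); last exact: iv.
  rewrite addrACA -mulrDr; congr (_ + _).
  rewrite -[RHS]cintD//; try exact: ih.
  by apply: eq_cint => s _; ring.
- move=> x y /andP[ax xb] /andP[cy yd] e e0.
  have dz : differentiable f (x +i* y).
    by apply: df; rewrite /= (lt_le_trans alc cy) (le_lt_trans yd dbe).
  have e2 : 0 < e / 2 by rewrite divr_gt0.
  have [r r0 Hr] := choloE dz e2.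
  exists (r / 2); first by rewrite divr_gt0.
  move=> a' b' c' d' aa ax' xb' bb cc cy' yd' dd abr cdr.
  have h1 := lt_le_trans alc cc; have h2 := le_lt_trans dd dbe.
  have ab' := le_trans ax' xb'; have cd' := le_trans cy' yd'.
  set S := (b' - a') + (d' - c').
  have S0 : 0 <= S by rewrite /S; lra.
  have eS : e * S = e / 2 * S + e / 2 * S by lra.
  set bt := cder f (x +i* y) in Hr.
  have rho u v : a' <= u <= b' -> c' <= v <= d' ->
      nc (f (u +i* v) - f (x +i* y) - ((u - x) +i* (v - y)) * bt) <= e / 2 * S.
    move=> /andP[au ub] /andP[cv' vd].
    have hS : nc ((u - x) +i* (v - y) : C) <= S.
      apply: le_trans (nc_le _) _ => /=.
      have : `|u - x| <= b' - a' by rewrite ler_norml; lra.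
      have : `|v - y| <= d' - c' by rewrite ler_norml; lra.
      by rewrite /S; lra.
    have := Hr ((u - x) +i* (v - y)).
    rewrite (_ : (x +i* y) + ((u - x) +i* (v - y)) = u +i* v); last first.
      by apply/eqP; rewrite eq_complex /=; apply/andP; split; apply/eqP; ring.
    move=> H; apply: le_trans (H _) _; first by apply: le_lt_trans hS _; rewrite /S; lra.
    by rewrite ler_wpM2l// ltW.
  have E1 : LI a' b' (fun t => f (t +i* c') - f (t +i* d')) =
     LI a' b' (fun t => f (t +i* c') - f (t +i* d') - (0 +i* (c' - d')) * bt)
       + (b' - a')%:C * ((0 +i* (c' - d')) * bt).
    rewrite -LI_cst// -cintD//.
    - by apply: eq_cint => t _; rewrite subrK.
    - apply: cintableB => //; first exact: ih.
      by apply: LI_intable => ?; exact: cst_continuous.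
    - by apply: LI_intable => ?; exact: cst_continuous.
  have E2 : LI c' d' (fun s => f (b' +i* s) - f (a' +i* s)) =
     LI c' d' (fun s => f (b' +i* s) - f (a' +i* s) - ((b' - a') +i* 0) * bt)
       + (d' - c')%:C * (((b' - a') +i* 0) * bt).
    rewrite -LI_cst// -cintD//.
    - by apply: eq_cint => t _; rewrite subrK.
    - apply: cintableB => //; first exact: iv.
      by apply: LI_intable => ?; exact: cst_continuous.
    - by apply: LI_intable => ?; exact: cst_continuous.
  rewrite /Phi E1 E2.
  set I1 := LI _ _ _; set I2 := LI _ _ _.
  have -> : I1 + (b' - a')%:C * ((0 +i* (c' - d')) * bt) +
     'i%C * (I2 + (d' - c')%:C * (((b' - a') +i* 0) * bt)) = I1 + 'i%C * I2.
    rewrite mulrDr addrACA !mulrA -mulrDl.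
    rewrite (_ : _ + 'i%C * _ * _ = 0 :> C) ?mul0r ?addr0//.
    by apply/eqP; rewrite eq_complex /=; apply/andP; split; apply/eqP; ring.
  have b1 : nc I1 <= e * S * (b' - a').
    apply: LI_norm => //.
      apply: cintableB => //; first exact: ih.
      by apply: LI_intable => ?; exact: cst_continuous.
    move=> t ht.
    have -> : f (t +i* c') - f (t +i* d') - (0 +i* (c' - d')) * bt =
      (f (t +i* c') - f (x +i* y) - ((t - x) +i* (c' - y)) * bt) -
      (f (t +i* d') - f (x +i* y) - ((t - x) +i* (d' - y)) * bt).
      rewrite (_ : (0 +i* (c' - d') : C) = ((t - x) +i* (c' - y)) - ((t - x) +i* (d' - y))).
        by ring.
      by apply/eqP; rewrite eq_complex /=; apply/andP; split; apply/eqP; ring.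
    apply: le_trans (ncB _ _) _; rewrite eS lerD// rho// ?ht ?lexx ?cd' ?andbT//.
  have b2 : nc I2 <= e * S * (d' - c').
    apply: LI_norm => //.
      apply: cintableB => //; first exact: iv.
      by apply: LI_intable => ?; exact: cst_continuous.
    move=> t ht.
    have -> : f (b' +i* t) - f (a' +i* t) - ((b' - a') +i* 0) * bt =
      (f (b' +i* t) - f (x +i* y) - ((b' - x) +i* (t - y)) * bt) -
      (f (a' +i* t) - f (x +i* y) - ((a' - x) +i* (t - y)) * bt).
      rewrite (_ : ((b' - a') +i* 0 : C) = ((b' - x) +i* (t - y)) - ((a' - x) +i* (t - y))).
        by ring.
      by apply/eqP; rewrite eq_complex /=; apply/andP; split; apply/eqP; ring.
    apply: le_trans (ncB _ _) _; rewrite eS lerD// rho// ?ht ?lexx ?ab' ?andbT//.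
  apply: le_trans (ncD _ _) _; rewrite ncM nc_ii mul1r.
  apply: le_trans (lerD b1 b2) _.
  by rewrite -mulrDr -/S expr2 mulrA.
Qed.

End goursat.
(** * Affine changes of variable and exponential decay on the line *)
Section affine.
Context {R : realType}.
Local Notation leb := (@lebesgue_measure R).
Variables (a b : R).
Hypothesis a0 : a != 0.

Definition aff (t : measurableTypeR R) : measurableTypeR R := a * t + b.

Lemma measurable_aff : measurable_fun setT aff.
Proof. by apply: measurable_funD => //; exact: measurable_funM. Qed.

Definition pf_aff : {measure set (measurableTypeR R) -> \bar R} :=
  measure_function_pushforward__canonical__measure_function_Measure leb measurable_aff.

Lemma leb_affine A : measurable A ->
  leb A = (`|a|%:E * pushforward leb aff A)%E.
Proof.
move=> mA; have na : (0 <= `|a|) by [].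
pose M : {measure set (measurableTypeR R) -> \bar R} := mscale (NngNum na) pf_aff.
rewrite -[RHS]/(M A); apply: lebesgue_measure_unique => // X.
have E (x y : R) (c d : bool): (leb [set` Interval (BSide c x) (BSide d y)] =
   if x < y then (y%:E - x%:E)%E else 0%E).
  by rewrite lebesgue_measure_itv /= lte_fin.
move=> /ocitvP[->|[[x y] /= xy ->]]; first by rewrite !measure0.
rewrite -[RHS]/(_ * leb _)%E E xy.
move: a0; rewrite neq_lt => /orP[an|ap].
  rewrite (_ : aff @^-1` _ = `[(y - b) / a, (x - b) / a[%classic).
    rewrite E ltr_nM2r ?invr_lt0// ltrD2r xy /= -EFinD -EFinM; congr EFin.
    by rewrite ltr0_norm//; field; rewrite lt_eqF.
  apply/seteqP; split => t /=; rewrite !in_itv/= /aff ler_ndivrMr// ltr_ndivlMr//.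
    by rewrite lerBrDr ltrBlDr ![t * a]mulrC => /andP[-> ->].
  by rewrite lerBrDr ltrBlDr ![t * a]mulrC => /andP[-> ->].
rewrite (_ : aff @^-1` _ = `](x - b) / a, (y - b) / a]%classic).
  rewrite E ltr_pM2r ?invr_gt0// ltrD2r xy /= -EFinD -EFinM; congr EFin.
  by rewrite gtr0_norm//; field; rewrite gt_eqF.
apply/seteqP; split => t /=; rewrite !in_itv/= /aff ler_pdivlMr// ltr_pdivrMr//.
  by rewrite lerBrDr ltrBlDr ![t * a]mulrC => /andP[-> ->].
by rewrite lerBrDr ltrBlDr ![t * a]mulrC => /andP[-> ->].
Qed.

Lemma ge0_int_affine (f : measurableTypeR R -> \bar R) : measurable_fun setT f ->
  (forall x, (0 <= f x)%E) ->
  (\int[leb]_x f x = `|a|%:E * \int[leb]_x f (aff x))%E.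
Proof.
move=> mf f0; have na : (0 <= `|a|) by [].
transitivity (\int[mscale (NngNum na) pf_aff]_x f x)%E.
  by apply: eq_measure_integral => A mA _; exact: (leb_affine mA).
rewrite ge0_integral_mscale//=; congr (_ * _)%E.
by rewrite ge0_integral_pushforward//; exact: measurable_aff.
Qed.

Lemma integrable_affine (f : measurableTypeR R -> R) :
  leb.-integrable setT (EFin \o f) -> leb.-integrable setT (EFin \o (f \o aff)).
Proof.
move=> /integrableP[mf fi]; apply/integrableP; split.
  exact: (measurableT_comp mf measurable_aff).
move: fi; rewrite (ge0_int_affine (f := fun x => `|(f x)%:E|%E))//; last first.
  exact: measurableT_comp.
set I := (\int[_]_x _)%E; rewrite -[X in _ -> (X < _)%E]/I.
have I0 : (0 <= I)%E by exact: integral_ge0.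
case: I I0 => [r _ _| _|]//=; first exact: ltry.
by rewrite mulry gtr0_sg ?normr_gt0// mul1e.
Qed.

Lemma Rint_affine (f : measurableTypeR R -> R) :
  leb.-integrable setT (EFin \o f) ->
  Rintegral leb setT f = `|a| * Rintegral leb setT (f \o aff).
Proof.
move=> fi; have mf := measurable_int _ fi.
have fi' := integrable_affine fi.
transitivity (fine (`|a|%:E * \int[leb]_x (f (aff x))%:E)%E); last first.
  by rewrite fineM//; exact: (integrable_fin_num measurableT fi').
congr fine; rewrite integralE [in RHS]integralE.
rewrite muleBr//; last first.
  apply: fin_num_adde_defr.
  by apply: integrable_fin_num => //; exact: integrable_funepos.
congr (_ - _)%E.
  have H := ge0_int_affine (measurable_funepos mf) (funepos_ge0 (EFin \o f)).
  etransitivity; first exact: H.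
  by congr (_ * _)%E; apply: eq_integral => x _; rewrite !(funeposE,funenegE).
have H := ge0_int_affine (measurable_funeneg mf) (funeneg_ge0 (EFin \o f)).
etransitivity; first exact: H.
  by congr (_ * _)%E; apply: eq_integral => x _; rewrite !(funeposE,funenegE).
Qed.

Lemma cint_affine (f : measurableTypeR R -> R[i]) : cintable leb setT f ->
  cintable leb setT (f \o aff) /\
  cint leb setT f = `|a|%:C * cint leb setT (f \o aff).
Proof.
move=> [fr fi]; split.
  by split; [exact: (integrable_affine fr)|exact: (integrable_affine fi)].
rewrite /cint (Rint_affine fr) (Rint_affine fi).
by apply/eqP; rewrite eq_complex/=; apply/andP; split; apply/eqP; ring.
Qed.

End affine.

Section expdecay.
Context {R : realType}.
Local Notation leb := (@lebesgue_measure R).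

Definition edecay (c : R) (t : measurableTypeR R) : R := expR (- (c * `|t|)).

Lemma edecay_continuous c : continuous (edecay c).
Proof.
move=> t; apply: continuous_comp; last exact: continuous_expR.
apply: cvgN; apply: cvgM; first exact: cvg_cst.
exact: norm_continuous.
Qed.

Lemma integrable_edecay c : 0 < c -> leb.-integrable setT (EFin \o edecay c).
Proof.
move=> c0.
have ip := integrable_exponential_pdf c0.
have N10 : (-1 : R) != 0 by rewrite oppr_eq0 oner_eq0.
have ip2 := integrable_affine 0 N10 ip.
have := integrableD measurableT ip ip2.
move=> /(integrableZl measurableT c^-1)/(le_integrable _); apply => //.
  by apply/measurable_EFinP; apply: continuous_measurable_fun; exact: edecay_continuous.
move=> t _ /=; rewrite /aff lee_fin mulN1r addr0.
rewrite ger0_norm ?expR_ge0// ger0_norm; last first.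
  rewrite mulr_ge0 ?invr_ge0 ?(ltW c0)//.
  by rewrite addr_ge0// exponential_pdf_ge0// ltW.
rewrite mulrC ler_pdivlMr// mulrC.
have [t0|t0] := leP 0 t.
  rewrite exponential_pdfE// /edecay ger0_norm//.
  by rewrite mulNr lerDl exponential_pdf_ge0// ltW.
rewrite [X in _ <= _ + X]exponential_pdfE; last by rewrite oppr_ge0 ltW.
rewrite /edecay ltr0_norm// mulNr.
by rewrite lerDr exponential_pdf_ge0// ltW.
Qed.

End expdecay.
(** * Shifting the line of integration *)
Section line_shift.
Context {R : realType}.
Local Notation C := R[i].
Local Notation leb := (@lebesgue_measure R).

Lemma cont_cmeas (g : R -> C) : continuous g -> cmeas (setT : set (measurableTypeR R)) g.
Proof.
move=> cg; split; apply: continuous_measurable_fun => t;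
  by apply: continuous_comp; [exact: cg|exact: Re_continuous || exact: Im_continuous].
Qed.

Lemma LI_expand (g : measurableTypeR R -> C) (M c : R) : 0 < c -> continuous (g : R -> C) ->
  (forall t, nc (g t) <= M * edecay c t) ->
  clim (fun N => LI (- N%:R) N%:R g) (cint leb setT g).
Proof.
move=> c0 cg gM.
pose gN (N : nat) (t : measurableTypeR R) : C := if t \in `[- N%:R, N%:R] then g t else 0.
have M0 : 0 <= M.
  have := le_trans (nc_ge0 _) (gM 0); rewrite pmulr_lge0//; exact: expR_gt0.
have E N : LI (- N%:R) N%:R g = cint leb setT (gN N).
  rewrite /LI /cint [X in X +i* _]Rintegral_mkcond [X in _ +i* X]Rintegral_mkcond.
  congr (_ +i* _); apply: eq_Rintegral => t _; rewrite /gN patchE mem_setE;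
  by case: ifPn.
under eq_fun do rewrite E.
have mg := cont_cmeas cg.
apply: (cint_dct (G := fun t => M * edecay c t)) => //.
- move=> N; split.
    rewrite (_ : (fun t => _) = (fun t => complex.Re (g t)) \_ `[- N%:R, N%:R]); last first.
      by apply/funext => t; rewrite /gN patchE mem_setE; case: ifPn.
    apply/(measurable_restrictT _ _).1 => //.
    by apply: measurable_funTS; exact: mg.1.
  rewrite (_ : (fun t => _) = (fun t => complex.Im (g t)) \_ `[- N%:R, N%:R]); last first.
    by apply/funext => t; rewrite /gN patchE mem_setE; case: ifPn.
  apply/(measurable_restrictT _ _).1 => //.
  by apply: measurable_funTS; exact: mg.2.
- by apply: RintZ => //; exact: integrable_edecay.
- move=> N t _; rewrite /gN; case: ifPn => _ //.
  by rewrite nc0 mulr_ge0// expR_ge0.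
- move=> t _ e e0; exists (Num.truncn `|t|).+1 => //= N /= hN.
  rewrite /gN ifT ?subrr ?nc0 ?(ltW e0)// in_itv/= -ler_norml.
  apply: le_trans (_ : (Num.truncn `|t|).+1%:R <= _); first exact/ltW/truncnS_gt.
  by rewrite ler_nat.
Qed.

Lemma line_cont (f : C -> C) (de y : R) :
  (forall z, `|complex.Im z| < de -> differentiable f z) -> `|y| < de ->
  continuous (fun t : R => f (t +i* y)).
Proof.
move=> df yd t; apply: continuous_comp; first exact: hcont.
by apply: differentiable_continuous; exact: df.
Qed.

Lemma edecay_small (c : R) : 0 < c -> forall e, 0 < e ->
  \forall N \near \oo, expR (- (c * N%:R)) <= e.
Proof.
move=> c0 e e0; exists (Num.truncn `|(c * e)^-1|).+1 => // N /= hN.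
have cN : (c * e)^-1 < N%:R.
  apply: le_lt_trans (ler_norm _) _; apply: lt_le_trans (truncnS_gt _) _.
  by rewrite ler_nat.
rewrite expRN -[leRHS]invrK lef_pV2 ?posrE ?expR_gt0 ?invr_gt0//.
have h : e^-1 <= c * N%:R by rewrite -ler_pdivrMl// -invfM ltW.
by apply: le_trans h _; apply: le_trans (expR_ge1Dx _); rewrite lerDr.
Qed.

(** The vertical sides of the rectangles [-N, N] x [y1, y2] contribute
    [O(exp(- c N))]. *)
Lemma line_shift (f : C -> C) (de M c y1 y2 : R) : 0 < c ->
  (forall z, `|complex.Im z| < de -> differentiable f z) ->
  (forall z, `|complex.Im z| < de -> nc (f z) <= M * edecay c (complex.Re z)) ->
  `|y1| < de -> `|y2| < de ->
  cint leb setT (fun t => f (t +i* y1)) = cint leb setT (fun t => f (t +i* y2)).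
Proof.
move=> c0 df fM; wlog y12 : y1 y2 / y1 <= y2.
  move=> H h1 h2; have [/H|/ltW/H] := leP y1 y2; first exact.
  by move=> ->.
move=> h1 h2.
have c1 := line_cont df h1; have c2 := line_cont df h2.
have b1 t : nc (f (t +i* y1)) <= M * edecay c t by apply: fM.
have b2 t : nc (f (t +i* y2)) <= M * edecay c t by apply: fM.
have L1 := LI_expand c0 c1 b1; have L2 := LI_expand c0 c2 b2.
have M0 : 0 <= M.
  by have := le_trans (nc_ge0 _) (b1 0); rewrite pmulr_lge0//; exact: expR_gt0.
have de0 : 0 < de by apply: le_lt_trans h1.
have df' z : - de < complex.Im z < de -> differentiable f z.
  by rewrite -ltr_norml; exact: df.
have G N := goursat df' (ltac:(by rewrite -subr_ge0 opprK addr_ge0) : - N%:R <= N%:R :> R)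
  y12 (ltac:(by move: h1; rewrite ltr_norml => /andP[]))
  (ltac:(by move: h2; rewrite ltr_norml => /andP[])).
have e0 e : 0 < e -> \forall N \near \oo,
    nc (LI (- N%:R) N%:R (fun t => f (t +i* y1)) - LI (- N%:R) N%:R (fun t => f (t +i* y2))) <= e.
  move=> e0.
  have K0 : 0 <= 2 * M * (y2 - y1) by rewrite !mulr_ge0// subr_ge0.
  have [//|N0 _ HN] := edecay_small c0 (_ : 0 < e / (2 * M * (y2 - y1) + 1)).
    by rewrite divr_gt0// ltr_wpDl.
  exists N0 => // N /HN h.
  have ci (y : R) : `|y| < de -> cintable leb `[- N%:R, N%:R] (fun t => f (t +i* y)).
    by move=> hy; apply: LI_intable; apply: continuous_subspaceT; exact: (line_cont df hy).
  rewrite /LI -cintB//; [|exact: ci|exact: ci].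
  have := G N; rewrite /Phi => /eqP; rewrite addr_eq0 => /eqP.
  rewrite {1}/LI => ->; rewrite ncN ncM nc_ii mul1r.
  have iy x : {within `[y1, y2], continuous (fun s : R => f (x +i* s))}.
    apply: cont_within => s /andP[s1 s2].
    apply: continuous_comp; first exact: vcont.
    apply: differentiable_continuous; apply: df' => /=.
    move: h1 h2; rewrite !ltr_norml => /andP[h1 _] /andP[_ h2].
    by rewrite (lt_le_trans h1 s1) (le_lt_trans s2 h2).
  apply: le_trans (LI_norm (M := 2 * M * expR (- (c * N%:R))) y12 _ _) _.
  - by apply: cintableB => //; apply: LI_intable; exact: iy.
  - move=> s /andP[s1 s2].
    have sd : `|s| < de.
      move: h1 h2; rewrite !ltr_norml => /andP[h1 _] /andP[_ h2].
      by rewrite (lt_le_trans h1 s1) (le_lt_trans s2 h2).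
    apply: le_trans (ncB _ _) _; rewrite -mulrA mulrDl mul1r.
    apply: lerD; apply: (le_trans (fM _ _)) => //=; rewrite /edecay ?normrN ger0_norm//.
  - rewrite mulrAC; apply: le_trans (ler_wpM2l K0 h) _.
    rewrite mulrCA -mulr_natl ler_piMr ?(ltW e0)//.
    rewrite mulr1 ler_pdivrMr ?ltr_wpDl// mul1r lerDl ler01//.
apply/eqP; rewrite -subr_eq0; apply/eqP.
apply: (@clim_unique _ (fun N => LI (- N%:R) N%:R (fun t => f (t +i* y1)) -
   LI (- N%:R) N%:R (fun t => f (t +i* y2)))).
  move=> e ep; have e2 : 0 < e / 2 by rewrite divr_gt0.
  apply: filterS2 (L1 _ e2) (L2 _ e2) => N k1 k2.
  set A := LI _ _ _ in k1 *; set B := LI _ _ _ in k2 *.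
  set A' := cint _ _ _ in k1 *; set B' := cint _ _ _ in k2 *.
  rewrite (_ : A - B - (A' - B') = (A - A') - (B - B')); last by ring.
  by rewrite (le_trans (ncB _ _))// (splitr e) lerD.
by move=> e /e0; apply: filterS => N; rewrite subr0.
Qed.

End line_shift.
(** * Mean value bound and Cauchy estimates *)
Section mean.
Context {R : realType}.
Local Notation C := R[i].

Lemma cexp_comp (f : C -> C) z : differentiable f z -> differentiable (fun w => cexp (f w)) z.
Proof. by move=> df; apply: (differentiable_comp df); have [] := cexp_diff (f z). Qed.

(** With [z = r exp(i tau)] the circles [|z| = r exp(- y)] become horizontal
    segments of length [2 pi], whose vertical sides cancel by periodicity. So the mean
    of [K] over a circle does not depend on its radius, and it tends to [K 0].
    Only continuity is assumed at 0, which is what difference quotients satisfy. *)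
Lemma mean_bound (K : C -> C) (r r' B : R) : 0 < r -> r < r' ->
  {for 0, continuous K} ->
  (forall z, 0 < nc z -> nc z < r' -> differentiable K z) ->
  (forall z, nc z = r -> nc (K z) <= B) -> nc (K 0) <= B.
Proof.
move=> r0 rr' K0 dK KB.
pose g (tau : C) : C := r%:C * cexp ('i%C * tau).
have ng tau : nc (g tau) = r * expR (- complex.Im tau).
  rewrite /g ncM nc_real gtr0_norm// nc_cexp; congr (_ * expR _).
  by case: tau => a b /=; ring.
have dg tau : differentiable g tau.
  apply: differentiableM; first exact: differentiable_cst.
  apply: cexp_comp; apply: differentiableM; first exact: differentiable_cst.
  by [].
(* the strip of heights mapped by [g] into the punctured disc of radius [r'] *)
pose eta := ln (r' / r).
have eta0 : 0 < eta by rewrite ln_gt0// ltr_pdivlMr// mul1r.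
have dk be z : - eta < complex.Im z < be -> differentiable (K \o g) z.
  move=> /andP[h _]; apply: differentiable_comp; first exact: dg.
  apply: dK; rewrite ng; first by rewrite mulr_gt0// expR_gt0.
  rewrite mulrC -ltr_pdivlMr// -[ltRHS]lnK ?posrE ?divr_gt0 ?(lt_trans r0 rr')//.
  by rewrite ltr_expR ltrNl.
have tp0 : 0 <= 2 * pi :> R by rewrite mulr_ge0// pi_ge0.
have per s : g ((2 * pi) +i* s) = g (0 +i* s).
  rewrite /g; congr (_ * _).
  have -> : 'i%C * ((2 * pi) +i* s) = (- s) +i* (2 * pi) :> C.
    by apply/eqP; rewrite eq_complex/=; apply/andP; split; apply/eqP; ring.
  have -> : 'i%C * (0 +i* s) = (- s) +i* 0 :> C.
    by apply/eqP; rewrite eq_complex/=; apply/andP; split; apply/eqP; ring.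
  by rewrite /cexp /= mulr_natl cos2pi sin2pi cos0 sin0.
have kc y : 0 <= y -> {within `[0, 2 * pi], continuous (fun t : R => (K \o g) (t +i* y))}.
  move=> y0; apply: continuous_subspaceT => t; apply: (@continuous_comp _ _ _ (fun t : R => t +i* y) (K \o g)); first exact: hcont.
  apply: differentiable_continuous; apply: (dk (y + 1)) => /=.
  by rewrite ltrDl ltr01 andbT (lt_le_trans _ y0)// oppr_lt0.
have E y : 0 <= y -> LI 0 (2 * pi) (fun t => (K \o g) (t +i* 0)) =
    LI 0 (2 * pi) (fun t => (K \o g) (t +i* y)).
  move=> y0; have := goursat (dk (y + 1)) tp0 y0 (ltac:(by rewrite oppr_lt0)) (ltac:(by rewrite ltrDl)).
  rewrite /Phi (_ : LI 0 y _ = 0); last first.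
    rewrite /LI -[RHS](mul0r (cint lebesgue_measure `[0, y] (fun=> 0 : C))) -cintZ//; last first.
      by apply: LI_intable => ?; exact: cst_continuous.
    by apply: eq_cint => s _; rewrite /= per subrr mul0r.
  rewrite mulr0 addr0 [LI _ _ _]cintB//; [|exact: LI_intable (kc _ _)|exact: LI_intable (kc _ _)].
  by move/eqP; rewrite subr_eq0 => /eqP.
apply/ler_addgt0Pr => e e0.
have [d d0 Hd] : exists2 d : R, 0 < d & forall z, nc z < d -> nc (K 0 - K z) <= e.
  have ec0 : (0 : C) < e%:C by rewrite ltcR0.
  have /cvgrPdist_le/(_ _ ec0)/nbhs_ballP[d' /posCE[d d0 ->] Hd] := K0.
  exists d => // z zd; rewrite -lecR -normCE; apply: Hd.
  by rewrite -ball_normE/= /ball_/= sub0r normrN normCE ltcR.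
have [y [y0 yd]] : exists y, 0 <= y /\ r * expR (- y) < d.
  exists (Num.max 0 (ln (r / d) + 1)); split; first by rewrite le_max lexx.
  rewrite mulrC -ltr_pdivlMr// -[ltRHS]lnK ?posrE ?divr_gt0// ltr_expR ltrNl.
  by rewrite lt_max -lnV ?posrE ?divr_gt0// invf_div ltrDl ltr01 orbT.
have pp : 0 < 2 * pi :> R by rewrite mulr_gt0// pi_gt0.
have I1 : nc (LI 0 (2 * pi) (fun t => (K \o g) (t +i* y))) <= B * (2 * pi - 0).
  rewrite -E//; apply: LI_norm => //; first exact: LI_intable (kc _ _).
  by move=> t _; apply: KB; rewrite ng /= oppr0 expR0 mulr1.
have I2 : nc (LI 0 (2 * pi) (fun t => K 0 - (K \o g) (t +i* y))) <= e * (2 * pi - 0).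
  apply: LI_norm => //.
    apply: cintableB => //; last exact: LI_intable (kc _ _).
    by apply: LI_intable => ?; exact: cst_continuous.
  by move=> t _; apply: Hd; rewrite ng /=.
have S : LI 0 (2 * pi) (fun t => K 0 - (K \o g) (t +i* y)) =
   (2 * pi - 0)%:C * K 0 - LI 0 (2 * pi) (fun t => (K \o g) (t +i* y)).
  rewrite -LI_cst// [LHS]cintB//; last exact: LI_intable (kc _ _).
  by apply: LI_intable => ?; exact: cst_continuous.
rewrite subr0 in S I1 I2.
have : nc ((2 * pi)%:C * K 0) <= (B + e) * (2 * pi).
  rewrite (_ : _ * _ = LI 0 (2 * pi) (fun t => K 0 - (K \o g) (t +i* y)) +
    LI 0 (2 * pi) (fun t => (K \o g) (t +i* y))); last by rewrite S subrK.
  by apply: le_trans (ncD _ _) _; apply: le_trans (lerD I2 I1) _; rewrite -mulrDl [e + _]addrC.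
by rewrite ncM nc_real ger0_norm// mulrC ler_pM2r.
Qed.

End mean.
Section cauchy.
Context {R : realType}.
Local Notation C := R[i].
Implicit Types (f g k : C -> C) (z w a c : C).

Lemma near_diff f g z (d : R) : 0 < d -> (forall h, nc h < d -> f (z + h) = g (z + h)) ->
  differentiable f z -> differentiable g z /\ cder g z = cder f z.
Proof.
move=> d0 fg df; apply: choloI => e e0; have [r r0 H] := choloE df e0.
exists (Num.min d r); first by rewrite lt_min d0.
move=> h; rewrite lt_min => /andP[hd hr].
by rewrite -fg// -[X in _ - g X - _]addr0 -fg ?nc0// addr0 H.
Qed.

Lemma cderB f g z : differentiable f z -> differentiable g z ->
  cder (fun w => f w - g w) z = cder f z - cder g z.
Proof.
move=> df dg; apply: (choloI _).2 => e e0.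
have e2 : 0 < e / 2 by rewrite divr_gt0.
have [r r0 H] := choloE df e2; have [r' r'0 H'] := choloE dg e2.
exists (Num.min r r'); first by rewrite lt_min r0.
move=> h; rewrite lt_min => /andP[/H h1 /H' h2].
rewrite (_ : _ - _ - _ = (f (z + h) - f z - h * cder f z) -
  (g (z + h) - g z - h * cder g z)); last first.
  by move: (cder f z) (cder g z) (f _) (f _) (g _) (g _) => *; ring.
by apply: le_trans (ncB _ _) _; rewrite (splitr e) mulrDl lerD.
Qed.

Lemma cder_mulc (c z : C) : differentiable (fun w : C => w * c) z /\ cder (fun w => w * c) z = c.
Proof.
apply: choloI => e e0; exists 1 => // h _.
rewrite (_ : _ - _ - _ = 0); last by ring.
by rewrite nc0 mulr_ge0// ltW.
Qed.

Lemma cder_shift f a z : differentiable f (a + z) ->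
  differentiable (fun w => f (a + w)) z /\ cder (fun w => f (a + w)) z = cder f (a + z).
Proof.
move=> df; apply: choloI => e e0; have [r r0 H] := choloE df e0.
by exists r => // h hr; rewrite addrA; exact: H.
Qed.

Lemma choloE_cont f z (e : R) : differentiable f z -> 0 < e ->
  exists2 d : R, 0 < d & forall h, nc h < d -> nc (f (z + h) - f z) <= e.
Proof.
move=> /differentiable_continuous fc e0.
have ec0 : (0 : C) < e%:C by rewrite ltcR0.
have /cvgrPdist_le/(_ _ ec0)/nbhs_ballP[d' /posCE[d d0 ->] Hd] := fc.
exists d => // h hd; rewrite ncBC -lecR -normCE; apply: Hd.
by rewrite -ball_normE/= /ball_/= opprD addrA subrr sub0r normrN normCE ltcR.
Qed.

(** [mean_bound] for the difference quotient [(k w - k 0) / w], completed by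
    the derivative at 0. *)
Lemma cauchy_est0 k (r r' M : R) : 0 < r -> r < r' ->
  (forall z, nc z < r' -> differentiable k z) ->
  (forall z, nc z <= r -> nc (k z) <= M) -> nc (cder k 0) <= 2 * M / r.
Proof.
move=> r0 rr' dk kM.
have r'0 := lt_trans r0 rr'.
pose K w := if w == 0 then cder k 0 else (k w - k 0) / w.
rewrite (_ : cder k 0 = K 0); last by rewrite /K eqxx.
apply: (mean_bound r0 rr').
- have d0 : differentiable k 0 by apply: dk; rewrite nc0.
  move=> A /nbhs_ballP[e' /posCE[e e0 ->] eA].
  have e2 : 0 < e / 2 by rewrite divr_gt0.
  have [d dp H] := choloE d0 e2.
  apply/nbhs_ballP; exists d%:C; first by rewrite /= ltcR0.
  move=> w; rewrite -ball_normE/= /ball_/= sub0r normrN normCE ltcR => wd.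
  apply: eA; rewrite -ball_normE/= /ball_/= normCE ltcR.
  apply: le_lt_trans (_ : e / 2 < e); last by rewrite ltr_pdivrMr// ltr_pMr// ltr1n.
  rewrite {1}/K eqxx /K; case: eqP => [_|/eqP w0].
    by rewrite subrr nc0 ltW.
  have nw : 0 < nc w by rewrite lt_neqAle nc_ge0 andbT eq_sym nc_eq0.
  rewrite ncBC -(ler_pM2r nw) -ncM mulrBl divfK//.
  by have := H w wd; rewrite add0r [w * _]mulrC.
- move=> z z0 zr.
  have zn : z != 0 by rewrite -nc_eq0 gt_eqF.
  apply: (@near_diff (fun w => (k w - k 0) / w) K z (nc z) z0 _ _).1.
  + move=> h hz; rewrite /K ifF//; apply/negbTE; rewrite addr_eq0.
    by apply: contraTneq hz => ->; rewrite ncN ltxx.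
  + apply: differentiableM; last by apply: differentiableV.
    by apply: differentiableB; [exact: dk|exact: differentiable_cst].
- move=> z zr.
  have zn : z != 0 by rewrite -nc_eq0 zr gt_eqF.
  rewrite /K (negbTE zn) ncM ncV zr ler_pM2r ?invr_gt0//.
  by rewrite (le_trans (ncB _ _))// mulr_natl mulr2n lerD// kM// ?zr// nc0 ltW.
Qed.

Lemma cauchy_est k a (r r' M : R) : 0 < r -> r < r' ->
  (forall z, nc (z - a) < r' -> differentiable k z) ->
  (forall z, nc (z - a) <= r -> nc (k z) <= M) -> nc (cder k a) <= 2 * M / r.
Proof.
move=> r0 rr' dk kM.
have da : differentiable k (a + 0).
  by rewrite addr0; apply: dk; rewrite subrr nc0 (lt_trans r0).
have [_ E] := cder_shift da; rewrite addr0 in E; rewrite -E.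
apply: (cauchy_est0 r0 rr') => z hz; last by apply: kM; rewrite addrC addKr.
by apply: (cder_shift _).1; apply: dk; rewrite addrC addKr.
Qed.

Lemma eps_is_derive (f : R -> R) (x c : R) :
  (forall e : R, 0 < e -> exists2 d : R, 0 < d &
    forall h, `|h| < d -> `|f (x + h) - f x - h * c| <= e * `|h|) -> is_derive x 1 f c.
Proof.
move=> H.
have ml : linear ((fun h => h * c : R) : R -> R).
  by move=> u v w; rewrite mulrDl -scalerAl.
pose ml1 := GRing.isLinear.Build _ _ _ _ _ ml.
pose l : {linear R -> R} := HB.pack ((fun h => h * c : R) : R -> R) ml1.
have [df E] : differentiable f x /\ 'd f x = l :> (R -> R).
  apply: eps_diff => //; exact: mulrr_continuous.
split; first exact/derivable1_diffP.
by rewrite deriveE// E /l /= mul1r.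
Qed.

(** Apply the real mean value theorem to the component of [f] in the direction of
    [f w - f 0]. *)
Lemma cmvt f w (L : R) :
  (forall t : R, 0 <= t <= 1 -> differentiable f (t%:C * w)) ->
  (forall t : R, 0 <= t <= 1 -> nc (cder f (t%:C * w)) <= L) ->
  nc (f w - f 0) <= L * nc w.
Proof.
move=> df fL; have [->|zn0] := eqVneq (f w - f 0) 0.
  have L0 : 0 <= L by apply: le_trans (fL 0 _); rewrite ?lexx ?ler01//.
  by rewrite nc0 mulr_ge0.
set z := f w - f 0 in zn0 *.
have nz0 : 0 < nc z by rewrite lt_neqAle nc_ge0 andbT eq_sym nc_eq0.
pose u := z^* / (nc z)%:C.
have nu : nc u = 1.
  by rewrite ncM ncV ncJ nc_real ger0_norm ?nc_ge0// divff ?gt_eqF.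
have uz : u * z = (nc z)%:C.
  rewrite /u mulrAC mulrC [z^* * z]mulrC -sqr_normc normCE -!(rmorphXn, fmorphV).
  by rewrite -rmorphM/= expr2 mulKf// gt_eqF.
pose g (t : R) := complex.Re (u * f (t%:C * w)).
have dg (t : R) : 0 <= t <= 1 -> is_derive t 1 g (complex.Re (u * (w * cder f (t%:C * w)))).
  move=> t01; apply: eps_is_derive => e e0.
  have W0 : 0 < nc w + 1 by rewrite ltr_wpDl.
  have e1 : 0 < e / (nc w + 1) by rewrite divr_gt0.
  have [d d0 H] := choloE (df t t01) e1.
  exists (d / (nc w + 1)); first by rewrite divr_gt0.
  move=> h hd; rewrite /g.
  have hR (b : C) : h * complex.Re b = complex.Re (h%:C * b).
    by case: b => b1 b2; rewrite /= mul0r subr0.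
  rewrite hR -!raddfB; apply: le_trans (Re_le _) _.
  rewrite (_ : _ - _ - _ = u * (f (t%:C * w + h%:C * w) - f (t%:C * w) - h%:C * w * cder f (t%:C * w))); last first.
    by rewrite rmorphD mulrDl; move: (cder f _) (f _) (f _) => *; ring.
  rewrite ncM nu mul1r; apply: le_trans (H _ _) _.
    rewrite ncM nc_real; apply: le_lt_trans (_ : `|h| * (nc w + 1) < _).
      by rewrite ler_wpM2l// lerDl.
    by rewrite -ltr_pdivlMr.
  rewrite ncM nc_real [`|h| * _]mulrC mulrA ler_wpM2r//.
  by rewrite mulrAC ler_pdivrMr// ler_wpM2l ?(ltW e0)// lerDl.
have [c /[!in_itv]/= c01 E] := @MVT R g (fun t => complex.Re (u * (w * cder f (t%:C * w)))) 0 1 ltr01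
  (ltac:(by move=> t; rewrite in_itv/= => /andP[h1 h2]; apply: dg; rewrite !ltW))
  (ltac:(by apply: continuous_in_subspaceT => t; rewrite inE/= in_itv/= => /dg [] /derivable1_diffP /differentiable_continuous)).
have gE : g 1 - g 0 = nc z.
  by rewrite /g mul1r mul0r -raddfB -mulrBr -/z uz.
rewrite -gE E subr0 mulr1; apply: le_trans (ler_norm _) _; apply: le_trans (Re_le _) _.
rewrite ncM nu mul1r ncM [L * _]mulrC.
apply: ler_wpM2l; first exact: nc_ge0.
apply: fL.
by case/andP: c01 => h1 h2; rewrite !ltW.
Qed.

(** The Lipschitz bound on [cder k] comes from [cauchy_est0] applied to
    [v |-> k (a + v) - k v], which avoids differentiability of [cder k]. This is the
    uniform remainder that allows differentiation under the integral sign. *)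
Lemma taylor2 k (r r' M : R) w : 0 < r -> r < r' ->
  (forall z, nc z < r' -> differentiable k z) ->
  (forall z, nc z <= r -> nc (k z) <= M) -> nc w <= r / 4 ->
  nc (k w - k 0 - w * cder k 0) <= 32 * M / r ^+ 2 * nc w ^+ 2.
Proof.
move=> r0 rr' dk kM wr.
have r2 : 0 < r / 2 by rewrite divr_gt0.
have r4 : 0 < r / 4 by rewrite divr_gt0.
have H1 a : nc a <= r / 2 -> nc (cder k a) <= 4 * M / r.
  move=> ar; have -> : 4 * M / r = 2 * M / (r / 2) by field; rewrite gt_eqF.
  apply: (@cauchy_est _ _ (r / 2) (r' - r / 2)) => //; first by lra.
  - move=> z hz; apply: dk; rewrite -(subrK a z).
    by apply: le_lt_trans (ncD _ _) _; lra.
  - move=> z hz; apply: kM; rewrite -(subrK a z).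
    by apply: le_trans (ncD _ _) _; lra.
have M0 : 0 <= M.
  by apply: le_trans (nc_ge0 (k 0)) _; apply: kM; rewrite nc0 ltW.
have tw (t : R) (v : C) : 0 <= t <= 1 -> nc (t%:C * v) <= nc v.
  move=> /andP[t0 t1]; rewrite ncM nc_real ger0_norm//.
  by rewrite ler_piMl.
have H2 z a : nc z <= r / 4 -> nc a <= r / 4 -> nc (k (z + a) - k z) <= 4 * M / r * nc a.
  move=> zr ar; rewrite -[X in _ - k X]addr0.
  have zt (t : R) : 0 <= t <= 1 -> nc (z + t%:C * a) <= r / 2.
    move=> t01; apply: le_trans (ncD _ _) _.
    by have := tw t a t01; lra.
  have dz (t : R) : 0 <= t <= 1 -> differentiable k (z + t%:C * a).
    by move=> t01; apply: dk; have := zt t t01; lra.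
  apply: (@cmvt (fun v => k (z + v))) => t t01; first by have [] := cder_shift (dz t t01).
  by have [_ ->] := cder_shift (dz t t01); apply: H1; exact: zt.
have H3 a : nc a <= r / 4 -> nc (cder k a - cder k 0) <= 32 * M / r ^+ 2 * nc a.
  move=> ar.
  have da z : nc z < r' - r / 4 -> differentiable (fun v => k (a + v)) z.
    move=> zr; apply: (cder_shift _).1; apply: dk.
    by apply: le_lt_trans (ncD _ _) _; lra.
  have d0 z : nc z < r' - r / 4 -> differentiable k z.
    by move=> zr; apply: dk; lra.
  have p0 : nc (0 : C) < r' - r / 4 by rewrite nc0; lra.
  have -> : cder k a - cder k 0 = cder (fun v => k (a + v) - k v) 0.
    rewrite cderB; [|exact: da|exact: d0].
    have [|_ ->] := @cder_shift k a 0; last by rewrite addr0.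
    by rewrite addr0; apply: dk; lra.
  have -> : 32 * M / r ^+ 2 * nc a = 2 * (4 * M / r * nc a) / (r / 4).
    by field; rewrite gt_eqF.
  apply: (@cauchy_est0 _ (r / 4) (r' - r / 4) _ r4); first by lra.
  - by move=> z zr; apply: differentiableB; [exact: da|exact: d0].
  - by move=> z zr; rewrite [a + z]addrC; apply: H2.
have dw (t : R) : 0 <= t <= 1 -> nc (t%:C * w) < r'.
  by move=> t01; have := tw t w t01; lra.
have -> : k w - k 0 - w * cder k 0 = (k w - w * cder k 0) - (k 0 - 0 * cder k 0).
  by move: (cder k 0) (k w) (k 0) => *; ring.
rewrite expr2 mulrA.
apply: (@cmvt (fun v => k v - v * cder k 0)) => t t01.
  apply: differentiableB; first exact/dk/dw.
  by have [] := cder_mulc (cder k 0) (t%:C * w).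
have [d1 d2] := cder_mulc (cder k 0) (t%:C * w).
rewrite cderB//; last exact/dk/dw.
rewrite d2; apply: le_trans (H3 _ _) _; first exact: le_trans (tw _ _ t01) wr.
rewrite ler_wpM2l ?tw//.
by rewrite !mulr_ge0// invr_ge0 exprn_ge0// ltW.
Qed.

End cauchy.

(** * Differentiation under the integral sign *)
Section param.
Context {R : realType} {n : nat}.
Local Notation C := R[i].
Implicit Types (z v h : 'rV[C]_n) (f : 'rV[C]_n -> C).

Lemma rnormZ (a : C) v : rnorm (a *: v) = nc a * rnorm v.
Proof.
apply: (@complexI R); rewrite -rnormE normrZ normCE rnormE.
by rewrite (rmorphM (real_complex R)).
Qed.
Lemma rnorm0 : rnorm (0 : 'rV[C]_n) = 0.
Proof. by rewrite -(scale0r 0) rnormZ nc0 mul0r. Qed.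

(** Chain rule along a complex line. *)
Lemma line_cder f z h (w : C) : differentiable f (z + w *: h) ->
  differentiable (fun u : C => f (z + u *: h)) w /\
  cder (fun u : C => f (z + u *: h)) w = 'd f (z + w *: h) h.
Proof.
move=> df; apply: choloI => e e0.
have H0 : 0 < rnorm h + 1 by rewrite ltr_wpDl.
have e1 : 0 < e / (rnorm h + 1) by rewrite divr_gt0.
have [d d0 H] := holoE df e1.
exists (d / (rnorm h + 1)); first by rewrite divr_gt0.
move=> u ud.
have hu : rnorm (u *: h) < d.
  rewrite rnormZ; apply: le_lt_trans (_ : nc u * (rnorm h + 1) < _).
    by rewrite ler_wpM2l// lerDl.
  by rewrite -ltr_pdivlMr.
have := H _ hu; rewrite -[z + _ + u *: h]addrA -scalerDl linearZ => h1.
apply: le_trans h1 _; rewrite rnormZ mulrA mulrAC ler_wpM2r//.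
by rewrite mulrAC ler_pdivrMr// ler_wpM2l ?(ltW e0)// lerDl.
Qed.
End param.

Section cmeas_lim.
Context {R : realType} {d : measure_display} {T : measurableType d}.
Local Notation C := R[i].

Lemma cmeas_lim (D : set T) (f_ : nat -> T -> C) (f : T -> C) : measurable D ->
  (forall m, cmeas D (f_ m)) -> (forall x, D x -> clim (f_ ^~ x) (f x)) -> cmeas D f.
Proof.
move=> mD mf cf; split.
  apply: (measurable_fun_cvg (h := fun m x => complex.Re (f_ m x))) => [m|x Dx].
    exact: (mf m).1.
  apply/cvgrPdist_le => e e0; apply: filterS (cf x Dx _ e0) => m hm.
  by rewrite distrC -raddfB (le_trans (Re_le _)).
apply: (measurable_fun_cvg (h := fun m x => complex.Im (f_ m x))) => [m|x Dx].
  exact: (mf m).2.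
apply/cvgrPdist_le => e e0; apply: filterS (cf x Dx _ e0) => m hm.
by rewrite distrC -raddfB (le_trans (Im_le _)).
Qed.

Lemma cmeasD (D : set T) (f g : T -> C) : measurable D -> cmeas D f -> cmeas D g ->
  cmeas D (fun x => f x + g x).
Proof.
move=> mD [fr fi] [gr gi]; split.
  by under eq_fun do rewrite raddfD; exact: measurable_funD.
by under eq_fun do rewrite raddfD; exact: measurable_funD.
Qed.

Lemma cmeasM (D : set T) (f g : T -> C) : measurable D -> cmeas D f -> cmeas D g ->
  cmeas D (fun x => f x * g x).
Proof.
move=> mD [fr fi] [gr gi].
have ReM (a b : C) : complex.Re (a * b) =
  complex.Re a * complex.Re b - complex.Im a * complex.Im b by case: a b => [? ?] [].
have ImM (a b : C) : complex.Im (a * b) =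
  complex.Re a * complex.Im b + complex.Im a * complex.Re b by case: a b => [? ?] [].
split.
  under eq_fun do rewrite ReM.
  by apply: measurable_funB => //; apply: measurable_funM.
under eq_fun do rewrite ImM.
by apply: measurable_funD => //; apply: measurable_funM.
Qed.

Lemma cmeas_cst (D : set T) (c : C) : cmeas D (fun=> c).
Proof. by split; exact: measurable_cst. Qed.
End cmeas_lim.

Section param_int.
Context {R : realType} {n : nat} {d : measure_display} {T : measurableType d}.
Variable mu : {measure set T -> \bar R}.
Local Notation C := R[i].
Variables (g : 'rV[C]_n -> T -> C) (z0 : 'rV[C]_n) (rho : R) (G : T -> R).
Hypothesis rho0 : 0 < rho.
Hypothesis Hd : forall t (z : 'rV[C]_n), rnorm (z - z0) < rho -> differentiable (g ^~ t) z.
Hypothesis Hb : forall t (z : 'rV[C]_n), rnorm (z - z0) < rho -> nc (g z t) <= G t.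
Hypothesis Hm : forall z : 'rV[C]_n, rnorm (z - z0) < rho -> cmeas setT (g z).
Hypothesis iG : mu.-integrable setT (EFin \o G).

Let dg (v : 'rV[C]_n) t := 'd (g ^~ t) z0 v.

Let c0 : rnorm (z0 - z0) < rho. Proof. by rewrite subrr rnorm0. Qed.

Let G0 t : 0 <= G t. Proof. exact: le_trans (nc_ge0 _) (Hb t c0). Qed.

Let seg v (w : C) : nc w * rnorm v < rho -> rnorm (z0 + w *: v - z0) < rho.
Proof. by rewrite addrC addKr rnormZ. Qed.

Let kd v t (w : C) : nc w * rnorm v < rho ->
  differentiable (fun u : C => g (z0 + u *: v) t) w.
Proof. by move=> h; apply: (@line_cder _ _ (g ^~ t) z0 v w _).1; exact/Hd/seg. Qed.

Let kd0 (v : 'rV[C]_n) t : cder (fun u : C => g (z0 + u *: v) t) 0 = dg v t.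
Proof.
rewrite (@line_cder _ _ (g ^~ t) z0 v 0 _).2 ?scale0r ?addr0//.
by apply: Hd; rewrite subrr rnorm0.
Qed.

Let r1 (v : 'rV[C]_n) : R := rho / 2 / (rnorm v + 1).

Let r10 v : 0 < r1 v.
Proof. by rewrite !divr_gt0// ltr_wpDl. Qed.

Let r1v v : r1 v * (rnorm v + 1) = rho / 2.
Proof. by rewrite divfK// gt_eqF// ltr_wpDl. Qed.

Let dg_bound v t : nc (dg v t) <= 2 * G t / r1 v.
Proof.
rewrite -kd0; apply: (@cauchy_est0 _ _ (r1 v) (r1 v * 2)) => //.
- by rewrite ltr_pMr ?ltr1n.
- move=> z hz; apply: kd; apply: le_lt_trans (_ : nc z * (rnorm v + 1) < _).
    by rewrite ler_wpM2l// lerDl.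
  rewrite -(ltr_pM2r (_ : 0 < rnorm v + 1)) in hz; last by rewrite ltr_wpDl.
  by apply: lt_le_trans hz _; rewrite mulrAC r1v divfK.
- move=> z hz; apply: Hb; apply: seg; apply: le_lt_trans (_ : nc z * (rnorm v + 1) < _).
    by rewrite ler_wpM2l// lerDl.
  rewrite -(ler_pM2r (_ : 0 < rnorm v + 1)) in hz; last by rewrite ltr_wpDl.
  by apply: le_lt_trans hz _; rewrite r1v ltr_pdivrMr// ltr_pMr// ltr1n.
Qed.

(** The derivative is measurable in the parameter as a limit of difference
    quotients. *)
Let dg_meas v : cmeas setT (dg v).
Proof.
pose w (m : nat) : R := r1 v / m.+1%:R.
have w0 m : 0 < w m by rewrite divr_gt0.
have wr m : nc (w m)%:C * rnorm v < rho.
  rewrite nc_real gtr0_norm//; apply: le_lt_trans (_ : r1 v * (rnorm v + 1) < _).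
    apply: ler_pM => //; first exact: ltW.
      by rewrite ler_pdivrMr// ler_peMr ?(ltW (r10 v))// ler1n.
    by rewrite lerDl.
  by rewrite r1v ltr_pdivrMr// ltr_pMr// ltr1n.
apply: (@cmeas_lim _ _ _ _ (fun m t => (w m)%:C^-1 * (g (z0 + (w m)%:C *: v) t + (-1) * g z0 t))).
- by [].
- move=> m; apply: cmeasM => //.
  apply: cmeasD => //; first exact/Hm/seg.
  by apply: cmeasM => //; exact: Hm.
- move=> t _ e e0.
  have k0 : differentiable (fun u : C => g (z0 + u *: v) t) 0.
    by apply: kd; rewrite nc0 mul0r.
  have [dd dd0 H] := choloE k0 e0.
  exists (Num.truncn `|r1 v / dd|).+1 => // m /= hm.
  have wm : w m < dd.
    rewrite /w ltr_pdivrMr// mulrC -ltr_pdivrMr//.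
    apply: le_lt_trans (ler_norm _) _; apply: lt_le_trans (truncnS_gt _) _.
    by rewrite ler_nat (leq_trans hm).
  have nw : nc (w m)%:C = w m by rewrite nc_real gtr0_norm.
  have := H (w m)%:C; rewrite nw => /(_ wm).
  rewrite kd0 add0r scale0r addr0 => h1.
  have wn : (w m)%:C != 0 :> C by rewrite -nc_eq0 nw gt_eqF.
  rewrite -(ler_pM2l (w0 m)) -{1}nw -ncM mulrBr mulrA divff// mul1r mulN1r.
  by rewrite [w m * e]mulrC.
Qed.

Let dg_int v : cintable mu setT (dg v).
Proof.
apply: (le_cintable (G := fun t => (2 / r1 v) * G t)) => //; first exact: RintZ.
by move=> t _; rewrite mulrAC; exact: dg_bound.
Qed.

Let g_int z : rnorm (z - z0) < rho -> cintable mu setT (g z).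
Proof. by move=> h; apply: (le_cintable (G := G)) => // [|t _]; [exact: Hm|exact: Hb]. Qed.

(** For holomorphic integrands domination of the function is enough: [taylor2]
    turns it into a remainder of order [G t |v|^2]. *)
Lemma param_diff : differentiable (fun z => cint mu setT (g z)) z0 /\
  forall v, 'd (fun z => cint mu setT (g z)) z0 v = cint mu setT (fun t => 'd (g ^~ t) z0 v).
Proof.
have ml : linear ((fun v => cint mu setT (dg v)) : 'rV[C]_n -> C).
  move=> a u v; rewrite -[a *: cint _ _ _]/(a * cint _ _ _) -cintZ// -cintD//; last exact: cintableZ.
  by apply: eq_cint => t _; rewrite /dg linearP.
pose ml1 := GRing.isLinear.Build _ _ _ _ _ ml.
pose l : {linear 'rV[C]_n -> C} := HB.pack ((fun v => cint mu setT (dg v)) : 'rV[C]_n -> C) ml1.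
suff [dF E] : differentiable (fun z => cint mu setT (g z)) z0 /\
   'd (fun z => cint mu setT (g z)) z0 = l :> ('rV[C]_n -> C).
  split; first exact: dF.
  move=> v; exact: (congr1 (@^~ v) E).
apply: holoI => e e0.
pose J := Rintegral mu setT G.
have J0 : 0 <= J by apply: Rintegral_ge0.
pose K := 128 / rho ^+ 2 * J.
have K0 : 0 <= K by rewrite !mulr_ge0// invr_ge0 exprn_ge0// ltW.
exists (Num.min (rho / 8) (e / (K + 1))).
  by rewrite lt_min !divr_gt0// ltr_wpDl.
move=> h; rewrite lt_min => /andP[h8 he].
have hr : rnorm (z0 + h - z0) < rho.
  by rewrite addrC addKr; apply: lt_trans h8 _; rewrite ltr_pdivrMr// ltr_pMr// ltr1n.
have [h0|hn] := eqVneq (rnorm h) 0.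
  have -> : h = 0.
    apply/rowP => j; rewrite mxE; apply/eqP; rewrite -nc_eq0 eq_le nc_ge0 andbT.
    by rewrite -h0 nc_rnorm.
  by rewrite addr0 subrr sub0r linear0 oppr0 nc0 mulr_ge0// ltW.
have hp : 0 < rnorm h by rewrite lt_neqAle rnorm_ge0 andbT eq_sym.
have gh := g_int hr; have g0 := g_int c0.
change (l h) with (cint mu setT (dg h)).
rewrite -(cintB measurableT gh g0) -(cintB measurableT (cintableB measurableT gh g0) (dg_int h)).
have T2 t : nc (g (z0 + h) t - g z0 t - dg h t) <= 128 / rho ^+ 2 * rnorm h ^+ 2 * G t.
  pose r := rho / 2 / rnorm h.
  have r0 : 0 < r by rewrite !divr_gt0.
  have rh : r * rnorm h = rho / 2 by rewrite divfK.
  have := @taylor2 _ (fun u : C => g (z0 + u *: h) t) r (r * 2) (G t) 1 r0.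
  rewrite nc1 kd0 scale1r scale0r addr0 mul1r expr1n mulr1 => H.
  apply: le_trans (H _ _ _ _) _.
  - by rewrite ltr_pMr ?ltr1n.
  - move=> z hz; apply: kd; rewrite -ltr_pdivlMr//.
    by apply: lt_le_trans hz _; rewrite /r mulrAC divfK.
  - move=> z hz; apply: Hb; apply: seg; rewrite -ltr_pdivlMr//.
    by apply: le_lt_trans hz _; rewrite /r ltr_pM2r ?invr_gt0// ltr_pdivrMr// ltr_pMr// ltr1n.
  - rewrite ler_pdivlMr// mul1r /r ler_pdivlMr//; lra.
  - have -> : 32 * G t / r ^+ 2 = 128 / rho ^+ 2 * rnorm h ^+ 2 * G t.
      by rewrite /r; field; rewrite hn gt_eqF.
    by [].
apply: le_trans (cint_norm (G := fun t => 128 / rho ^+ 2 * rnorm h ^+ 2 * G t) _ _ _ _) _ => //.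
- exact: (cintableB measurableT (cintableB measurableT gh g0) (dg_int h)).
- exact: RintZ.
- rewrite RintegralZl// -/J.
  have -> : 128 / rho ^+ 2 * rnorm h ^+ 2 * J = K * rnorm h * rnorm h.
    by rewrite /K; ring.
  rewrite ler_wpM2r//; apply: le_trans (_ : (K + 1) * rnorm h <= _).
    by rewrite ler_wpM2r// lerDl.
  by rewrite mulrC -ler_pdivlMr ?ltr_wpDl// ltW.
Qed.

End param_int.
(** * Fourier transform of holomorphic functions in one coordinate *)
Section upd.
Context {T : Type} {n : nat}.
Definition upd (z : 'rV[T]_n) (j : 'I_n) (t : T) : 'rV[T]_n :=
  \row_k (if k == j then t else z ord0 k).
End upd.

Section FText.
Context {R : realType} {n : nat}.
Local Notation C := R[i].
Local Notation leb := (@lebesgue_measure R).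
Implicit Types (z v : 'rV[C]_n) (f : 'rV[C]_n -> C) (x : 'rV[R]_n) (j : 'I_n).

Lemma cexp_compV (V : normedModType C) (f : V -> C) (z : V) :
  differentiable f z -> differentiable (fun w => cexp (f w)) z.
Proof. by move=> df; apply: (differentiable_comp df); have [] := cexp_diff (f z). Qed.

Lemma updE z j (w : C) : upd z j w = upd z j 0 + w *: delta_mx ord0 j.
Proof.
apply/rowP => k; rewrite !mxE eqxx andTb; case: eqP => _.
  by rewrite mulr1 add0r.
by rewrite mulr0 addr0.
Qed.

Lemma updE2 z j (w : C) : upd z j w = z + (w - z ord0 j) *: delta_mx ord0 j.
Proof.
apply/rowP => k; rewrite !mxE eqxx andTb; case: eqP => [->|_].
  by rewrite mulr1 addrC subrK.
by rewrite mulr0 addr0.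
Qed.

Lemma toC_upd x j (t : R) : toC (upd x j t) = upd (toC x) j t%:C.
Proof. by apply/rowP => k; rewrite !mxE; case: eqP. Qed.

Definition tube (de : R) : set 'rV[C]_n := [set z | forall k, `|complex.Im (z ord0 k)| < de].

Definition sumabs z : R := \sum_k `|complex.Re (z ord0 k)|.

Lemma sumabs_ge0 z : 0 <= sumabs z. Proof. exact: sumr_ge0. Qed.

Lemma sumabs_upd z j w :
  sumabs (upd z j w) = sumabs z - `|complex.Re (z ord0 j)| + `|complex.Re w|.
Proof.
rewrite /sumabs (bigD1 j)//= mxE eqxx [in RHS](bigD1 j)//= [X in X - _]addrC addrK addrC.
by congr (_ + _); apply: eq_bigr => k kj; rewrite mxE (negbTE kj).
Qed.

Lemma sumabs_j z j : `|complex.Re (z ord0 j)| <= sumabs z.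
Proof. by rewrite /sumabs (bigD1 j)//= lerDl sumr_ge0. Qed.

Lemma tube_upd de z j w : tube de z -> `|complex.Im w| < de -> tube de (upd z j w).
Proof. by move=> zd wd k; rewrite mxE; case: eqP. Qed.

Lemma tubeW de de' z : de' <= de -> tube de' z -> tube de z.
Proof. by move=> dd zd k; exact: lt_le_trans (zd k) dd. Qed.

Lemma tube_toC de x : 0 < de -> tube de (toC x).
Proof. by move=> de0 k; rewrite mxE /= normr0. Qed.

Lemma tube_open de z : tube de z ->
  exists2 r : R, 0 < r & forall z', rnorm (z' - z) < r -> tube de z'.
Proof.
move=> zd; exists (\big[Order.min/1]_k (de - `|complex.Im (z ord0 k)|)).
  by apply: lt_bigmin => // k _; rewrite subr_gt0.
move=> z' hz k.
have := le_lt_trans (nc_rnorm (z' - z) k) hz.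
move=> /lt_le_trans/(_ (bigmin_le _ k (fun k => de - `|complex.Im (z ord0 k)|))).
rewrite !mxE => /(le_lt_trans (Im_le _)); rewrite raddfB => h.
have := ler_normD (complex.Im (z' ord0 k) - complex.Im (z ord0 k)) (complex.Im (z ord0 k)).
rewrite subrK; lra.
Qed.

(** Holomorphic with exponential decay on a tube. The same [de] serves as the width
    of the tube and as the rate of decay, since the Fourier transform exchanges the
    two. *)
Definition eclext (de M : R) f := (forall z, tube de z -> differentiable f z) /\
  (forall z, tube de z -> nc (f z) <= M * expR (- (de * sumabs z))).

(** The kernel of the Fourier transform in coordinate [j]: the integration variable
    [w] replaces coordinate [j] of [f], and the old coordinate becomes the frequency. *)
Definition FTk (s : R) f z j (w : C) : C := f (upd z j w) * cexp ('i%C * s%:C * w * z ord0 j).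

Definition FText (s : R) j f z : C := cint leb setT (fun t => FTk s f z j t%:C).

Lemma ReFT (s : R) (w a : C) : complex.Re ('i%C * s%:C * w * a) =
  - (s * (complex.Re w * complex.Im a + complex.Im w * complex.Re a)).
Proof. by case: w a => [u v] [p q] /=; ring. Qed.

Variables (de M : R) (f : 'rV[C]_n -> C) (s : R).
Hypothesis (de0 : 0 < de) (hf : eclext de M f) (s1 : `|s| = 1).

Lemma eclext_M0 : 0 <= M.
Proof.
have := hf.2 0 ltac:(by move=> k; rewrite mxE normr0).
by move=> /(le_trans (nc_ge0 _)); rewrite pmulr_lge0// expR_gt0.
Qed.

Lemma FTk_bound z j (w : C) : tube de z -> `|complex.Im w| < de ->
  nc (FTk s f z j w) <= M * expR (- (de * (sumabs z - `|complex.Re (z ord0 j)|)) -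
     s * complex.Im w * complex.Re (z ord0 j)) *
     edecay (de - `|complex.Im (z ord0 j)|) (complex.Re w).
Proof.
move=> zd wd; rewrite ncM nc_cexp ReFT.
apply: le_trans (ler_wpM2r (expR_ge0 _) (hf.2 _ (tube_upd j zd wd))) _.
rewrite sumabs_upd /edecay -!mulrA -!expRD ler_wpM2l ?eclext_M0// ler_expR.
set X := sumabs z - _; set a := complex.Re w; set b := complex.Im (z ord0 j).
have : - (s * (a * b)) <= `|a| * `|b|.
  by apply: le_trans (ler_norm _) _; rewrite normrN !normrM s1 mul1r.
rewrite mulrBl [`|b| * _]mulrC; lra.
Qed.

Lemma FTk_diff z j (w : C) : tube de z -> `|complex.Im w| < de ->
  differentiable (FTk s f z j) w.
Proof.
move=> zd wd; apply: differentiableM.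
  rewrite (_ : (fun w => _) = (fun u : C => f (upd z j 0 + u *: delta_mx ord0 j))).
    by apply: (line_cder _).1; rewrite -updE; apply: hf.1; exact: tube_upd.
  by apply/funext => u; rewrite updE.
apply: cexp_comp; apply: differentiableM; last exact: differentiable_cst.
by apply: differentiableM; first exact: differentiable_cst.
Qed.

Lemma FTk_cont z j : tube de z -> continuous (fun t : R => FTk s f z j t%:C).
Proof.
move=> zd t; apply: (@continuous_comp _ _ _ (fun t : R => t%:C : C) (FTk s f z j)).
  exact: RtoC_continuous.
by apply: differentiable_continuous; apply: FTk_diff => //=; rewrite normr0.
Qed.

Lemma FTk_meas z j : tube de z ->
  cmeas (setT : set (measurableTypeR R)) (fun t => FTk s f z j t%:C).
Proof. by move=> zd; apply: cont_cmeas; exact: FTk_cont. Qed.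

Lemma FTk_bound2 z j (t : measurableTypeR R) : tube (de / 2) z ->
  nc (FTk s f z j t%:C) <= M * edecay (de / 2) t.
Proof.
move=> zd; have zd' : tube de z.
  by apply: tubeW zd; rewrite ler_pdivrMr// ler_pMr// ler1n.
apply: le_trans (FTk_bound _ _ _) _ => //=; first by rewrite normr0.
rewrite mulr0 mul0r subr0 /edecay -mulrA -expRD ler_wpM2l ?eclext_M0// ler_expR.
have h1 : 0 <= de * (sumabs z - `|complex.Re (z ord0 j)|).
  by rewrite mulr_ge0 ?(ltW de0)// subr_ge0 sumabs_j.
have h2 : de / 2 * `|t| <= (de - `|complex.Im (z ord0 j)|) * `|t|.
  by rewrite ler_wpM2r//; have := zd j; lra.
lra.
Qed.

Lemma upd_diff j (w : C) z : differentiable (fun z => upd z j w) z.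
Proof.
under eq_fun do rewrite updE2.
apply: differentiableD => //.
apply: differentiableZl; apply: differentiableB; first exact: differentiable_cst.
exact: differentiable_coord.
Qed.

Lemma FTk_diffz z j (t : R) : tube de z ->
  differentiable (fun z => FTk s f z j t%:C) z.
Proof.
move=> zd; apply: differentiableM.
  apply: (@differentiable_comp _ _ _ _ (fun z => upd z j t%:C) f); first exact: upd_diff.
  by apply: hf.1; apply: tube_upd => //=; rewrite normr0.
apply: cexp_compV; apply: differentiableM; first exact: differentiable_cst.
exact: differentiable_coord.
Qed.

Lemma FText_diff z j : tube (de / 2) z -> differentiable (FText s j f) z /\
  forall v, 'd (FText s j f) z v =
    cint leb setT (fun t => 'd (fun z => FTk s f z j t%:C) z v).
Proof.
move=> zd; have d2 : 0 < de / 2 by rewrite divr_gt0.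
have dd : de / 2 <= de by rewrite ler_pdivrMr// ler_pMr// ler1n.
have [r r0 Hr] := tube_open zd.
apply: (@param_diff _ _ _ _ leb (fun z t => FTk s f z j t%:C) z r (fun t => M * edecay (de / 2) t)).
- exact: r0.
- by move=> t z' /Hr h; apply: FTk_diffz; apply: tubeW h.
- by move=> t z' /Hr h; exact: FTk_bound2.
- by move=> z' /Hr h; apply: FTk_meas; apply: tubeW h.
- by apply: RintZ => //; exact: integrable_edecay.
Qed.

Definition Kde (de : R) : R := Rintegral leb setT (edecay (de / 2)).

(** Decay in the frequency: shifting the integration line by [de / 2] towards
    the sign of the frequency gains a factor [exp(- de / 2 |Re z_j|)]. *)
Lemma FText_bound z j : tube (de / 2) z ->
  nc (FText s j f z) <= M * Kde de * expR (- (de / 2 * sumabs z)).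
Proof.
move=> zd; have d2 : 0 < de / 2 by rewrite divr_gt0.
have dd : de / 2 <= de by rewrite ler_pdivrMr// ler_pMr// ler1n.
have ddl : de / 2 < de by rewrite ltr_pdivrMr// ltr_pMr// ltr1n.
have zd' := tubeW dd zd; have zj := zd j.
set X := complex.Re (z ord0 j).
pose y := if 0 <= s * X then de / 2 else - (de / 2).
have yd : `|y| < de by rewrite /y; case: ifP => _; rewrite ?normrN gtr0_norm.
have yX : s * y * X = de / 2 * `|X|.
  rewrite mulrAC /y; have <- : `|s * X| = `|X| by rewrite normrM s1 mul1r.
  case: ifPn => h; first by rewrite ger0_norm// mulrC.
  by rewrite ltr0_norm ?ltNge// mulrN mulrC mulrN.
have M0 := eclext_M0.
rewrite /FText.
have -> : cint leb setT (fun t => FTk s f z j t%:C) = cint leb setT (fun t => FTk s f z j (t +i* y)).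
  apply: (@line_shift _ (FTk s f z j) de (M * expR (de * `|X|)) (de / 2) 0 y) => //.
  - by move=> w wd; exact: FTk_diff.
  - move=> w wd; apply: le_trans (FTk_bound _ _ _) _ => //.
    rewrite -!mulrA ler_wpM2l// /edecay -!expRD ler_expR -/X.
    have h1 : 0 <= de * (sumabs z - `|X|) by rewrite mulr_ge0 ?(ltW de0)// subr_ge0 sumabs_j.
    have h2 : de / 2 * `|complex.Re w| <= (de - `|complex.Im (z ord0 j)|) * `|complex.Re w|.
      by rewrite ler_wpM2r//; lra.
    have h3 : - (s * (complex.Im w * X)) <= de * `|X|.
      apply: le_trans (ler_norm _) _; rewrite !normrN !normrM s1 mul1r.
      by rewrite ler_wpM2r// ltW.
    lra.
  - by rewrite normr0.
have bd (t : measurableTypeR R) : nc (FTk s f z j (t +i* y)) <= M * expR (- (de / 2 * sumabs z)) * edecay (de / 2) t.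
  apply: le_trans (FTk_bound _ _ _) _ => //=; rewrite -/X yX.
  rewrite -!mulrA ler_wpM2l// /edecay -!expRD ler_expR.
  have h1 : de / 2 * sumabs z <= de * (sumabs z - `|X|) + de / 2 * `|X|.
    have : 0 <= de / 2 * (sumabs z - `|X|).
      by rewrite mulr_ge0 ?(ltW d2)// subr_ge0 sumabs_j.
    by rewrite !mulrBr; lra.
  have h2 : de / 2 * `|t| <= (de - `|complex.Im (z ord0 j)|) * `|t|.
    by rewrite ler_wpM2r//; lra.
  lra.
have -> : M * Kde de * expR (- (de / 2 * sumabs z)) =
   Rintegral leb setT (fun t => M * expR (- (de / 2 * sumabs z)) * edecay (de / 2) t).
  by rewrite RintegralZl//; [rewrite -/(Kde de); ring|exact: integrable_edecay].
have iG : leb.-integrable setT (EFin \o (fun t => M * expR (- (de / 2 * sumabs z)) * edecay (de / 2) t)).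
  by apply: RintZ => //; exact: integrable_edecay.
apply: cint_norm => //.
apply: (le_cintable (G := fun t => M * expR (- (de / 2 * sumabs z)) * edecay (de / 2) t)) => //.
apply: cont_cmeas; apply: (@line_cont _ (FTk s f z j) de y) => // w wd.
exact: FTk_diff.
Qed.

Lemma FText_ecl j : eclext (de / 2) (M * Kde de) (FText s j f).
Proof. by split=> z zd; [exact: (FText_diff _ zd).1|exact: FText_bound]. Qed.

End FText.

(** * Gaussian integrals and one-dimensional Fourier inversion *)
Section gaussian.
Context {R : realType}.
Local Notation C := R[i].
Local Notation leb := (@lebesgue_measure R).

(** The Gaussian integral, that is, the square root of pi. Fourier inversion holds up to
    the factor [2 * Gam ^ 2] per coordinate, which [Fin] divides out. *)
Definition Gam : R := Rintegral leb setT (@gauss_fun R).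

Lemma Gam_gt0 : 0 < Gam.
Proof. by rewrite /Gam /Rintegral integralT_gauss/= sqrtr_gt0 pi_gt0. Qed.

Lemma integrable_gauss : leb.-integrable setT (EFin \o (@gauss_fun R)).
Proof. exact: integrableT_gauss. Qed.

(** Completing the square: the integral of [exp(- z^2)] along [Im z = - b / 2] equals
    the one along the real line. *)
Lemma gauss_osc (b : R) :
  cint leb setT (fun t : measurableTypeR R => (gauss_fun t)%:C * cexp ('i%C * (b * t)%:C)) =
  (Gam * expR (- (b ^+ 2 / 4)))%:C.
Proof.
pose f (z : C) := cexp (- (z * z)).
have df z : differentiable f z by apply: cexp_comp; apply: differentiableN; apply: differentiableM.
have nf (z : C) : nc (f z) = expR (complex.Im z ^+ 2 - complex.Re z ^+ 2).
  by rewrite nc_cexp; congr expR; case: z => x y /=; ring.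
pose de := `|b| + 1.
have fb (z : C) : `|complex.Im z| < de -> nc (f z) <= expR (de ^+ 2 + 1) * edecay 1 (complex.Re z).
  move=> zd; rewrite nf /edecay -expRD ler_expR mul1r.
  have : complex.Im z ^+ 2 <= de ^+ 2.
    by rewrite -(real_normK (num_real (complex.Im z))) lerXn2r ?nnegrE ?(ltW zd)// /de addr_ge0.
  have : 0 <= (`|complex.Re z| - 1 / 2) ^+ 2 by exact: sqr_ge0.
  rewrite -(real_normK (num_real (complex.Re z))).
  move: `|complex.Re z| => r; rewrite !expr2; nra.
have d0 : `|0 : R| < de by rewrite normr0 ltr_wpDl.
have db : `|- (b / 2)| < de.
  rewrite normrN normrM (gtr0_norm (_ : 0 < 2^-1))//.
  by have : 0 <= `|b| by []; rewrite /de; lra.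
have := line_shift (ltr01 : (0:R) < 1) (fun z _ => df z) fb d0 db.
rewrite (_ : cint leb setT (fun t => f (t +i* 0)) = Gam%:C); last first.
  rewrite /cint /Gam; apply/eqP; rewrite eq_complex/=; apply/andP; split; apply/eqP.
    apply: eq_Rintegral => t _; rewrite /f /cexp /= /gauss_fun expr2.
    by rewrite !mulr0 mul0r subr0 addr0 oppr0 cos0 sin0 mulr1 mulr0 subr0.
  rewrite -[RHS](mul0r (Rintegral leb setT (@gauss_fun R))) -RintegralZl//; last exact: integrable_gauss.
  apply: eq_Rintegral => t _; rewrite /f /cexp /=.
  by rewrite !mulr0 mul0r addr0 oppr0 cos0 sin0 !mul0r mulr0 addr0.
have E (t : R) : f (t +i* - (b / 2)) =
   (expR (b ^+ 2 / 4))%:C * ((gauss_fun t)%:C * cexp ('i%C * (b * t)%:C)).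
  rewrite /f /gauss_fun.
  have -> : - ((t +i* - (b / 2)) * (t +i* - (b / 2))) =
     (b ^+ 2 / 4 - t ^+ 2)%:C + 'i%C * (b * t)%:C.
    by apply/eqP; rewrite eq_complex/=; apply/andP; split; apply/eqP; field.
  rewrite cexpD mulrA; congr (_ * _).
  rewrite /cexp /= cos0 sin0 expRD -rmorphM/=.
  by apply/eqP; rewrite eq_complex/=; apply/andP; split; apply/eqP; ring.
under [in X in _ = X -> _]eq_cint do rewrite E.
rewrite cintZ//; last first.
  apply: (@le_cintable _ _ (measurableTypeR R) leb setT _ (@gauss_fun R)) => //.
  - apply: cont_cmeas => t; apply: cvgM; last first.
      apply: (@continuous_comp _ _ _ (fun t : R => (b * t)%:C) (fun z => cexp ('i%C * z))).
        apply: (@continuous_comp _ _ _ (fun t : R => b * t) (fun z => z%:C : C)).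
          exact: mulrl_continuous.
        exact: RtoC_continuous.
      apply: differentiable_continuous; apply: cexp_comp; exact: differentiableM.
    apply: (@continuous_comp _ _ _ (@gauss_fun R) (fun z => z%:C : C)).
      exact: continuous_gauss_fun.
    exact: RtoC_continuous.
  - exact: integrable_gauss.
  - move=> t _; rewrite ncM nc_cexp nc_real ger0_norm ?gauss_fun_ge0//=.
    by rewrite mul0r mul1r subrr expR0 mulr1.
set X := cint _ _ _ => H.
by rewrite (rmorphM (real_complex R)) /= H mulrAC -(rmorphM (real_complex R)) /= -expRD subrr expR0 mul1r.
Qed.

End gaussian.
Section cfubini.
Context {R : realType}.
Local Notation C := R[i].
Local Notation leb := (@lebesgue_measure R).
Local Notation mR := (measurableTypeR R).

Lemma cfubini (F : mR * mR -> C) (A B : mR -> R) :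
  cmeas setT F -> leb.-integrable setT (EFin \o A) -> leb.-integrable setT (EFin \o B) ->
  (forall x y, nc (F (x, y)) <= A x * B y) ->
  cint leb setT (fun x => cint leb setT (fun y => F (x, y))) =
  cint leb setT (fun y => cint leb setT (fun x => F (x, y))).
Proof.
move=> [mr mi] iA iB FAB.
have H (f : mR * mR -> R) : measurable_fun setT f -> (forall x y, `|f (x, y)| <= A x * B y) ->
    Rintegral leb setT (fun x => Rintegral leb setT (fun y => f (x, y))) =
    Rintegral leb setT (fun y => Rintegral leb setT (fun x => f (x, y))).
  move=> mf fAB.
  have mf' : measurable_fun setT (EFin \o f) by exact/measurable_EFinP.
  have m1 x : measurable_fun setT (fun y => f (x, y)).
    by apply: (measurableT_comp mf); exact: pair1_measurable.
  have m2 y : measurable_fun setT (fun x => f (x, y)).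
    by apply: (measurableT_comp mf); exact: pair2_measurable.
  have i1 x : leb.-integrable setT (EFin \o (fun y => f (x, y))).
    apply: (le_integrable _ _ _ (RintZ (A x) measurableT iB)) => //.
      exact/measurable_EFinP.
    by move=> y _ /=; rewrite lee_fin (le_trans (fAB _ _))// ler_norm.
  have i2 y : leb.-integrable setT (EFin \o (fun x => f (x, y))).
    apply: (le_integrable _ _ _ (RintZ (B y) measurableT iA)) => //.
      exact/measurable_EFinP.
    by move=> x _ /=; rewrite lee_fin (le_trans (fAB _ _))// mulrC ler_norm.
  have iF : (leb \x leb)%E.-integrable setT (EFin \o f).
    apply/integrable12ltyP => //=.
    apply: (@le_lt_trans _ _ (\int[leb]_x ((`|A x| * Rintegral leb setT (fun y => `|B y|))%:E))%E).
      apply: ge0_le_integral => //=.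
      - by move=> x _; exact: integral_ge0.
      - apply: (@measurable_fun_fubini_tonelli_F _ _ _ _ _ leb (fun z => `|(f z)%:E|%E)) => //.
        exact: measurableT_comp.
      - apply/measurable_EFinP; apply: measurable_funM => //.
        by apply: measurableT_comp => //; apply/measurable_EFinP; exact: measurable_int iA.
      - move=> x _; apply: (@le_trans _ _ (\int[leb]_y ((`|A x| * `|B y|)%:E))%E).
          apply: ge0_le_integral => //=.
          + by apply/measurable_EFinP; apply: measurableT_comp => //; exact: m1.
          + apply/measurable_EFinP; apply: measurable_funM => //.
            by apply: measurableT_comp => //; apply/measurable_EFinP; exact: measurable_int iB.
          + by move=> y _; rewrite lee_fin (le_trans (fAB _ _))// -normrM ler_norm.
        have iB' : leb.-integrable setT (EFin \o (fun y => `|B y|)).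
          by have := integrable_abse iB; apply: eq_integrable => // y _.
        rewrite -RintegralZl// fineK//.
        by apply: integrable_fin_num => //; exact: (RintZ `|A x| measurableT iB').
    have iA' : leb.-integrable setT (EFin \o (fun y => `|A y|)).
      by have := integrable_abse iA; apply: eq_integrable => // y _.
    have := RintZ (Rintegral leb setT (fun y => `|B y|)) measurableT iA'.
    move=> /integrableP[_]; apply: le_lt_trans; apply: ge0_le_integral => //.
    - by move=> x _; rewrite lee_fin mulr_ge0// Rintegral_ge0.
    - apply/measurable_EFinP; apply: measurable_funM => //.
      by apply/measurable_EFinP; exact: measurable_int iA'.
    - apply: measurableT_comp => //; apply/measurable_EFinP; apply: measurable_funM => //.
      by apply/measurable_EFinP; exact: measurable_int iA'.
    - by move=> x _; rewrite /= lee_fin mulrC ler_norm.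
  have := Fubini iF => /= /(congr1 fine).
  have -> : (\int[leb]_x \int[leb]_y (f (x, y))%:E = \int[leb]_x (Rintegral leb setT (fun y => f (x, y)))%:E)%E.
    by apply: eq_integral => x _; rewrite fineK//; exact: (integrable_fin_num measurableT (i1 x)).
  have -> : (\int[leb]_y \int[leb]_x (f (x, y))%:E = \int[leb]_y (Rintegral leb setT (fun x => f (x, y)))%:E)%E.
    by apply: eq_integral => x _; rewrite fineK//; exact: (integrable_fin_num measurableT (i2 x)).
  by [].
rewrite /cint /=; congr (_ +i* _).
  by apply: (H (fun z => complex.Re (F z)) mr) => x y; apply: le_trans (Re_le _) _.
by apply: (H (fun z => complex.Im (F z)) mi) => x y; apply: le_trans (Im_le _) _.
Qed.

Lemma cmeas_cexp {d : measure_display} {T : measurableType d} (f : T -> C) :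
  cmeas setT f -> cmeas setT (fun x => cexp (f x)).
Proof.
move=> [fr fi].
have E x : cexp (f x) = (expR (complex.Re (f x)) * cos (complex.Im (f x))) +i*
   (expR (complex.Re (f x)) * sin (complex.Im (f x))).
  by rewrite /cexp; apply/eqP; rewrite eq_complex/=; apply/andP; split; apply/eqP; ring.
split; under eq_fun do rewrite E /=.
  apply: measurable_funM; first exact: (measurableT_comp (@measurable_expR R)).
  by apply: (measurableT_comp _ fi); apply: continuous_measurable_fun; exact: continuous_cos.
apply: measurable_funM; first exact: (measurableT_comp (@measurable_expR R)).
by apply: (measurableT_comp _ fi); apply: continuous_measurable_fun; exact: continuous_sin.
Qed.

Lemma cmeas_real {d : measure_display} {T : measurableType d} (f : T -> R) :
  measurable_fun setT f -> cmeas setT (fun x => (f x)%:C : C).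
Proof. by move=> mf; split => //=; exact: measurable_cst. Qed.

Lemma cmeas_comp {d d' : measure_display} {T : measurableType d} {T' : measurableType d'}
  (f : T' -> C) (g : T -> T') : cmeas setT f -> measurable_fun setT g ->
  cmeas setT (fun x => f (g x)).
Proof. by move=> [fr fi] mg; split; [exact: (measurableT_comp fr)|exact: (measurableT_comp fi)]. Qed.

(** The oscillating factor of the Fourier transform; [s] is the sign of the phase. *)
Definition osc (s x t : R) : C := cexp ('i%C * (s * x * t)%:C).

Lemma nc_osc s x t : nc (osc s x t) = 1.
Proof. by rewrite nc_cexp /= mul0r mul1r subrr expR0. Qed.

(** For [h] tending to 0 this is an approximate identity in [b]. *)
Lemma gauss_osc_scaled (h b : R) : 0 < h ->
  cint leb setT (fun t : mR => (gauss_fun (h * t))%:C * cexp ('i%C * (b * t)%:C)) =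
  (h^-1 * (Gam * gauss_fun (b / (2 * h))))%:C.
Proof.
move=> h0; have hn : h^-1 != 0 by rewrite gt_eqF ?invr_gt0.
pose f (t : mR) : C := (gauss_fun (h * t))%:C * cexp ('i%C * (b * t)%:C).
have fi : cintable leb setT f.
  apply: (@le_cintable _ _ _ leb setT f (fun t => gauss_fun (h * t))) => //.
  - apply: cmeasM => //.
      apply: cmeas_real; apply: continuous_measurable_fun => t.
      apply: (@continuous_comp _ _ _ (fun t : R => h * t) gauss_fun).
        exact: mulrl_continuous.
      exact: continuous_gauss_fun.
    apply: cmeas_cexp; apply: cmeasM => //.
    by apply: cmeas_real; exact: measurable_funM.
  - have := integrable_affine 0 (ltac:(by rewrite gt_eqF) : h != 0) (@integrable_gauss R).
    by apply: eq_integrable => // t _; rewrite /= /aff addr0.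
  - move=> t _; rewrite ncM nc_real ger0_norm ?gauss_fun_ge0// nc_cexp /=.
    by rewrite mul0r mul1r subrr expR0 mulr1.
rewrite -/f (cint_affine 0 hn fi).2 gtr0_norm ?invr_gt0//.
rewrite (rmorphM (real_complex R)) /=; congr (_ * _).
transitivity (cint leb setT (fun t : mR => (gauss_fun t)%:C * cexp ('i%C * ((b / h) * t)%:C))).
  apply: eq_cint => t _; rewrite /f /= /aff addr0 mulrA divff ?gt_eqF// mul1r.
  by rewrite [b * _]mulrA.
rewrite gauss_osc; congr (_ * _)%:C; rewrite /gauss_fun; congr expR.
by field; rewrite gt_eqF.
Qed.

Lemma clim_comp (u : nat -> R) (g : R -> C) (a : R) : u n @[n --> \oo] --> a ->
  {for a, continuous g} -> clim (fun n => g (u n)) (g a).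
Proof.
move=> ua ga e e0.
have := cvg_comp _ _ ua ga => /= H.
have ec0 : (0 : C) < e%:C by rewrite ltcR0.
have h : \forall n \near \oo, ball (g a) e%:C (g (u n)) := H _ (nbhsx_ballx (g a) _ ec0).
apply: filterS h => n.
by rewrite -ball_normE/= /ball_/= normCE ltcR ncBC => /ltW.
Qed.

(** Insert the factor [gauss_fun (h xi)], integrate in [xi] first (Fubini and
    [gauss_osc_scaled]) and rescale, so that only [u (2 h t + a)] against a Gaussian
    remains; then let [h] tend to 0 on both sides. *)
Lemma inversion1 (u v : mR -> C) (M c M' c' s a : R) : `|s| = 1 -> 0 < c -> 0 < c' ->
  continuous (u : R -> C) -> (forall t, nc (u t) <= M * edecay c t) ->
  continuous (v : R -> C) -> (forall t, nc (v t) <= M' * edecay c' t) ->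
  (forall xi, v xi = cint leb setT (fun t => u t * osc s xi t)) ->
  cint leb setT (fun xi => v xi * osc (- s) xi a) = (2 * Gam ^+ 2)%:C * u a.
Proof.
move=> s1 c0 c'0 uc uM vc vM vE.
have ss : s * s = 1.
  by rewrite -expr2 -(real_normK (num_real s)) s1 expr1n.
have iU := integrable_edecay c0; have iV := integrable_edecay c'0.
pose h (m : nat) : R := m.+1%:R^-1.
have h0 m : 0 < h m by rewrite invr_gt0.
have hl : h m @[m --> \oo] --> 0 by exact: cvg_harmonic.
pose A m := cint leb setT (fun xi : mR => v xi * osc (- s) xi a * (gauss_fun (h m * xi))%:C).
have mosc (b : R) (k : R): cmeas setT (fun xi : mR => osc k xi b : C).
  apply: cmeas_cexp; apply: cmeasM => //; apply: cmeas_real.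
  by apply: measurable_funM => //; apply: measurable_funM.
have mg m : measurable_fun setT (fun xi : mR => gauss_fun (h m * xi)).
  apply: continuous_measurable_fun => t.
  apply: (@continuous_comp _ _ _ (fun t : R => h m * t) gauss_fun).
    exact: mulrl_continuous.
  exact: continuous_gauss_fun.
have L1 : clim A (cint leb setT (fun xi => v xi * osc (- s) xi a)).
  apply: (@cint_dct _ _ _ leb setT _ _ (fun t => M' * edecay c' t)) => //.
  - move=> m; apply: cmeasM => //; last exact: cmeas_real.
    by apply: cmeasM => //; exact: cont_cmeas.
  - by apply: cmeasM => //; exact: cont_cmeas.
  - exact: RintZ.
  - move=> m t _; rewrite ncM ncM nc_osc mulr1 nc_real ger0_norm ?gauss_fun_ge0//.
    apply: le_trans (vM t); rewrite ler_piMr// gauss_fun_le1//.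
  - move=> t _; have := @clim_comp (fun m => h m * t)
      (fun y : R => v t * osc (- s) t a * (gauss_fun y)%:C) (0 * t) _ _.
    have g0 : gauss_fun (0 * t) = 1 by rewrite /gauss_fun mul0r expr0n oppr0 expR0.
    rewrite g0 mulr1; apply.
      by apply: cvgM => //; exact: cvg_cst.
    apply: cvgM; first exact: cvg_cst.
    apply: (@continuous_comp _ _ _ (@gauss_fun R) (fun z => z%:C : C)).
      exact: continuous_gauss_fun.
    exact: RtoC_continuous.
have AE m : A m = 2%:C * Gam%:C * cint leb setT (fun t : mR => u (2 * h m * t + a) * (gauss_fun t)%:C).
  have h2 : 2 * h m != 0 by rewrite gt_eqF// mulr_gt0.
  pose F (z : mR * mR) : C := u z.2 * (osc s z.1 z.2 * osc (- s) z.1 a * (gauss_fun (h m * z.1))%:C).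
  have ig : leb.-integrable setT (EFin \o (fun xi : mR => gauss_fun (h m * xi))).
    have := integrable_affine 0 (ltac:(by rewrite gt_eqF) : h m != 0) (@integrable_gauss R).
    by apply: eq_integrable => // t _; rewrite /= /aff addr0.
  have ic (xi : mR) : cintable leb setT (fun t => u t * osc s xi t).
    apply: (@le_cintable _ _ _ leb setT _ (fun t => M * edecay c t)) => //.
    - apply: cmeasM => //; first exact: cont_cmeas.
      apply: cmeas_cexp; apply: cmeasM => //; apply: cmeas_real.
      exact: measurable_funM.
    - exact: RintZ.
    - by move=> t _; rewrite ncM nc_osc mulr1.
  have -> : A m = cint leb setT (fun xi => cint leb setT (fun t => F (xi, t))).
    apply: eq_cint => xi _; rewrite vE mulrC [in LHS]mulrC -[in LHS]mulrA.
    rewrite [in LHS]mulrC -cintZ//.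
    by apply: eq_cint => t _; rewrite /F /=; ring.
  rewrite (cfubini (A := fun xi => gauss_fun (h m * xi)) (B := fun t => M * edecay c t)) //; first last.
  - move=> xi t; change (nc (u t * (osc s xi t * osc (- s) xi a * (gauss_fun (h m * xi))%:C)) <=
      gauss_fun (h m * xi) * (M * edecay c t)).
    rewrite ncM ncM ncM !nc_osc !mul1r nc_real ger0_norm ?gauss_fun_ge0// mulrC.
    by rewrite ler_wpM2l// gauss_fun_ge0.
  - exact: RintZ.
  - apply: cmeasM => //.
      exact: (cmeas_comp (cont_cmeas uc) measurable_snd).
    apply: cmeasM => //; last first.
      by apply: cmeas_real; apply: (measurableT_comp (mg m)); exact: measurable_fst.
    apply: cmeasM => //.
      apply: cmeas_cexp; apply: cmeasM => //; apply: cmeas_real.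
      apply: measurable_funM => //; apply: measurable_funM => //.
    apply: cmeas_cexp; apply: cmeasM => //; apply: cmeas_real.
    by apply: measurable_funM => //; apply: measurable_funM.
  have inner (t : mR) : cint leb setT (fun xi => F (xi, t)) =
     ((h m)^-1 * Gam)%:C * (u t * (gauss_fun ((t - a) / (2 * h m)))%:C).
    transitivity (u t * cint leb setT (fun xi : mR => (gauss_fun (h m * xi))%:C *
       cexp ('i%C * (s * (t - a) * xi)%:C))).
      rewrite -cintZ//; last first.
        apply: (@le_cintable _ _ _ leb setT _ (fun t => gauss_fun (h m * t))) => //.
        - apply: cmeasM => //; first exact: cmeas_real.
          apply: cmeas_cexp; apply: cmeasM => //; apply: cmeas_real.
          exact: measurable_funM.
        - move=> xi _; rewrite ncM nc_real ger0_norm ?gauss_fun_ge0// nc_cexp /=.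
          by rewrite mul0r mul1r subrr expR0 mulr1.
      apply: eq_cint => xi _; rewrite /F /= /osc -cexpD -mulrDr -rmorphD/=.
      rewrite [X in _ * X]mulrC; congr (_ * (_ * cexp (_ * _%:C))); ring.
    rewrite gauss_osc_scaled//.
    rewrite (_ : gauss_fun (s * (t - a) / (2 * h m)) = gauss_fun ((t - a) / (2 * h m))); last first.
      by rewrite /gauss_fun -mulrA exprMn expr2 ss mul1r.
    by rewrite !(rmorphM (real_complex R))/=; ring.
  under eq_cint do rewrite inner.
  have ci : cintable leb setT (fun t : mR => u t * (gauss_fun ((t - a) / (2 * h m)))%:C).
    apply: (@le_cintable _ _ _ leb setT _ (fun t => M * edecay c t)) => //.
    - apply: cmeasM => //; first exact: cont_cmeas.
      apply: cmeas_real.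
      apply: continuous_measurable_fun => t.
      apply: (@continuous_comp _ _ _ (fun t : R => (t - a) / (2 * h m)) gauss_fun).
        by apply: cvgMl; apply: cvgB; [exact: cvg_id|exact: cvg_cst].
      exact: continuous_gauss_fun.
    - exact: RintZ.
    - move=> t _; rewrite ncM nc_real ger0_norm ?gauss_fun_ge0//.
      by apply: le_trans (uM t); rewrite ler_piMr// gauss_fun_le1.
  have E1 := cintZ (((h m)^-1 * Gam)%:C) measurableT ci.
  have [_ E2] := cint_affine a h2 ci.
  have E3 : cint leb setT ((fun t : mR => u t * (gauss_fun ((t - a) / (2 * h m)))%:C) \o aff (2 * h m) a) =
    cint leb setT (fun t : mR => u (2 * h m * t + a) * (gauss_fun t)%:C).
    by apply: eq_cint => t _; rewrite /= /aff addrK [_ * t / _]mulrAC divff// mul1r.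
  etransitivity; first exact: E1.
  rewrite E2 E3; set J := cint _ _ _; move: J => J.
  have n2 : `|2 * h m| = 2 * h m by exact: gtr0_norm (mulr_gt0 (ltr0Sn R 1) (h0 m)).
  rewrite n2 mulrA; apply: (congr1 (fun w => w * J)).
  rewrite -!(rmorphM (real_complex R)) /=; congr (_%:C); field.
  by rewrite gt_eqF.
have L2 : clim (fun m => cint leb setT (fun t : mR => u (2 * h m * t + a) * (gauss_fun t)%:C))
   (cint leb setT (fun t : mR => u a * (gauss_fun t)%:C)).
  have M0 : 0 <= M.
    by have := le_trans (nc_ge0 _) (uM 0); rewrite pmulr_lge0//; exact: expR_gt0.
  apply: (@cint_dct _ _ _ leb setT _ _ (fun t => M * gauss_fun t)) => //.
  - move=> m; apply: cmeasM => //; last by apply: cmeas_real; exact: measurable_gauss_fun.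
    apply: (@cmeas_comp _ _ _ _ u (fun t : mR => 2 * h m * t + a)); first exact: cont_cmeas.
    by apply: measurable_funD => //; exact: measurable_funM.
  - by apply: cmeasM => //; apply: cmeas_real; exact: measurable_gauss_fun.
  - by apply: RintZ => //; exact: integrable_gauss.
  - move=> m t _; rewrite ncM nc_real ger0_norm ?gauss_fun_ge0//.
    rewrite ler_wpM2r ?gauss_fun_ge0// (le_trans (uM _))// ler_piMr//.
    by rewrite /edecay -[leRHS]expR0 ler_expR oppr_le0 mulr_ge0// ltW.
  - move=> t _; have := @clim_comp (fun m => 2 * h m * t + a)
      (fun y : R => u y * (gauss_fun t)%:C) (2 * 0 * t + a) _ _.
    have g0 : 2 * 0 * t + a = a by rewrite mulr0 mul0r add0r.
    rewrite [in X in _ -> _ -> X]g0; apply.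
      apply: cvgD; last exact: cvg_cst.
      apply: cvgM; last exact: cvg_cst.
      by apply: cvgM => //; exact: cvg_cst.
    by apply: cvgM; [exact: uc|exact: cvg_cst].
have L3 : clim A (2%:C * Gam%:C * cint leb setT (fun t : mR => u a * (gauss_fun t)%:C)).
  move=> e e0; have K0 : 0 < nc (2%:C * Gam%:C : C) + 1 by rewrite ltr_wpDl.
  have := L2 (e / (nc (2%:C * Gam%:C : C) + 1)) (divr_gt0 e0 K0).
  apply: filterS => m hm; rewrite AE -mulrBr ncM.
  apply: le_trans (_ : (nc (2%:C * Gam%:C : C) + 1) * (e / (nc (2%:C * Gam%:C : C) + 1)) <= _).
    by apply: ler_pM => //; rewrite lerDl.
  by rewrite mulrC divfK// gt_eqF.
rewrite (clim_unique L1 L3) cintZ//; last first.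
  apply: (@le_cintable _ _ _ leb setT _ (@gauss_fun R)) => //.
  - by apply: cmeas_real; exact: measurable_gauss_fun.
  - exact: integrable_gauss.
  - by move=> t _; rewrite nc_real ger0_norm// gauss_fun_ge0.
have -> : cint leb setT (fun t : mR => (gauss_fun t)%:C : C) = Gam%:C.
  rewrite /cint /Gam; congr (_ +i* _).
  have -> : Rintegral leb setT (fun t : mR => complex.Im (gauss_fun t)%:C) = Rintegral leb setT (fun=> 0).
    by apply: eq_Rintegral.
  by rewrite Rintegral_cst// mul0r.
by rewrite !(rmorphM, rmorphXn)/=; ring.
Qed.

End cfubini.

(** * Fourier transform in one coordinate on functions of real variables *)
Section cder_calc.
Context {R : realType}.
Local Notation C := R[i].

Lemma cderMc (f : C -> C) (z c : C) : differentiable f z ->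
  cder (fun w => f w * c) z = cder f z * c.
Proof.
move=> df; apply: (choloI _).2 => e e0.
have K0 : 0 < nc c + 1 by rewrite ltr_wpDl.
have [d d0 H] := choloE df (divr_gt0 e0 K0).
exists d => // h /H hh.
rewrite (_ : _ - _ - _ = (f (z + h) - f z - h * cder f z) * c); last first.
  by move: (cder f z) (f _) (f _) => *; ring.
rewrite ncM; apply: le_trans (ler_wpM2r (nc_ge0 c) hh) _.
rewrite mulrAC ler_wpM2r// mulrAC ler_pdivrMr// ler_wpM2l ?(ltW e0)//.
by rewrite lerDl.
Qed.

Lemma cder_cexp_lin (a b k : C) : differentiable (fun w : C => k * cexp (a * (b + w))) 0 /\
  cder (fun w : C => k * cexp (a * (b + w))) 0 = k * (a * cexp (a * b)).
Proof.
apply: choloI => e e0.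
have [df E] := cexp_diff (a * b).
have K0 : 0 < nc k * nc a + 1 by rewrite ltr_wpDl// mulr_ge0.
have [d d0 H] := choloE df (divr_gt0 e0 K0).
have A0 : 0 < nc a + 1 by rewrite ltr_wpDl.
exists (d / (nc a + 1)); first by rewrite divr_gt0.
move=> h hd; rewrite add0r addr0 mulrDr.
have ah : nc (a * h) < d.
  rewrite ncM; apply: le_lt_trans (_ : (nc a + 1) * nc h < _).
    by rewrite ler_wpM2r// lerDl.
  by rewrite mulrC -ltr_pdivlMr.
have := H _ ah; rewrite E => hh.
rewrite (_ : _ - _ - _ = k * (cexp (a * b + a * h) - cexp (a * b) - a * h * cexp (a * b))); last first.
  by move: (cexp _) (cexp _) => *; ring.
rewrite ncM; apply: le_trans (ler_wpM2l (nc_ge0 k) hh) _.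
rewrite ncM; set K := nc k * nc a + 1 in K0 *.
have -> : nc k * (e / K * (nc a * nc h)) = (nc k * nc a) * e / K * nc h by ring.
rewrite ler_wpM2r// ler_pdivrMr// mulrC ler_wpM2l ?(ltW e0)//.
by rewrite lerDl.
Qed.

End cder_calc.

Section FT.
Context {R : realType} {n : nat}.
Local Notation C := R[i].
Local Notation leb := (@lebesgue_measure R).
Local Notation mR := (measurableTypeR R).
Implicit Types (phi psi : 'rV[R]_n -> C) (f : 'rV[C]_n -> C) (x : 'rV[R]_n) (j k : 'I_n).

Definition ecl (de M : R) phi := exists2 f, eclext de M f & extends f phi.

Definition FT (s : R) j phi x : C :=
  cint leb setT (fun t : mR => phi (upd x j t) * osc s t (x ord0 j)).

Lemma FTk_toC (s : R) f phi x j (t : R) : extends f phi ->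
  FTk s f (toC x) j t%:C = phi (upd x j t) * osc s t (x ord0 j).
Proof.
move=> ef; rewrite /FTk -toC_upd ef mxE /osc; congr (_ * cexp _).
by rewrite !(rmorphM (real_complex R))/=; ring.
Qed.

Lemma FT_ext (s : R) f phi j : extends f phi -> extends (FText s j f) (FT s j phi).
Proof. by move=> ef x; apply: eq_cint => t _; exact: FTk_toC. Qed.

Lemma ecl_M0 de M phi : 0 < de -> ecl de M phi -> 0 <= M.
Proof. by move=> de0 [f hf ef]; exact: (eclext_M0 de0 hf). Qed.

Lemma FT_ecl (s de M : R) j phi : 0 < de -> `|s| = 1 -> ecl de M phi ->
  ecl (de / 2) (M * Kde de) (FT s j phi).
Proof.
move=> de0 s1 [f hf ef]; exists (FText s j f); first exact: FText_ecl.
exact: FT_ext.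
Qed.

Lemma eclW de de' M phi : 0 < de' <= de -> ecl de M phi -> ecl de' M phi.
Proof.
move=> /andP[de'0 dd] H; have M0 := ecl_M0 (lt_le_trans de'0 dd) H; move: H => [f [df fM] ef].
exists f => //; split => z zd; first by apply: df; exact: tubeW zd.
apply: le_trans (fM z (tubeW dd zd)) _.
by rewrite ler_wpM2l// ler_expR lerN2 ler_wpM2r// sumabs_ge0.
Qed.

Lemma ecl_lin de M N (a : C) phi psi : ecl de M phi -> ecl de N psi ->
  ecl de (nc a * M + N) (fun x => a * phi x + psi x).
Proof.
move=> [f [df fM] ef] [g [dg gN] eg]; exists (fun z => a * f z + g z).
  split => z zd.
    apply: differentiableD; last exact: dg.
    by apply: differentiableM; [exact: differentiable_cst|exact: df].
  apply: le_trans (ncD _ _) _; rewrite mulrDl lerD ?gN// ncM -mulrA.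
  by rewrite ler_wpM2l// fM.
by move=> x; rewrite ef eg.
Qed.

(** A multiplier of growth [exp(de / 2 sumabs z)] costs half of the decay. *)
Lemma ecl_mul de M K (m : 'rV[C]_n -> C) phi : 0 < de ->
  (forall z, tube de z -> differentiable m z) ->
  (forall z, tube de z -> nc (m z) <= K * expR (de / 2 * sumabs z)) ->
  ecl de M phi -> ecl (de / 2) (K * M) (fun x => m (toC x) * phi x).
Proof.
move=> de0 dm mK [f [df fM] ef]; have dd : de / 2 <= de by rewrite ler_pdivrMr// ler_pMr// ler1n.
exists (fun z => m z * f z); last by move=> x; rewrite ef.
split=> z /(tubeW dd) zd; first by apply: differentiableM; [exact: dm|exact: df].
rewrite ncM; apply: le_trans (ler_pM _ _ (mK z zd) (fM z zd)) _ => //.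
rewrite mulrACA -expRD le_eqVlt; apply/orP; left; apply/eqP; congr (_ * expR _).
by field.
Qed.

Lemma coord_bound (de : R) (z : 'rV[C]_n) k : 0 < de -> tube de z ->
  nc (z ord0 k) <= (2 / de + de) * expR (de / 2 * sumabs z).
Proof.
move=> de0 zd; apply: le_trans (nc_le _) _.
have h1 := sumabs_j z k; have h2 := ltW (zd k); have s0 := sumabs_ge0 z.
have h3 := expR_ge1Dx (de / 2 * sumabs z).
have h4 : 0 <= de / 2 * sumabs z by rewrite mulr_ge0// divr_ge0// ltW.
rewrite mulrDl lerD//.
  apply: (le_trans h1); rewrite -ler_pdivrMl ?divr_gt0// invf_div.
  by apply: le_trans h3; rewrite lerDr.
by rewrite (le_trans h2)// ler_peMr ?(ltW de0)//; lra.
Qed.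

Lemma ecl_xmul de M k phi : 0 < de -> ecl de M phi ->
  ecl (de / 2) ((2 / de + de) * M) (fun x => (x ord0 k)%:C * phi x).
Proof.
move=> de0 h.
have := @ecl_mul de M (2 / de + de) (fun z => z ord0 k) phi de0
  (fun z _ => differentiable_coord _ _ _) (fun z => @coord_bound de z k de0) h.
move=> [f hf ef]; exists f => //.
by move=> x; rewrite ef mxE.
Qed.

Lemma toC_tube de x : 0 < de -> tube de (toC x).
Proof. exact: tube_toC. Qed.

Lemma ecl_line de M phi x j : 0 < de -> ecl de M phi ->
  continuous (fun t : R => phi (upd x j t)).
Proof.
move=> de0 [f hf ef] t.
rewrite (_ : (fun t => _) = (fun t : R => FTk 0 f (toC x) j t%:C)).
  by apply: FTk_cont; [exact: de0|exact: hf|exact: toC_tube].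
by apply/funext => u; rewrite (FTk_toC _ _ _ _ ef) /osc !mul0r mulr0 cexp0 mulr1.
Qed.

Lemma ecl_line_bound de M phi x j (t : R) : 0 < de -> ecl de M phi ->
  nc (phi (upd x j t)) <= M * edecay de t.
Proof.
move=> de0 H; have M0 := ecl_M0 de0 H; move: H => [f [df fM] ef]; rewrite -ef.
apply: le_trans (fM _ (toC_tube _ de0)) _; rewrite /edecay ler_wpM2l// ler_expR lerN2.
rewrite ler_wpM2l ?(ltW de0)//; apply: le_trans (sumabs_j _ j).
by rewrite !mxE eqxx /=.
Qed.

Lemma FT_int (s de M : R) j phi x : 0 < de -> ecl de M phi ->
  cintable leb setT (fun t : mR => phi (upd x j t) * osc s t (x ord0 j)).
Proof.
move=> de0 h; apply: (@le_cintable _ _ _ leb setT _ (fun t => M * edecay de t)) => //.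
- apply: cmeasM => //; first by apply: cont_cmeas; exact: (ecl_line de0 h).
  apply: cmeas_cexp; apply: cmeasM => //; apply: cmeas_real.
  by apply: measurable_funM => //; exact: measurable_funM.
- by apply: RintZ => //; exact: integrable_edecay.
- by move=> t _; rewrite ncM nc_osc mulr1; exact: ecl_line_bound.
Qed.

Lemma FT_lin (s de M N : R) j (a : C) phi psi : 0 < de -> ecl de M phi -> ecl de N psi ->
  FT s j (fun x => a * phi x + psi x) = fun x => a * FT s j phi x + FT s j psi x.
Proof.
move=> de0 h1 h2; apply/funext => x.
have i1 := FT_int s j x de0 h1; have i2 := FT_int s j x de0 h2.
rewrite /FT -cintZ// -cintD//; last exact: cintableZ.
by apply: eq_cint => t _; rewrite mulrDl mulrA.
Qed.

(** [inversion1] on the line parallel to the axis [j] through [x]. *)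
Lemma FT_inv (s de M : R) j phi : 0 < de -> `|s| = 1 -> ecl de M phi ->
  FT (- s) j (FT s j phi) = fun x => (2 * Gam ^+ 2)%:C * phi x.
Proof.
move=> de0 s1 h; apply/funext => x.
have d2 : 0 < de / 2 by rewrite divr_gt0.
have h' := FT_ecl j de0 s1 h.
rewrite /FT (@inversion1 _ (fun t => phi (upd x j t)) (fun t => FT s j phi (upd x j t))
   M de (M * Kde de) (de / 2) s (x ord0 j) s1 de0 d2).
- congr (_ * phi _); apply/rowP => k; rewrite mxE; case: eqP => [->//|//].
- exact: (ecl_line de0 h).
- by move=> t; exact: (ecl_line_bound _ _ _ de0 h).
- exact: (ecl_line d2 h').
- by move=> t; exact: (ecl_line_bound _ _ _ d2 h').
- move=> xi; apply: eq_cint => t _; rewrite mxE eqxx /osc.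
  have -> : upd (upd x j xi) j t = upd x j t.
    by apply/rowP => k; rewrite !mxE; case: eqP.
  by congr (_ * cexp (_ * _%:C)); ring.
Qed.

Lemma FT_mulout (s de M : R) j (m : 'rV[R]_n -> C) phi : 0 < de -> ecl de M phi ->
  (forall x t, m (upd x j t) = m x) ->
  FT s j (fun x => m x * phi x) = (fun x => m x * FT s j phi x).
Proof.
move=> de0 h mu; apply/funext => x; have i1 := FT_int s j x de0 h.
by rewrite /FT -cintZ//; apply: eq_cint => t _; rewrite mu mulrA.
Qed.

Lemma upd_line (z : 'rV[C]_n) j k (t u : C) : k != j ->
  upd (z + u *: delta_mx ord0 k) j t = upd z j t + u *: delta_mx ord0 k.
Proof.
move=> kj; apply/rowP => l; rewrite !mxE eqxx /=.
case: (eqVneq l j) => [->|lj]; last by [].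
by rewrite (eq_sym j) (negbTE kj) mulr0 addr0.
Qed.

Lemma upd_linej (z : 'rV[C]_n) j (t u : C) :
  upd (z + u *: delta_mx ord0 j) j t = upd z j t.
Proof.
apply/rowP => l; rewrite !mxE eqxx /=.
by case: (eqVneq l j) => // lj; rewrite mulr0 addr0.
Qed.

Lemma line_cder0 f (z h : 'rV[C]_n) : differentiable f z ->
  differentiable (fun u : C => f (z + u *: h)) 0 /\
  'd f z h = cder (fun u : C => f (z + u *: h)) 0.
Proof.
move=> df; have E : z + 0 *: h = z by rewrite scale0r addr0.
have df' : differentiable f (z + 0 *: h) by rewrite E.
have [h1 h2] := line_cder df'; split; first exact: h1.
apply: esym; etransitivity; first exact: h2.
exact: (congr1 (fun w : 'rV[C]_n => 'd f w h) E).
Qed.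

Lemma ecl_diff de M phi : 0 < de -> ecl de M phi -> forall x, Cdifferentiable phi x.
Proof.
move=> de0 [f [df _] ef] x.
by have [] := diff_ext (df _ (toC_tube x de0)) ef.
Qed.

(** Derivatives in the other coordinates pass under the integral. *)
Lemma FT_partial (s de M : R) j k phi : 0 < de -> `|s| = 1 -> ecl de M phi -> k != j ->
  partial k (FT s j phi) = FT s j (partial k phi).
Proof.
move=> de0 s1 [f hf ef] kj; apply/funext => x.
have d2 : 0 < de / 2 by rewrite divr_gt0.
have xt : tube de (toC x) by exact: toC_tube.
have [dF E] := FText_diff de0 hf s1 j (toC_tube x d2).
have [_ ->] := diff_ext dF (FT_ext s j ef).
rewrite E; apply: eq_cint => t _.
have xut : tube de (toC (upd x j t)) by exact: toC_tube.
have [_ ->] := diff_ext (hf.1 _ xut) ef.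
have D := FTk_diffz s de0 hf j t xt.
etransitivity; first exact: (line_cder0 (delta_mx ord0 k) D).2.
rewrite (_ : (fun u : C => _) = (fun u : C => f (upd (toC x) j t%:C + u *: delta_mx ord0 k) *
    osc s t (x ord0 j))); last first.
  apply/funext => u; rewrite /FTk upd_line//; congr (_ * cexp _).
  rewrite !mxE eqxx /= (eq_sym j) (negbTE kj) mulr0 addr0.
  by rewrite !(rmorphM (real_complex R))/=; ring.
have [D3 E3] := line_cder0 (delta_mx ord0 k) (hf.1 _ xut).
rewrite -toC_upd; etransitivity; first exact: (cderMc _ D3).
by apply: (congr1 (fun w => w * osc s t (x ord0 j))); exact: esym E3.
Qed.

Lemma FT_partialj (s de M : R) j phi : 0 < de -> `|s| = 1 -> ecl de M phi ->
  partial j (FT s j phi) = FT s j (fun x => 'i%C * s%:C * (x ord0 j)%:C * phi x).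
Proof.
move=> de0 s1 [f hf ef]; apply/funext => x.
have d2 : 0 < de / 2 by rewrite divr_gt0.
have [dF E] := FText_diff de0 hf s1 j (toC_tube x d2).
have [_ ->] := diff_ext dF (FT_ext s j ef).
rewrite E; apply: eq_cint => t _.
have D := FTk_diffz s de0 hf j t (toC_tube x de0).
etransitivity; first exact: (line_cder0 (delta_mx ord0 j) D).2.
rewrite (_ : (fun u : C => _) = (fun u : C => phi (upd x j t) *
   cexp ('i%C * s%:C * t%:C * ((x ord0 j)%:C + u)))); last first.
  apply/funext => u; rewrite /FTk upd_linej -toC_upd ef; congr (_ * cexp _).
  by rewrite !mxE !eqxx /= mulr1.
rewrite (cder_cexp_lin _ _ _).2 mxE eqxx /osc.
have -> : 'i%C * s%:C * t%:C * (x ord0 j)%:C = 'i%C * (s * t * x ord0 j)%:C :> C.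
  by rewrite !(rmorphM (real_complex R))/=; ring.
by ring.
Qed.

End FT.
Section byparts.
Context {R : realType}.
Local Notation C := R[i].
Local Notation leb := (@lebesgue_measure R).
Local Notation mR := (measurableTypeR R).

Lemma cderM (f g : C -> C) (z : C) : differentiable f z -> differentiable g z ->
  cder (fun w => f w * g w) z = cder f z * g z + f z * cder g z.
Proof.
move=> df dg; apply: (choloI _).2 => e e0.
set f' := cder f z; set g' := cder g z.
pose K := nc (g z) + nc (f z) + nc f' + 1.
have K0 : 0 < K by rewrite ltr_wpDl// !addr_ge0.
pose e1 := Num.min 1 (e / (2 * K)).
have e10 : 0 < e1 by rewrite lt_min ltr01 divr_gt0// mulr_gt0.
have e11 : e1 <= 1 by rewrite ge_min lexx.
have e1e : 2 * K * e1 <= e by rewrite -ler_pdivlMl ?mulr_gt0// mulrC ge_min lexx orbT.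
clearbody e1.
have [d1 d10 H1] := choloE df e10; have [d2 d20 H2] := choloE dg e10.
have [d3 d30 H3] := choloE_cont dg e10.
exists (Num.min d1 (Num.min d2 d3)); first by rewrite !lt_min d10 d20.
move=> h; rewrite !lt_min => /and3P[/H1 h1 /H2 h2 /H3 h3].
rewrite -/f' in h1; rewrite -/g' in h2.
have -> : f (z + h) * g (z + h) - f z * g z - h * (f' * g z + f z * g') =
  (f (z + h) - f z - h * f') * g (z + h) + f z * (g (z + h) - g z - h * g') +
  h * f' * (g (z + h) - g z).
  by clear; move: f' g' (f _) (f _) (g _) (g _) => *; ring.
have gb : nc (g (z + h)) <= nc (g z) + 1.
  rewrite -[g (z + h)](subrK (g z)) addrC; apply: le_trans (ncD _ _) _.
  by rewrite lerD2l (le_trans h3).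
apply: le_trans (ncD _ _) _; apply: le_trans (lerD (ncD _ _) (lexx _)) _.
rewrite !ncM.
have t1 := ler_pM (nc_ge0 _) (nc_ge0 _) h1 gb.
have t2 := ler_wpM2l (nc_ge0 (f z)) h2.
have t3 : nc h * nc f' * nc (g (z + h) - g z) <= nc h * nc f' * e1.
  by rewrite ler_wpM2l// mulr_ge0.
apply: le_trans (lerD (lerD t1 t2) t3) _.
have -> : e1 * nc h * (nc (g z) + 1) + nc (f z) * (e1 * nc h) + nc h * nc f' * e1 = K * e1 * nc h.
  by rewrite /K; ring.
rewrite ler_wpM2r//; apply: le_trans e1e.
by rewrite ler_pM2r// ler_peMl// ?ler1n// ltW.
Qed.

Lemma edecay_shift (c a t r : R) : 0 <= c -> `|a| <= r -> edecay c (t + a) <= expR (c * r) * edecay c t.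
Proof.
move=> c0 ar; rewrite /edecay -expRD ler_expR.
have h : `|t| <= `|t + a| + `|a| by rewrite -{1}(addrK a t) ler_normB.
have : c * `|t| <= c * (`|t + a| + r) by rewrite ler_wpM2l// (le_trans h)// lerD2l.
by rewrite mulrDr; lra.
Qed.

(** Differentiating [line_shift] in the height: the integral of [ka] along the lines
    [Im w = y] is constant in [y]. *)
Lemma int_cder (ka : C -> C) (de M c : R) : 0 < c -> 0 < de ->
  (forall w, `|complex.Im w| < de -> differentiable ka w) ->
  (forall w, `|complex.Im w| < de -> nc (ka w) <= M * edecay c (complex.Re w)) ->
  cint leb setT (fun t : mR => cder ka t%:C) = 0.
Proof.
move=> c0 de0 dk bk.
have M0 : 0 <= M.
  have := bk 0; rewrite /= normr0 => /(_ de0) /(le_trans (nc_ge0 _)).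
  by rewrite pmulr_lge0// expR_gt0.
pose e : 'rV[C]_1 := delta_mx ord0 ord0.
pose g (z : 'rV[C]_1) (t : mR) := ka (t%:C + z ord0 ord0).
pose G (t : mR) := M * expR (c * de) * edecay c t.
have iG : leb.-integrable setT (EFin \o G) by apply: RintZ => //; exact: integrable_edecay.
have zIm (z : 'rV[C]_1) : rnorm (z - 0) < de -> `|complex.Im (z ord0 ord0)| < de.
  rewrite subr0 => h; apply: le_lt_trans h; apply: le_trans (nc_rnorm z ord0).
  exact: Im_le.
have zRe (z : 'rV[C]_1) : rnorm (z - 0) < de -> `|complex.Re (z ord0 ord0)| <= de.
  rewrite subr0 => h; apply: le_trans (ltW h); apply: le_trans (nc_rnorm z ord0).
  exact: Re_le.
have ImD (t : R) (w : C) : complex.Im (t%:C + w) = complex.Im w by rewrite raddfD/= add0r.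
have ReD (t : R) (w : C) : complex.Re (t%:C + w) = t + complex.Re w by rewrite raddfD.
have Hd t (z : 'rV[C]_1) : rnorm (z - 0) < de -> differentiable (g ^~ t) z.
  move=> /zIm h; apply: (@differentiable_comp _ _ _ _ (fun z : 'rV[C]_1 => t%:C + z ord0 ord0) ka).
    by apply: differentiableD; [exact: differentiable_cst|exact: differentiable_coord].
  by apply: dk; rewrite ImD.
have Hb t (z : 'rV[C]_1) : rnorm (z - 0) < de -> nc (g z t) <= G t.
  move=> h; apply: le_trans (bk _ _) _; first by rewrite ImD; exact: zIm.
  rewrite ReD /G -mulrA ler_wpM2l//; apply: edecay_shift; [exact: ltW|exact: zRe].
have Hm (z : 'rV[C]_1) : rnorm (z - 0) < de -> cmeas setT (g z).
  move=> h; apply: cont_cmeas => t.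
  apply: (@continuous_comp _ _ _ (fun t : R => t%:C + z ord0 ord0) ka).
    by apply: cvgD; [exact: RtoC_continuous|exact: cvg_cst].
  by apply: differentiable_continuous; apply: dk; rewrite ImD; exact: zIm.
have [dI EI] := param_diff de0 Hd Hb Hm iG.
set I := (fun z => _) in dI EI.
have [dk0 E0] := line_cder0 e dI.
have z0d : rnorm (0 - 0 : 'rV[C]_1) < de by rewrite subrr rnorm0.
have E1 : 'd I 0 e = cint leb setT (fun t : mR => cder ka t%:C).
  rewrite EI; apply: eq_cint => t _.
  etransitivity; first exact: (line_cder0 e (Hd t 0 z0d)).2.
  have D : differentiable ka (t%:C + 0) by apply: dk; rewrite addr0 /= normr0.
  have [_ Es] := cder_shift D; rewrite addr0 in Es; rewrite -Es.
  congr (cder _ 0); apply/funext => u; rewrite /g /e !mxE eqxx /=.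
  by rewrite mulr1 add0r.
rewrite -E1 E0; set k := (fun u => _) in dk0 *.
have kE (y : R) : `|y| < de -> k (0 +i* y) = k 0.
  move=> yd.
  have E (w : R) : k (0 +i* w) = cint leb setT (fun t : mR => ka (t +i* w)).
    apply: eq_cint => t _; rewrite /g /e !mxE eqxx /= mulr1 add0r.
    by congr ka; apply/eqP; rewrite eq_complex /= addr0 add0r !eqxx.
  have -> : k 0 = k (0 +i* 0) by [].
  rewrite !E; apply: (line_shift c0 dk bk) => //.
  by rewrite normr0.
apply/eqP; rewrite -nc_eq0 eq_le nc_ge0 andbT; apply/ler_addgt0Pr => ep ep0; rewrite add0r.
have [d d0 H] := choloE dk0 ep0.
pose y := Num.min d de / 2.
have m0 : 0 < Num.min d de by rewrite lt_min d0.
have y0 : 0 < y by rewrite divr_gt0.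
have ym : y < Num.min d de by rewrite ltr_pdivrMr// ltr_pMr// ltr1n.
have yd : y < d by apply: lt_le_trans ym _; rewrite ge_min lexx.
have yde : y < de by apply: lt_le_trans ym _; rewrite ge_min lexx orbT.
have ny : nc (0 +i* y : C) = y by rewrite nc_i expr0n add0r sqrtr_sqr gtr0_norm.
have := H (0 +i* y); rewrite ny add0r => /(_ yd).
rewrite kE ?gtr0_norm// subrr sub0r ncN ncM ny mulrC.
by rewrite ler_pM2r.
Qed.
End byparts.

Section FT_byparts.
Context {R : realType} {n : nat}.
Local Notation C := R[i].
Local Notation leb := (@lebesgue_measure R).
Local Notation mR := (measurableTypeR R).
Implicit Types (phi psi : 'rV[R]_n -> C) (f : 'rV[C]_n -> C) (x : 'rV[R]_n) (j k : 'I_n).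

Lemma FTk_cder (s de M : R) f phi x j (t : R) : 0 < de -> eclext de M f -> extends f phi ->
  cder (FTk s f (toC x) j) t%:C = partial j phi (upd x j t) * osc s t (x ord0 j) +
    ('i%C * s%:C * (x ord0 j)%:C) * (phi (upd x j t) * osc s t (x ord0 j)).
Proof.
move=> de0 hf ef.
have xut : tube de (toC (upd x j t)) by exact: toC_tube.
have [_ Ep] := diff_ext (hf.1 _ xut) ef.
have [D3 E3] := line_cder0 (delta_mx ord0 j) (hf.1 _ xut).
have D : differentiable (FTk s f (toC x) j) (t%:C + 0).
  by rewrite addr0; apply: FTk_diff; [exact: hf|exact: toC_tube|rewrite /= normr0].
have [_] := cder_shift D; rewrite addr0 => <-.
have -> : (fun w : C => FTk s f (toC x) j (t%:C + w)) =
   (fun u : C => f (toC (upd x j t) + u *: delta_mx ord0 j) *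
       (1 * cexp (('i%C * s%:C * (x ord0 j)%:C) * (t%:C + u)))).
  apply/funext => u; rewrite /FTk mul1r; congr (f _ * cexp _).
    rewrite toC_upd updE [in RHS]updE -addrA -scalerDl; congr (_ + _ *: _).
  by rewrite mxE; ring.
have [D4 E4] := cder_cexp_lin ('i%C * s%:C * (x ord0 j)%:C) t%:C 1.
etransitivity; first exact: (cderM D3 D4).
rewrite E4 Ep scale0r !addr0 ef !mul1r.
have -> : cexp ('i%C * s%:C * (x ord0 j)%:C * t%:C) = osc s t (x ord0 j).
  rewrite /osc; congr cexp; rewrite !(rmorphM (real_complex R))/=; ring.
rewrite [X in _ + X]mulrCA; congr (_ + _).
by apply: (congr1 (fun w => w * osc s t (x ord0 j))); exact: esym E3.
Qed.

(** The integral of the derivative of [FTk] in its integration variable is 0. *)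
Lemma FT_byparts (s de M de' M' : R) j phi : 0 < de -> `|s| = 1 -> ecl de M phi ->
  0 < de' -> ecl de' M' (partial j phi) ->
  FT s j (partial j phi) = fun x => - ('i%C * s%:C * (x ord0 j)%:C) * FT s j phi x.
Proof.
move=> de0 s1 h de'0 h'; apply/funext => x; have [f hf ef] := h.
have i1 := FT_int s j x de0 h; have i2 := FT_int s j x de'0 h'.
have Z : cint leb setT (fun t : mR => cder (FTk s f (toC x) j) t%:C) = 0.
  have X0 : complex.Im ((toC x) ord0 j) = 0 by rewrite mxE.
  have X1 : complex.Re ((toC x) ord0 j) = x ord0 j by rewrite mxE.
  apply: (@int_cder _ _ de (M * expR (de * `|x ord0 j|)) de) => //.
    by move=> w wd; apply: FTk_diff; [exact: hf|exact: toC_tube|].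
  move=> w wd; have := FTk_bound de0 hf s1 j (toC_tube x de0) wd.
  rewrite X0 X1 normr0 subr0 => hh; apply: le_trans hh _.
  rewrite ler_wpM2r ?expR_ge0// ler_wpM2l ?(ecl_M0 de0 h)// ler_expR.
  have h1 : 0 <= de * (sumabs (toC x) - `|x ord0 j|).
    by rewrite mulr_ge0 ?(ltW de0)// subr_ge0 -{1}X1 sumabs_j.
  have h3 : - (s * complex.Im w * x ord0 j) <= de * `|x ord0 j|.
    apply: le_trans (ler_norm _) _; rewrite !normrN !normrM s1 mul1r.
    by rewrite ler_wpM2r// ltW.
  lra.
have E : cint leb setT (fun t : mR => cder (FTk s f (toC x) j) t%:C) =
   FT s j (partial j phi) x + ('i%C * s%:C * (x ord0 j)%:C) * FT s j phi x.
  rewrite /FT -cintZ// -cintD//; last exact: cintableZ.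
  by apply: eq_cint => t _; exact: (FTk_cder s x j t de0 hf ef).
by rewrite E in Z; rewrite mulNr; apply/eqP; rewrite -addr_eq0; apply/eqP.
Qed.

End FT_byparts.

(** * Full Fourier transform and bounded operators *)
Section good.
Context {R : realType} {n : nat}.
Local Notation C := R[i].
Local Notation leb := (@lebesgue_measure R).
Local Notation mR := (measurableTypeR R).
Local Notation fn := ('rV[R]_n -> C).
Implicit Types (phi psi : fn) (x : 'rV[R]_n) (j k : 'I_n) (s : R) (l : seq 'I_n).

(** These are exactly the test functions, by [Pstar_good] and [good_Pstar]. *)
Definition good phi := exists de M : R, 0 < de /\ ecl de M phi.

(** Continuity of an operator in terms of the classes [ecl]: the new width depends only
    on the old one, and the bound depends linearly on the bound. Linearity of the
    bound is what later gives continuity for the inductive topology. *)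
Definition bop (A : fn -> fn) := forall de : R, 0 < de ->
  exists de' K : R, 0 < de' /\ forall M phi, ecl de M phi -> ecl de' (K * M) (A phi).

Lemma bop_good A phi : bop A -> good phi -> good (A phi).
Proof.
move=> bA [de [M [de0 h]]]; have [de' [K [de'0 H]]] := bA de de0.
by exists de', (K * M); split => //; exact: H.
Qed.

Lemma bop_comp A B : bop A -> bop B -> bop (A \o B).
Proof.
move=> bA bB de de0; have [de1 [K1 [de10 H1]]] := bB de de0.
have [de2 [K2 [de20 H2]]] := bA de1 de10.
by exists de2, (K2 * K1); split => // M phi /H1/H2; rewrite mulrA.
Qed.

Lemma good2 phi psi : good phi -> good psi ->
  exists de M N : R, [/\ 0 < de, ecl de M phi & ecl de N psi].
Proof.
move=> [d [M [d0 h]]] [d' [N [d'0 h']]]; exists (Num.min d d'), M, N.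
have m0 : 0 < Num.min d d' by rewrite lt_min d0.
by split=> //; [apply: eclW h|apply: eclW h']; rewrite m0 ge_min lexx ?orbT.
Qed.

Lemma good_lin (a : C) phi psi : good phi -> good psi -> good (fun x => a * phi x + psi x).
Proof.
move=> h1 h2; have [de [M [N [de0 h h']]]] := good2 h1 h2.
by exists de, (nc a * M + N); split => //; exact: ecl_lin.
Qed.

Lemma ecl0 (de : R) : ecl de 0 ((fun=> 0) : fn).
Proof.
exists (fun=> 0) => //; split=> z _; first exact: differentiable_cst.
by rewrite nc0 mul0r.
Qed.

Lemma good0 : good (fun=> 0).
Proof. by exists 1, 0; split => //; exact: ecl0. Qed.

Lemma goodZ (a : C) phi : good phi -> good (fun x => a * phi x).
Proof.
move=> h; have := good_lin a h good0; congr good.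
by apply/funext => x; rewrite addr0.
Qed.

Lemma bop_lin (a : C) A B : bop A -> bop B -> bop (fun phi x => a * A phi x + B phi x).
Proof.
move=> bA bB de de0; have [d1 [K1 [d10 H1]]] := bA de de0.
have [d2 [K2 [d20 H2]]] := bB de de0.
have m0 : 0 < Num.min d1 d2 by rewrite lt_min d10.
exists (Num.min d1 d2), (nc a * K1 + K2); split => // M phi h.
rewrite mulrDl -mulrA; apply: ecl_lin.
  by apply: eclW (H1 _ _ h); rewrite m0 ge_min lexx.
by apply: eclW (H2 _ _ h); rewrite m0 ge_min lexx orbT.
Qed.

Lemma bop_scale (a : C) : bop (fun phi x => a * phi x).
Proof.
move=> de de0; exists de, (nc a); split => // M phi h.
have := ecl_lin a h (ecl0 de); rewrite addr0; congr (ecl _ _).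
by apply/funext => x; rewrite addr0.
Qed.

Lemma bop_FT s j : `|s| = 1 -> bop (FT s j).
Proof.
move=> s1 de de0; exists (de / 2), (Kde de); split; first by rewrite divr_gt0.
by move=> M phi h; rewrite [Kde de * M]mulrC; exact: FT_ecl.
Qed.

Lemma bop_xmul k : bop (fun phi x => (x ord0 k)%:C * phi x).
Proof.
move=> de de0; exists (de / 2), (2 / de + de); split; first by rewrite divr_gt0.
by move=> M phi h; exact: ecl_xmul.
Qed.

Lemma good_FT_lin s j (a : C) phi psi : good phi -> good psi ->
  FT s j (fun x => a * phi x + psi x) = fun x => a * FT s j phi x + FT s j psi x.
Proof.
by move=> h1 h2; have [de [M [N [de0 h h']]]] := good2 h1 h2; exact: FT_lin h h'.
Qed.

Lemma FT0 s j : FT s j ((fun=> 0) : fn) = fun=> 0.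
Proof.
apply/funext => x; rewrite /FT.
rewrite -[RHS](mul0r (cint leb setT (fun=> 0 : C))) -cintZ//.
  by apply: eq_cint => t _; rewrite !mul0r.
by split; exact: integrable0.
Qed.

Lemma good_FTZ s j (a : C) phi : good phi ->
  FT s j (fun x => a * phi x) = fun x => a * FT s j phi x.
Proof.
move=> h; have := good_FT_lin s j a h good0; rewrite FT0 => E.
rewrite (_ : (fun x => a * phi x) = fun x => a * phi x + 0); last first.
  by apply/funext => x; rewrite addr0.
by rewrite E; apply/funext => x; rewrite addr0.
Qed.

Definition FTs s l phi := foldr (FT s) phi l.

Lemma FTs_rcons s l j phi : FTs s (rcons l j) phi = FTs s l (FT s j phi).
Proof. by rewrite /FTs -cats1 foldr_cat. Qed.

Lemma bop_FTs s l : `|s| = 1 -> bop (FTs s l).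
Proof.
move=> s1; elim: l => [|j l IH]; last exact: (bop_comp (bop_FT j s1) IH).
by move=> de de0; exists de, 1; split => // M phi; rewrite mul1r.
Qed.

Lemma good_FTs s l phi : `|s| = 1 -> good phi -> good (FTs s l phi).
Proof. by move=> s1; apply: bop_good; exact: bop_FTs. Qed.

Lemma FTs_lin s l (a : C) phi psi : `|s| = 1 -> good phi -> good psi ->
  FTs s l (fun x => a * phi x + psi x) = fun x => a * FTs s l phi x + FTs s l psi x.
Proof.
move=> s1 h1 h2; elim: l => [//|j l IH]/=; rewrite IH.
by apply: good_FT_lin; exact: good_FTs.
Qed.

Lemma FTsZ s l (a : C) phi : `|s| = 1 -> good phi ->
  FTs s l (fun x => a * phi x) = fun x => a * FTs s l phi x.
Proof.
move=> s1 h; elim: l => [//|j l IH]/=; rewrite IH.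
by apply: good_FTZ; exact: good_FTs.
Qed.

Definition kap : C := (2 * Gam ^+ 2)%:C.

Lemma kap_neq0 : kap != 0.
Proof.
by rewrite -nc_eq0 nc_real normr_eq0 mulf_eq0 pnatr_eq0/= sqrf_eq0 gt_eqF// Gam_gt0.
Qed.

Lemma FTs_inv s l phi : `|s| = 1 -> good phi ->
  FTs (- s) (rev l) (FTs s l phi) = fun x => kap ^+ size l * phi x.
Proof.
move=> s1 h; elim: l => [|j l IH].
  by apply/funext => x; rewrite /= expr0 mul1r.
have Ns1 : `|- s| = 1 by rewrite normrN.
rewrite rev_cons FTs_rcons /=.
have [de [M [de0 hu]]] := good_FTs l s1 h.
rewrite (FT_inv j de0 s1 hu) FTsZ//; last exact: good_FTs.
apply/funext => x; transitivity (kap * (kap ^+ size l * phi x)).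
  by apply: (congr1 (fun w => kap * w)); exact: (congr1 (@^~ x) IH).
by rewrite mulrA -exprS.
Qed.

Lemma FTs_comm s l j (A : fn -> fn) phi : `|s| = 1 -> j \notin l ->
  (forall k phi, k != j -> good phi -> FT s k (A phi) = A (FT s k phi)) ->
  good phi -> FTs s l (A phi) = A (FTs s l phi).
Proof.
move=> s1 + HA h; elim: l => [//|k l IH]; rewrite inE negb_or => /andP[jk jl] /=.
by rewrite IH// HA// 1?eq_sym//; exact: good_FTs.
Qed.

(** Reduces an intertwining relation for the whole transform to the one coordinate
    that it concerns. *)
Lemma FTs_inter s l j (A B : fn -> fn) phi : `|s| = 1 -> uniq l -> j \in l ->
  (forall k phi, k != j -> good phi -> FT s k (A phi) = A (FT s k phi)) ->
  (forall phi, good phi -> FT s j (A phi) = B (FT s j phi)) ->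
  (forall k phi, k != j -> good phi -> FT s k (B phi) = B (FT s k phi)) ->
  good phi -> FTs s l (A phi) = B (FTs s l phi).
Proof.
move=> s1 + + HA HAB HB h; elim: l => [//|k l IH] /= /andP[kl ul]; rewrite inE.
have [jk _|jk /= jl] := eqVneq j k.
  rewrite -jk in kl *.
  rewrite /= -/(FTs s l (A phi)) (FTs_comm (j := j) s1 kl HA h).
  by apply: HAB; exact: good_FTs.
by rewrite IH// HB// 1?eq_sym//; exact: good_FTs.
Qed.

End good.

(** * Fourier transform and differential operators *)
Section calculus.
Context {R : realType} {n : nat}.
Local Notation C := R[i].
Local Notation leb := (@lebesgue_measure R).
Local Notation mR := (measurableTypeR R).
Local Notation fn := ('rV[R]_n -> C).
Implicit Types (phi psi : fn) (x t : 'rV[R]_n) (j k : 'I_n) (s : R) (l : seq 'I_n).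

Lemma good_xmul (a : C) k phi : good phi -> good (fun x => a * (x ord0 k)%:C * phi x).
Proof.
move=> h; have := goodZ a (bop_good (bop_xmul k) h); congr good.
by apply/funext => x; rewrite mulrA.
Qed.

Lemma FT_xmul s j k (a : C) phi : k != j -> good phi ->
  FT s k (fun x => a * (x ord0 j)%:C * phi x) = fun x => a * (x ord0 j)%:C * FT s k phi x.
Proof.
move=> kj [de [M [de0 h]]].
have H := @FT_mulout R n s de M k (fun x : 'rV[R]_n => a * (x ord0 j)%:C) phi de0 h.
by apply: H => x u; rewrite mxE eq_sym (negbTE kj).
Qed.

Lemma FTs_partial s l j phi : `|s| = 1 -> uniq l -> j \in l -> good phi ->
  FTs s l (fun x => 'i%C * s%:C * (x ord0 j)%:C * phi x) = partial j (FTs s l phi).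
Proof.
move=> s1 ul jl h.
pose A (f : fn) x : C := 'i%C * s%:C * (x ord0 j)%:C * f x.
apply: (FTs_inter (A := A) s1 ul jl _ _ _ h).
- by move=> k psi kj hp; exact: FT_xmul.
- by move=> psi [de [M [de0 hp]]]; exact: esym (FT_partialj j de0 s1 hp).
- move=> k psi kj [de [M [de0 hp]]]; apply: esym.
  by apply: (FT_partial de0 s1 hp); rewrite eq_sym.
Qed.

Local Notation l0 := (enum 'I_n).

Lemma l0_uniq : uniq l0. Proof. exact: enum_uniq. Qed.
Lemma l0_in j : j \in l0. Proof. exact: mem_enum. Qed.
Lemma rl0_uniq : uniq (rev l0). Proof. by rewrite rev_uniq l0_uniq. Qed.
Lemma rl0_in j : j \in rev l0. Proof. by rewrite mem_rev l0_in. Qed.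

Lemma one1 : `|1 : R| = 1. Proof. exact: normr1. Qed.
Lemma n11 : `|- 1 : R| = 1. Proof. by rewrite normrN normr1. Qed.

Definition Fou phi := FTs 1 l0 phi.
(** The constant normalizes the composition with [Fou] to the identity; the coordinates
    are inverted in the reverse order. *)
Definition Fin phi := FTs (- 1) (rev l0) (fun x => (kap : C) ^- size l0 * phi x).

Lemma good_Fou phi : good phi -> good (Fou phi).
Proof. by apply: good_FTs; exact: one1. Qed.

Lemma Fin_Fou phi : good phi -> Fin (Fou phi) = phi.
Proof.
move=> h; rewrite /Fin FTsZ; [|exact: n11|exact: good_Fou].
apply/funext => x; rewrite /Fou (FTs_inv l0 one1 h).
by rewrite mulrA mulVf ?mul1r// expf_neq0// kap_neq0.
Qed.

Lemma Fou_Fin phi : good phi -> Fou (Fin phi) = phi.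
Proof.
move=> h; rewrite /Fin FTsZ; [|exact: n11|exact: h].
rewrite /Fou FTsZ; [|exact: one1|by apply: good_FTs; [exact: n11|exact: h]].
have := FTs_inv (rev l0) n11 h; rewrite opprK revK size_rev => ->.
by apply/funext => x; rewrite mulrA mulVf ?mul1r// expf_neq0// kap_neq0.
Qed.

Lemma Fou_inj phi psi : good phi -> good psi -> Fou phi = Fou psi -> phi = psi.
Proof. by move=> h1 h2 E; rewrite -(Fin_Fou h1) E Fin_Fou. Qed.

(** Writing [phi] as an inverse transform, its derivative is the inverse transform
    of a function multiplied by a coordinate. *)
Lemma good_partial j phi : good phi -> good (partial j phi).
Proof.
move=> h; rewrite -(Fin_Fou h) /Fin.
rewrite -(FTs_partial n11 rl0_uniq (rl0_in j) (goodZ _ (good_Fou h))).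
by apply: good_FTs; [exact: n11|]; apply: good_xmul; apply: goodZ; exact: good_Fou.
Qed.

(** Every iterated derivative is again good, hence differentiable. *)
Lemma good_smooth phi : good phi -> smooth phi.
Proof.
move=> h s x; have [de [M [de0 hs]]] : good (foldr partial phi s).
  by elim: s => [//|j s IH]; exact: good_partial.
exact: ecl_diff de0 hs x.
Qed.

Lemma Fou_partial j phi : good phi ->
  Fou (partial j phi) = fun x => - 'i%C * (x ord0 j)%:C * Fou phi x.
Proof.
move=> h; pose B (f : fn) x : C := - 'i%C * (x ord0 j)%:C * f x.
apply: (FTs_inter (B := B) one1 l0_uniq (l0_in j) _ _ _ h).
- move=> k psi kj [de [M [de0 hp]]]; apply: esym.
  by apply: (FT_partial de0 one1 hp); rewrite eq_sym.
- move=> psi hp; have [de' [M' [de'0 hp']]] := good_partial j hp.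
  have [de [M [de0 hq]]] := hp.
  etransitivity; first exact: (FT_byparts de0 one1 hq de'0 hp').
  by apply/funext => x; rewrite /B (_ : 1%:C = 1 :> C)// mulr1 !mulNr.
- by move=> k psi kj hp; exact: FT_xmul.
Qed.

Lemma good_Dmonom (m : multinom n) phi : good phi -> good (Dmonom m phi).
Proof.
rewrite /Dmonom => h; elim: l0 => [//|j l IH] /=.
by elim: (m j) => [//|k IHk] /=; exact: good_partial.
Qed.

Lemma Fou_Dmonom (m : multinom n) phi : good phi ->
  Fou (Dmonom m phi) = fun x => (\prod_j (- 'i%C * (x ord0 j)%:C) ^+ m j) * Fou phi x.
Proof.
move=> h; have Hit j (k : nat) f : good f ->
    good (iter k (partial j) f) /\
    Fou (iter k (partial j) f) = fun x => (- 'i%C * (x ord0 j)%:C) ^+ k * Fou f x.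
  move=> hf; elim: k => [|k [IH1 IH2]].
    by split=> //; apply/funext => x; rewrite expr0 mul1r.
  split; first exact: good_partial.
  by rewrite /= Fou_partial// IH2; apply/funext => x; rewrite exprS mulrA.
suff H l : good (foldr (fun j => iter (m j) (partial j)) phi l) /\
    Fou (foldr (fun j => iter (m j) (partial j)) phi l) =
    fun x => (\prod_(j <- l) (- 'i%C * (x ord0 j)%:C) ^+ m j) * Fou phi x.
  by have [_ ->] := H l0; apply/funext => x; rewrite big_enum.
elim: l => [|j l [IH1 IH2]].
  by split=> //; apply/funext => x; rewrite big_nil mul1r.
have [h1 h2] := Hit j (m j) _ IH1; split; first exact: h1.
by rewrite /= h2 IH2; apply/funext => x; rewrite big_cons mulrA.
Qed.

Lemma good_sum (I : Type) (r : seq I) (a : I -> C) (f : I -> fn) :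
  (forall i, good (f i)) -> good (fun x => \sum_(i <- r) a i * f i x).
Proof.
move=> h; elim: r => [|i r IH].
  by have := @good0 R n; congr good; apply/funext => x; rewrite big_nil.
have := good_lin (a i) (h i) IH; congr good.
by apply/funext => x; rewrite big_cons.
Qed.

Lemma Fou_lin (a : C) phi psi : good phi -> good psi ->
  Fou (fun x => a * phi x + psi x) = fun x => a * Fou phi x + Fou psi x.
Proof. by move=> h1 h2; exact: (FTs_lin l0 a one1 h1 h2). Qed.

Lemma Fou0 : Fou (fun=> 0) = fun=> 0.
Proof.
have := FTsZ l0 0 one1 (@good0 R n); rewrite -/(Fou _).
rewrite (_ : (fun x => 0 * _) = (fun=> 0)); last by apply/funext => x; rewrite mul0r.
by move=> ->; apply/funext => x; rewrite mul0r.
Qed.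

Lemma Fou_sum (I : Type) (r : seq I) (a : I -> C) (f : I -> fn) :
  (forall i, good (f i)) ->
  Fou (fun x => \sum_(i <- r) a i * f i x) = fun x => \sum_(i <- r) a i * Fou (f i) x.
Proof.
move=> h; elim: r => [|i r IH].
  rewrite (_ : (fun x => _) = (fun=> 0)); last by apply/funext => x; rewrite big_nil.
  by rewrite Fou0; apply/funext => x; rewrite big_nil.
rewrite (_ : (fun x => _) = (fun x => a i * f i x + \sum_(j <- r) a j * f j x)).
  by rewrite Fou_lin// ?IH//; [apply/funext => x; rewrite big_cons|exact: good_sum].
by apply/funext => x; rewrite big_cons.
Qed.

Lemma good_Dadjoint (p : mpoly n R) phi : good phi -> good (Dadjoint p phi).
Proof. by move=> h; apply: good_sum => m; exact: good_Dmonom. Qed.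

(** [D_j] becomes [- i xi_j], so the signs of the formal adjoint turn each monomial
    into one in [i xi]. *)
Lemma Fou_Dadjoint (p : mpoly n R) phi : good phi ->
  Fou (Dadjoint p phi) = fun x => mpoly_at_i p (toC x) * Fou phi x.
Proof.
move=> h; rewrite /Dadjoint Fou_sum; last by move=> m; exact: good_Dmonom.
apply/funext => x; rewrite /mpoly_at_i /mmap big_distrl /=.
apply: eq_bigr => m _; rewrite (Fou_Dmonom m h) mulrA; congr (_ * _).
rewrite -mulrA; congr (_ * _); rewrite /mmap1 mdegE -prodrXr -big_split /=.
by apply: eq_bigr => j _; rewrite -exprMn mxE -complexiE; congr (_ ^+ _); ring.
Qed.

End calculus.

(** * Translations and Fourier multipliers *)
Section multiplier.
Context {R : realType} {n : nat}.
Local Notation C := R[i].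
Local Notation leb := (@lebesgue_measure R).
Local Notation mR := (measurableTypeR R).
Local Notation fn := ('rV[R]_n -> C).
Local Notation l0 := (enum 'I_n).
Implicit Types (phi psi : fn) (x t : 'rV[R]_n) (j k : 'I_n) (s : R) (l : seq 'I_n).

Lemma good_shiftf t phi : good phi -> good (shiftf t phi).
Proof.
move=> [de [M [de0 h]]]; have M0 := ecl_M0 de0 h; move: h => [f [df bf] ef].
have tb z : tube de z -> tube de (z - toC t).
  by move=> zd k; rewrite !mxE /=; have := zd k; case: (z _ _) => a b /=; rewrite subr0.
exists de, (M * expR (de * sumabs (toC t))); split => //.
exists (fun z => f (z - toC t)); last exact: shift_extends.
split=> z /tb zd.
  apply: (@differentiable_comp _ _ _ _ (fun z => z - toC t) f); last exact: df.
  by apply: differentiableB => //; exact: differentiable_cst.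
apply: le_trans (bf _ zd) _; rewrite -mulrA ler_wpM2l// -expRD ler_expR.
rewrite -mulrBr -mulrN ler_wpM2l ?(ltW de0)// lerNl opprB /sumabs -sumrB.
apply: ler_sum => k _; rewrite !mxE /=.
have := ler_normB (complex.Re (z ord0 k) - t ord0 k) (- t ord0 k).
by rewrite opprK subrK normrN; case: (z _ _) => a b /=; rewrite lerBlDr.
Qed.

(** Translation of the integration variable. *)
Lemma FT_shift1 s j (c : R) phi : good phi ->
  FT s j (shiftf (c *: delta_mx ord0 j) phi) = fun x => osc s c (x ord0 j) * FT s j phi x.
Proof.
move=> [de [M [de0 h]]]; apply/funext => x.
have i1 := FT_int s j x de0 h.
have i2 : cintable leb setT
    (fun t : mR => phi (upd x j (t - c)) * osc s t (x ord0 j)).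
  have [de' [M' [de'0 h']]] := good_shiftf (c *: delta_mx ord0 j) (ex_intro _ de (ex_intro _ M (conj de0 h))).
  have := FT_int s j x de'0 h'; apply: eq_cintable => // t _; rewrite /shiftf; congr (phi _ * _).
  by apply/rowP => k; rewrite !mxE eqxx /=; case: eqP => _; rewrite ?mulr1// mulr0 subr0.
rewrite [LHS]/FT (_ : cint _ _ _ = cint leb setT
    (fun t : mR => phi (upd x j (t - c)) * osc s t (x ord0 j))); last first.
  apply: eq_cint => t _; rewrite /shiftf; congr (phi _ * _).
  by apply/rowP => k; rewrite !mxE eqxx /=; case: eqP => _; rewrite ?mulr1// mulr0 subr0.
have [_ ->] := @cint_affine R 1 c (oner_neq0 R) _ i2.
rewrite normr1 (_ : 1%:C = 1 :> C)// mul1r -cintZ//.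
apply: eq_cint => t _; rewrite /= /aff mul1r addrK [RHS]mulrCA /osc -cexpD.
congr (_ * cexp _); rewrite -mulrDr -(rmorphD (real_complex R)) /=; congr ('i%C * _%:C); ring.
Qed.

Lemma Fou_shift1 j (c : R) phi : good phi ->
  Fou (shiftf (c *: delta_mx ord0 j) phi) = fun x => osc 1 c (x ord0 j) * Fou phi x.
Proof.
move=> h; have U x k u : k != j ->
    upd x k u - c *: delta_mx ord0 j = upd (x - c *: delta_mx ord0 j) k u.
  move=> kj; apply/rowP => i; rewrite !mxE eqxx /=; case: (eqVneq i k) => // ->.
  by rewrite (negbTE kj) mulr0 subr0.
have V x k : k != j -> (x - c *: delta_mx ord0 j) ord0 k = x ord0 k.
  by move=> kj; rewrite !mxE eqxx (negbTE kj) mulr0 subr0.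
pose B (f : fn) x : C := osc 1 c (x ord0 j) * f x.
apply: (FTs_inter (B := B) one1 (l0_uniq (n := n)) (l0_in j) _ _ _ h).
- move=> k psi kj _; apply/funext => x; rewrite /FT /shiftf.
  by apply: eq_cint => t _; rewrite U// V.
- by move=> psi; exact: FT_shift1.
- move=> k psi kj [de [M [de0 hp]]].
  have H := @FT_mulout R n 1 de M k (fun x : 'rV[R]_n => osc 1 c (x ord0 j)) psi de0 hp.
  by apply: H => x u; rewrite mxE eq_sym (negbTE kj).
Qed.

(** The multiplier [e] is [exp(i t . xi)], built one coordinate at a time. *)
Lemma Fou_shift t : exists e : fn, forall phi, good phi ->
  Fou (shiftf t phi) = fun x => e x * Fou phi x.
Proof.
have -> : t = \sum_(j <- l0) t ord0 j *: delta_mx ord0 j.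
  by rewrite big_enum /=; exact: row_sum_delta.
elim: l0 => [|j l [e IH]].
  exists (fun=> 1) => phi _; rewrite big_nil (_ : shiftf 0 phi = phi).
    by apply/funext => x; rewrite mul1r.
  by apply/funext => x; rewrite /shiftf subr0.
exists (fun x => osc 1 (t ord0 j) (x ord0 j) * e x) => phi h; rewrite big_cons.
set u := (X in _ + X); rewrite (_ : shiftf _ _ =
    shiftf (t ord0 j *: delta_mx ord0 j) (shiftf u phi)).
  rewrite Fou_shift1; last exact: good_shiftf.
  by rewrite IH//; apply/funext => x; rewrite mulrA.
by apply/funext => x; rewrite /shiftf opprD addrA.
Qed.

(** Growth slower than every exponential on one fixed tube, so that multiplication
    preserves every class [ecl] up to a smaller width. *)
Definition tempered (m : 'rV[C]_n -> C) := exists2 eta : R, 0 < eta &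
  (forall z, tube eta z -> differentiable m z) /\
  forall de : R, 0 < de -> exists K : R, forall z, tube eta z ->
    nc (m z) <= K * expR (de * sumabs z).

Lemma bop_mul m : tempered m -> bop (fun phi x => m (toC x) * phi x).
Proof.
move=> [eta eta0 [dm bm]] de de0.
have m0 : 0 < Num.min eta de by rewrite lt_min eta0.
have m2 : 0 < Num.min eta de / 2 by rewrite divr_gt0.
have [K hK] := bm _ m2.
exists (Num.min eta de / 2), K; split => // M phi h.
apply: ecl_mul => //.
- by move=> z zd; apply: dm; apply: tubeW zd; rewrite ge_min lexx.
- by move=> z zd; apply: hK; apply: tubeW zd; rewrite ge_min lexx.
- by apply: eclW h; rewrite m0 ge_min lexx orbT.
Qed.

Definition mult (m : 'rV[C]_n -> C) phi := Fin (fun x => m (toC x) * Fou phi x).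

Section m.
Variable m : 'rV[C]_n -> C.
Hypothesis tm : tempered m.

Lemma bop_mult : bop (mult m).
Proof.
have h := bop_comp (bop_FTs (rev l0) n11) (bop_comp (bop_scale ((kap : C) ^- size l0))
  (bop_comp (bop_mul tm) (bop_FTs l0 one1))).
exact: h.
Qed.

Lemma good_mulF phi : good phi -> good (fun x => m (toC x) * Fou phi x).
Proof. by move=> h; exact: (bop_good (bop_mul tm) (good_Fou h)). Qed.

Lemma good_mult phi : good phi -> good (mult m phi).
Proof. exact: bop_good bop_mult. Qed.

Lemma Fou_mult phi : good phi -> Fou (mult m phi) = fun x => m (toC x) * Fou phi x.
Proof. by move=> h; rewrite Fou_Fin//; exact: good_mulF. Qed.

Lemma mult_lin (a : C) phi psi : good phi -> good psi ->
  mult m (fun x => a * phi x + psi x) = fun x => a * mult m phi x + mult m psi x.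
Proof.
move=> h1 h2; apply: Fou_inj; first by apply: good_mult; exact: good_lin.
  by apply: good_lin; exact: good_mult.
rewrite Fou_mult; last exact: good_lin.
rewrite (Fou_lin a h1 h2) (Fou_lin a (good_mult h1) (good_mult h2)) !Fou_mult//.
by apply/funext => x; ring.
Qed.

(** Both sides have the same Fourier transform, multipliers being commutative. *)
Lemma mult_shift t phi : good phi -> mult m (shiftf t phi) = shiftf t (mult m phi).
Proof.
move=> h; have [e He] := Fou_shift t.
apply: Fou_inj; [apply: good_mult; exact: good_shiftf|apply: good_shiftf; exact: good_mult|].
rewrite Fou_mult; last exact: good_shiftf.
rewrite !He//; last exact: good_mult.
by rewrite Fou_mult//; apply/funext => x; ring.
Qed.

Lemma mult_Dadjoint (p q : mpoly n R) phi :
  (forall x, m (toC x) * mpoly_at_i p (toC x) = mpoly_at_i q (toC x)) -> good phi ->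
  mult m (Dadjoint p phi) = Dadjoint q phi.
Proof.
move=> E h; apply: Fou_inj; [by apply: good_mult; exact: good_Dadjoint|exact: good_Dadjoint|].
rewrite Fou_mult; last exact: good_Dadjoint.
by rewrite !Fou_Dadjoint//; apply/funext => x; rewrite mulrA E.
Qed.

(** Surjectivity of [p(-D)] when [1/p] is a multiplier; uniqueness rests on it. *)
Lemma Dadjoint_mult (p : mpoly n R) phi :
  (forall x, m (toC x) * mpoly_at_i p (toC x) = 1) -> good phi ->
  Dadjoint p (mult m phi) = phi.
Proof.
move=> E h; apply: Fou_inj => //; first by apply: good_Dadjoint; exact: good_mult.
rewrite Fou_Dadjoint ?Fou_mult//; last exact: good_mult.
by apply/funext => x; rewrite mulrCA mulrA E mul1r.
Qed.
End m.

End multiplier.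

(** * Test functions and continuous operators on them *)
Section steps.
Context {R : realType} {n : nat}.
Local Notation C := R[i].
Local Notation fn := ('rV[R]_n -> C).
Implicit Types (phi psi : fn) (x t : 'rV[R]_n) (z : 'rV[C]_n) (j k : 'I_n).

Lemma l2_le_sum (a : 'I_n -> R) : (forall k, 0 <= a k) ->
  Num.sqrt (\sum_k a k ^+ 2) <= \sum_k a k.
Proof.
move=> a0; have s0 : 0 <= \sum_k a k by exact: sumr_ge0.
rewrite -(ger0_norm s0) -sqrtr_sqr; apply: ler_wsqrtr.
have H (l : seq 'I_n) : \sum_(k <- l) a k ^+ 2 <= (\sum_(k <- l) a k) ^+ 2.
  elim: l => [|k l IH]; first by rewrite !big_nil expr0n.
  rewrite !big_cons sqrrD -addrA lerD2l (le_trans IH)// lerDr mulrn_wge0//.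
  by rewrite mulr_ge0//; exact: sumr_ge0.
exact: H.
Qed.

Lemma le_l2 (a : 'I_n -> R) k : `|a k| <= Num.sqrt (\sum_k a k ^+ 2).
Proof.
rewrite -sqrtr_sqr; apply: ler_wsqrtr; rewrite (bigD1 k)//= lerDl.
by apply: sumr_ge0 => i _; exact: sqr_ge0.
Qed.

Lemma strip_tube (de : R) z : strip de z -> tube de z.
Proof. by move=> zd k; apply: le_lt_trans zd; exact: (le_l2 (fun k => complex.Im (z ord0 k))). Qed.

(** The factor [n + 1] compensates the comparison of the Euclidean norms with the
    sums and maxima of coordinates used by [tube] and [sumabs]. *)
Definition shrink (d : R) : R := d / (2 * n.+1%:R).

Lemma shrink_gt0 d : 0 < d -> 0 < shrink d.
Proof. by move=> d0; rewrite divr_gt0// mulr_gt0. Qed.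

Lemma shrink_n d : 0 < d -> shrink d *+ n < d / 2.
Proof.
move=> d0; apply: lt_le_trans (_ : shrink d *+ n.+1 <= _).
  by rewrite -subr_gt0 -mulrnBr// subSnn shrink_gt0.
rewrite -[leLHS]mulr_natr /shrink invfM mulrA mulfVK// pnatr_eq0.
Qed.

Lemma tube_strip d z : 0 < d -> tube (shrink d) z -> strip (d / 2) z.
Proof.
move=> d0 zd; apply: le_lt_trans (shrink_n d0); rewrite /im_norm.
under eq_bigr do rewrite -real_normK ?num_real//.
apply: (le_trans (l2_le_sum _)) => //.
apply: le_trans (_ : \sum_(k < n) shrink d <= _).
  by apply: ler_sum => k _; exact: ltW.
by rewrite sumr_const card_ord.
Qed.

Lemma cnorm_sumabs z (de : R) : tube de z -> cnorm z <= sumabs z + de *+ n.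
Proof.
move=> zd; apply: (le_trans (l2_le_sum _)); first by move=> k; exact: nc_ge0.
rewrite -[X in _ *+ X](card_ord n) -sumr_const -big_split /=.
apply: ler_sum => k _; apply: le_trans (nc_le _) _.
by rewrite lerD2l ltW.
Qed.

Lemma sumabs_cnorm z : sumabs z <= cnorm z *+ n.
Proof.
rewrite -[X in _ *+ X](card_ord n) -sumr_const; apply: ler_sum => k _.
apply: le_trans (le_l2 (fun k => nc (z ord0 k)) k).
by rewrite (ger0_norm (nc_ge0 _)); exact: Re_le.
Qed.

(** The constant [c] passes unchanged; continuity of [lift] relies on this. *)
Lemma step_ecl d c (f : 'rV[C]_n -> C) : 0 < d -> in_step d f ->
  (forall z, strip (d / 2) z -> expR ((d - d / 2) * cnorm z) * nc (f z) <= c) ->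
  eclext (shrink d) c f.
Proof.
move=> d0 [hf _] bf; split=> z /(tube_strip d0) zd.
  by apply: hf; apply: lt_le_trans zd _; rewrite ler_pdivrMr// ler_pMr// ler1n.
have := bf z zd; rewrite (_ : d - d / 2 = d / 2); last by field.
rewrite -ler_pdivlMl ?expR_gt0// -expRN mulrC => h; apply: le_trans h _.
have c0 : 0 <= c.
  by apply: le_trans (bf z zd); apply: mulr_ge0; [exact: expR_ge0|exact: nc_ge0].
rewrite ler_wpM2l// ler_expR lerN2.
apply: le_trans (_ : shrink d * (cnorm z *+ n) <= _).
  by rewrite ler_wpM2l ?(ltW (shrink_gt0 d0))//; exact: sumabs_cnorm.
rewrite mulrnAr -mulrnAl ler_wpM2r ?(ltW (shrink_n d0))//.
exact: sqrtr_ge0.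
Qed.

Lemma ecl_step de M (g : 'rV[C]_n -> C) : 0 < de -> eclext de M g -> 
  forall e z, 0 < e < de -> strip de z ->
    expR ((de - e) * cnorm z) * nc (g z) <= expR (de * (de *+ n)) * M.
Proof.
move=> de0 [dg bg] e z /andP[e0 ed] /strip_tube zd.
have c0 : 0 <= cnorm z by exact: sqrtr_ge0.
have M0 : 0 <= M.
  by have := le_trans (nc_ge0 _) (bg z zd); rewrite pmulr_lge0// expR_gt0.
apply: le_trans (_ : expR (de * cnorm z) * (M * expR (- (de * sumabs z))) <= _).
  apply: ler_pM; [exact: expR_ge0|exact: nc_ge0| |exact: bg].
  by rewrite ler_expR ler_wpM2r// lerBlDr lerDl ltW.
rewrite mulrCA [leRHS]mulrC ler_wpM2l// -expRD ler_expR -mulrBr ler_wpM2l ?(ltW de0)//.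
by rewrite lerBlDl; exact: cnorm_sumabs.
Qed.

Lemma ecl_in_step de M (g : 'rV[C]_n -> C) : 0 < de -> eclext de M g -> in_step de g.
Proof.
move=> de0 hg; split; first by move=> z /strip_tube; exact: hg.1.
move=> e l he /andP[l0 ld]; exists (expR (de * (de *+ n)) * M) => z zl.
by apply: ecl_step => //; exact: lt_trans zl ld.
Qed.

Lemma Pstar_good phi : phi \in Pstar -> good phi.
Proof.
move=> /asboolP[_ [d d0 [f df ef]]].
have dd : 0 < d / 2 < d by rewrite divr_gt0//= ltr_pdivrMr// ltr_pMr// ltr1n.
have [M hM] := df.2 (d / 2) (d / 2) dd dd.
exists (shrink d), M; split; first exact: shrink_gt0.
by exists f => //; exact: step_ecl.
Qed.

Lemma good_Pstar phi : good phi -> phi \in Pstar.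
Proof.
move=> h; apply/asboolP; split; first exact: good_smooth.
move: h => [de [M [de0 [f hf ef]]]]; exists de => //; exists f => //.
exact: ecl_in_step hf.
Qed.

Lemma testfun_good (phi : testfun R n) : good phi.
Proof. by apply: Pstar_good; exact: testfunP. Qed.

Section lift.
Variable A : fn -> fn.
Hypothesis bA : bop A.
Hypothesis lA : forall (a : C) phi psi, good phi -> good psi ->
  A (fun x => a * phi x + psi x) = fun x => a * A phi x + A psi x.

Definition lift (phi : testfun R n) : testfun R n :=
  Testfun (good_Pstar (bop_good bA (testfun_good phi))).

Lemma lift_linear : linear lift.
Proof.
move=> a phi psi; apply/val_inj => /=.
exact: (lA a (testfun_good phi) (testfun_good psi)).
Qed.

HB.instance Definition _ := GRing.isLinear.Build _ _ _ _ lift lift_linear.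

(** The preimage of a neighborhood of 0 contains, on the step [d], the ball of radius
    [c / (E (|K| + 1))] for the seminorm with both parameters [d / 2], where [K] is the
    bound of [A] given by [bop] and [E] the constant of [ecl_step]. *)
Lemma lift_continuous : continuous lift.
Proof.
apply/continuousP => U; rewrite !inductive_openE => oU phi /oU[V [cV sV] hV].
exists (lift @^-1` V) => [|psi /hV]; last by rewrite /= linearD.
split=> [f g a b Vf Vg ab|d d0]; first by rewrite /= linearP linearZ; exact: cV.
have [de [K [de0 hK]]] := bA (shrink_gt0 d0).
have [e [l [c [he /andP[l0 ld] c0 hc]]]] := sV de de0.
have dd : 0 < d / 2 < d by rewrite divr_gt0//= ltr_pdivrMr// ltr_pMr// ltr1n.
have K1 : 0 < `|K| + 1 by rewrite ltr_wpDl.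
pose E := expR (de * (de *+ n)); have E0 : 0 < E by exact: expR_gt0.
exists (d / 2), (d / 2), (c / (E * (`|K| + 1))); split=> //.
  by rewrite divr_gt0// mulr_gt0.
move=> psi f df ef hf /=.
have [g hg eg] := hK _ _ (ex_intro2 _ _ f (step_ecl d0 df hf) ef).
apply: (hc (lift psi) g (ecl_in_step de0 hg) eg) => z zl.
apply: le_trans (ecl_step de0 hg he _) _; first exact: lt_trans zl ld.
have -> : E * (K * (c / (E * (`|K| + 1)))) = c * (K / (`|K| + 1)).
  by field; rewrite !gt_eqF.
rewrite -[leRHS]mulr1 ler_pM2l// ler_pdivrMr// mul1r.
by apply: (le_trans (ler_norm K)); rewrite lerDl.
Qed.

Lemma lift_hyper_continuous (u : hyperfunction R n) :
  continuous ((u \o lift : {linear testfun R n -> C}) : testfun R n -> C).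
Proof.
move=> phi; apply: continuous_comp; first exact: lift_continuous.
exact: hyper_continuous.
Qed.

Definition lift_hyper (u : hyperfunction R n) : hyperfunction R n :=
  Hyperfunction (@lift_hyper_continuous u).

End lift.
End steps.

(** * Complex conjugation and real operators *)
Section conjugation.
Context {R : realType} {n : nat}.
Local Notation C := R[i].
Local Notation fn := ('rV[R]_n -> C).
Implicit Types (phi psi : fn) (x t : 'rV[R]_n) (z : 'rV[C]_n) (j k : 'I_n).

Definition cjv z : 'rV[C]_n := \row_k conjc (z ord0 k).
Definition cj phi : fn := fun x => conjc (phi x).

Lemma cjK : involutive cj.
Proof. by move=> phi; apply/funext => x; rewrite /cj conjcK. Qed.

Lemma cjvD z w : cjv (z + w) = cjv z + cjv w.
Proof. by apply/rowP => k; rewrite !mxE rmorphD. Qed.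

Lemma rnorm_cjv z : rnorm (cjv z) = rnorm z.
Proof.
apply/eqP; rewrite eq_le; apply/andP; split; apply: rnorm_le; rewrite ?rnorm_ge0// => k.
  by rewrite mxE ncJ; exact: nc_rnorm.
by rewrite -ncJ; have := nc_rnorm (cjv z) k; rewrite mxE.
Qed.

(** [z |-> conj (f (conj z))] is complex differentiable: its differential is conjugated
    twice, so it is linear again. *)
Lemma cj_diff (f : 'rV[C]_n -> C) z : differentiable f (cjv z) ->
  differentiable (fun w => conjc (f (cjv w))) z.
Proof.
move=> df; have H := holoE df; move: H.
move: ('d f (cjv z)) => D H.
pose L (h : 'rV[C]_n) : C := conjc (D (cjv h)).
have lL : linear L.
  move=> a u v; rewrite /L cjvD (_ : cjv (a *: u) = conjc a *: cjv u); last first.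
    by apply/rowP => k; rewrite !mxE rmorphM.
  by rewrite linearP rmorphD rmorphM /= conjcK.
pose Ll : {linear 'rV[C]_n -> C} := HB.pack L (GRing.isLinear.Build _ _ _ _ L lL).
apply: (holoI (df := Ll) _).1 => e /H[d d0 hd]; exists d => // h hh.
have := hd (cjv h); rewrite rnorm_cjv => /(_ hh); rewrite -ncJ.
by rewrite !rmorphB /= cjvD.
Qed.

Lemma ecl_cj de M phi : ecl de M phi -> ecl de M (cj phi).
Proof.
move=> [f [df bf] ef].
have tb z : tube de z -> tube de (cjv z).
  by move=> zd k; have := zd k; rewrite mxE; case: (z _ _) => a b /=; rewrite normrN.
exists (fun z => conjc (f (cjv z))).
  split=> z /tb zd; first by apply: cj_diff; exact: df.
  rewrite ncJ (le_trans (bf _ zd))// (_ : sumabs (cjv z) = sumabs z)//.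
  by apply: eq_bigr => k _; rewrite mxE; case: (z _ _).
move=> x; rewrite /cj -ef; congr (conjc (f _)).
by apply/rowP => k; rewrite !mxE conjc_real.
Qed.

Lemma bop_cj : bop cj.
Proof. by move=> de de0; exists de, 1; split=> // M phi; rewrite mul1r; exact: ecl_cj. Qed.

Lemma good_cj phi : good phi -> good (cj phi).
Proof. exact: bop_good bop_cj. Qed.

Lemma partial_cj j phi : good phi -> partial j (cj phi) = cj (partial j phi).
Proof.
move=> [de [M [de0 h]]]; apply/funext => x; rewrite /partial.
have [_ /diff_derivable di] := ecl_diff de0 h x.
have ER : (fun y => complex.Re (cj phi y)) = (fun y => complex.Re (phi y)).
  by apply/funext => y; rewrite /cj; case: (phi y).
have EI : (fun y => complex.Im (cj phi y)) = - (fun y => complex.Im (phi y)).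
  by apply/funext => y; rewrite -[RHS]/(- complex.Im (phi y)) /cj; case: (phi y).
by rewrite ER EI deriveN; last exact: di.
Qed.

Lemma Dadjoint_cj (p : mpoly n R) phi : good phi ->
  Dadjoint p (cj phi) = cj (Dadjoint p phi).
Proof.
move=> h; have Hm m : Dmonom m (cj phi) = cj (Dmonom m phi).
  rewrite /Dmonom; suff: foldr (fun j => iter (m j) (partial j)) (cj phi) (enum 'I_n) =
     cj (foldr (fun j => iter (m j) (partial j)) phi (enum 'I_n)) /\
     good (foldr (fun j => iter (m j) (partial j)) phi (enum 'I_n)) by case.
  elim: (enum _) => [//|j l [IH1 IH2]] /=; rewrite IH1.
  elim: (m j) => [//|i [H1 H2]] /=; rewrite H1 partial_cj//; split=> //.
  exact: good_partial.
apply/funext => x; rewrite /cj rmorph_sum; apply: eq_bigr => m _.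
rewrite Hm rmorphM; congr (_ * _).
rewrite rmorphM; congr (_ * _); first exact: esym (conjc_real _).
by rewrite rmorphXn rmorphN1.
Qed.

Variable A : fn -> fn.

(** The conjugate operator is complex linear because conjugation occurs twice. *)
Definition realify phi x : C := 2^-1 * A phi x + 2^-1 * cj (A (cj phi)) x.

Lemma realify_real phi : cj phi = phi -> forall x, complex.Im (realify phi x) = 0.
Proof.
move=> E x; rewrite /realify E /cj -mulrDr addcJ mulrA mulVf ?pnatr_eq0// mul1r.
by [].
Qed.

Hypothesis bA : bop A.
Hypothesis lA : forall (a : C) phi psi, good phi -> good psi ->
  A (fun x => a * phi x + psi x) = fun x => a * A phi x + A psi x.

Lemma bop_realify : bop realify.
Proof.
apply: bop_lin bA _.
exact: (bop_comp (bop_scale 2^-1) (bop_comp bop_cj (bop_comp bA bop_cj))).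
Qed.

Lemma realify_lin (a : C) phi psi : good phi -> good psi ->
  realify (fun x => a * phi x + psi x) = fun x => a * realify phi x + realify psi x.
Proof.
move=> h1 h2; rewrite /realify lA//.
rewrite (_ : cj (fun x => a * phi x + psi x) = fun x => conjc a * cj phi x + cj psi x).
  rewrite lA; try exact: good_cj.
  by apply/funext => x; rewrite /cj rmorphD rmorphM /= conjcK; ring.
by apply/funext => x; rewrite /cj rmorphD rmorphM.
Qed.

Lemma realify_shift t :
  (forall phi, good phi -> A (shiftf t phi) = shiftf t (A phi)) ->
  forall phi, good phi -> realify (shiftf t phi) = shiftf t (realify phi).
Proof.
move=> HA phi h; apply/funext => x; rewrite /realify HA//.
by rewrite [A (cj _)](HA (cj phi))//; exact: good_cj.
Qed.

(** The coefficients of [p] and [q] are real, so [p(-D)] and [q(-D)] commute with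
    conjugation. *)
Lemma realify_Dadjoint (p q : mpoly n R) :
  (forall phi, good phi -> A (Dadjoint p phi) = Dadjoint q phi) ->
  forall phi, good phi -> realify (Dadjoint p phi) = Dadjoint q phi.
Proof.
move=> HA phi h; apply/funext => x; rewrite /realify HA// -Dadjoint_cj//.
rewrite HA; last exact: good_cj.
rewrite Dadjoint_cj// cjK -mulrDl.
by rewrite (_ : 2^-1 + 2^-1 = 1) ?mul1r//; field.
Qed.

End conjugation.

(** * Identity theorem *)
Section identity.
Context {R : realType}.
Local Notation C := R[i].

(** Let [k1] be [ka] on the side of the real line where [c] lies and 0 on the other
    side. It is holomorphic, since [ka] and its derivative vanish on the line. The
    product of the four rotations of [k1] about [c] by right angles vanishes on the
    circle of radius [2 |Im c|], because each point of the circle has a rotated copy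
    beyond the line; by [mean_bound] it vanishes at [c]. *)
Lemma identity1 (ka : C -> C) (eps : R) c : 0 < eps ->
  (forall w, `|complex.Im w| < eps -> differentiable ka w) ->
  (forall t : R, ka t%:C = 0) -> `|complex.Im c| < eps / 3 -> ka c = 0.
Proof.
move=> eps0 dk k0 ce; set eta := complex.Im c.
have [e0|en0] := eqVneq eta 0.
  by rewrite (_ : c = (complex.Re c)%:C) ?k0//; apply/eqP; rewrite eq_complex /= -/eta e0 !eqxx.
pose k1 w := if 0 < complex.Im w * eta then ka w else 0.
have dk1 w : `|complex.Im w| < eps -> differentiable k1 w.
  move=> we; have dw := dk w we.
  have [h|h|h] := ltgtP 0 (complex.Im w * eta).
  - have wn0 : complex.Im w != 0 by apply: contraTneq h => ->; rewrite mul0r ltxx.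
    have w0 : 0 < `|complex.Im w| by rewrite normr_gt0.
    apply: (near_diff w0 _ dw).1 => u uw; rewrite /k1 ifT//.
    have : `|complex.Im u| < `|complex.Im w| by apply: le_lt_trans uw; exact: Im_le.
    have -> : complex.Im (w + u) = complex.Im w + complex.Im u by case: (w) (u) => ? ? [].
    rewrite ltr_norml => /andP[u1 u2].
    by case: (ltrgt0P (complex.Im w)) u1 u2 wn0 h => //; rewrite ?eqxx// => H u1 u2 _ h;
      move: H h; case: (ltrgt0P eta) => // He; rewrite ?mulr0 ?ltxx//; nra.
  - have wn0 : complex.Im w != 0 by apply: contraTneq h => ->; rewrite mul0r ltxx.
    have w0 : 0 < `|complex.Im w| by rewrite normr_gt0.
    apply: (near_diff (f := fun=> 0) w0 _ _).1 => [u uw|]; last exact: differentiable_cst.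
    rewrite /k1 ifF//; apply/negbTE; rewrite -leNgt.
    have : `|complex.Im u| < `|complex.Im w| by apply: le_lt_trans uw; exact: Im_le.
    have -> : complex.Im (w + u) = complex.Im w + complex.Im u by case: (w) (u) => ? ? [].
    rewrite ltr_norml => /andP[u1 u2].
    by case: (ltrgt0P (complex.Im w)) u1 u2 wn0 h => //; rewrite ?eqxx// => H u1 u2 _ h;
      move: H h; case: (ltrgt0P eta) => // He; rewrite ?mulr0 ?ltxx//; nra.
  - have w0 : complex.Im w = 0.
      by apply/eqP; move/esym/eqP : h; rewrite mulf_eq0 (negbTE en0) orbF.
    have wE : w = (complex.Re w)%:C.
      by apply/eqP; rewrite eq_complex /= w0 !eqxx.
    have kw : ka w = 0 by rewrite wE k0.
    have E := choloE dw.
    have D0 : cder ka w = 0.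
      apply/eqP; rewrite -nc_eq0 eq_le nc_ge0 andbT; apply/ler_addgt0Pr => e e_gt0.
      rewrite add0r; have [d d0 hd] := E _ e_gt0.
      have d2 : 0 < d / 2 by rewrite divr_gt0.
      have := hd (d / 2)%:C; rewrite nc_real gtr0_norm// ltr_pdivrMr// ltr_pMr// ltr1n => /(_ isT).
      rewrite kw subr0 (_ : w + (d / 2)%:C = (complex.Re w + d / 2)%:C); last first.
        by rewrite {1}wE -(rmorphD (real_complex R)).
      by rewrite k0 sub0r ncN ncM nc_real gtr0_norm// mulrC ler_pM2r.
    apply: (choloI (c := 0) _).1 => e e_gt0; have [d d0 hd] := E _ e_gt0.
    exists d => // u ud; have := hd u ud; rewrite D0 kw mulr0 !subr0 /k1 w0 mul0r ltxx.
    by case: ifP => _; rewrite !subr0// nc0 => _; rewrite mulr_ge0// ltW.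
pose G w := k1 (c + w) * k1 (c + 'i%C * w) * (k1 (c - w) * k1 (c - 'i%C * w)).
have ImD (u : C) : complex.Im (c + u) = eta + complex.Im u by rewrite /eta; case: (c) (u) => ? ? [].
have En : 0 < `|eta| by rewrite normr_gt0.
have e3 : `|eta| * 3 < eps by rewrite -ltr_pdivlMr.
pose r := 2 * `|eta|.
pose r' := eps - `|eta|.
have G0 : nc (G 0) <= 0.
  have dlin (a : C) w : nc a = 1 -> nc w < r' -> differentiable (fun w => k1 (c + a * w)) w.
    move=> a1 wr; apply: (@differentiable_comp _ _ _ _ (fun w => c + a * w) k1).
      apply: differentiableD; first exact: differentiable_cst.
      by apply: differentiableM; first exact: differentiable_cst.
    apply: dk1; rewrite ImD; apply: le_lt_trans (ler_normD _ _) _.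
    rewrite -ltrBrDl; apply: le_lt_trans (Im_le _) _.
    by rewrite ncM a1 mul1r.
  have dG w : nc w < r' -> differentiable G w.
    move=> wr; have H a (a1 : nc a = 1) := dlin a w a1 wr.
    have -> : G = fun w => k1 (c + 1 * w) * k1 (c + 'i%C * w) *
                     (k1 (c + (-1) * w) * k1 (c + (- 'i%C) * w)).
      by apply/funext => u; rewrite /G mul1r !mulNr mul1r.
    by apply: differentiableM; apply: differentiableM; apply: H;
      rewrite ?ncN ?nc1 ?nc_ii.
  apply: (@mean_bound _ G r r' 0).
  - by rewrite mulr_gt0.
  - by rewrite /r /r'; lra.
  - apply: differentiable_continuous; apply: dG; rewrite nc0 /r'; lra.
  - by move=> w _; exact: dG.
  move=> w wr; suff -> : G w = 0 by rewrite nc0.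
  have w2 : complex.Re w ^+ 2 + complex.Im w ^+ 2 = r ^+ 2.
    rewrite -wr; case: (w) => a b; rewrite nc_i sqr_sqrtr//.
    by rewrite addr_ge0// sqr_ge0.
  have kz u : complex.Im u * eta <= - eta ^+ 2 -> k1 (c + u) = 0.
    move=> hu; rewrite /k1 ifF//; apply/negbTE; rewrite -leNgt ImD mulrDl; nra.
  have e2 : r ^+ 2 = 4 * eta ^+ 2 by rewrite /r exprMn real_normK ?num_real//; ring.
  rewrite /G; move: w2; rewrite e2.
  have := kz w; have := kz ('i%C * w); have := kz (- w); have := kz (- ('i%C * w)).
  have Im_i : complex.Im ('i%C * w) = complex.Re w by case: (w) => ? ? /=; ring.
  have ImN (u : C) : complex.Im (- u) = - complex.Im u by case: u.
  rewrite !ImN Im_i; move: (complex.Re w) (complex.Im w) => a b h1 h2 h3 h4 ab.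
  have [b0|b0] := leP (eta ^+ 2) (`|b| * `|eta|).
    have : b * eta <= - eta ^+ 2 \/ - b * eta <= - eta ^+ 2.
      move: b0; rewrite -normrM mulNr; case: (ger0P (b * eta)) => _ h; [right|left]; lra.
    by case=> [/h4 ->|/h2 ->]; rewrite ?(mul0r,mulr0).
  have [a0|a0] := leP (eta ^+ 2) (`|a| * `|eta|).
    have : a * eta <= - eta ^+ 2 \/ - a * eta <= - eta ^+ 2.
      move: a0; rewrite -normrM mulNr; case: (ger0P (a * eta)) => _ h; [right|left]; lra.
    by case=> [/h3 ->|/h1 ->]; rewrite ?(mul0r,mulr0).
  exfalso; have n2 (x : R) : x ^+ 2 = `|x| ^+ 2 by rewrite real_normK ?num_real.
  move: ab a0 b0; rewrite (n2 a) (n2 b) (n2 eta).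
  have := normr_ge0 a; have := normr_ge0 b.
  rewrite !(expr2 `|eta|) !ltr_pM2r//; nra.
have : G 0 = 0 by apply/eqP; rewrite -nc_eq0 eq_le G0 nc_ge0.
rewrite /G mulr0 subr0 !addr0 => /eqP; rewrite !mulf_eq0 !orbb => /eqP.
by rewrite /k1 ifT// -expr2 exprn_even_gt0.
Qed.

Context {n : nat}.
Implicit Types (z : 'rV[C]_n) (j k : 'I_n) (l : seq 'I_n).

Lemma diff_upd (f : 'rV[C]_n -> C) z j (w : C) : differentiable f (upd z j w) ->
  differentiable (fun w => f (upd z j w)) w.
Proof.
move=> df; rewrite (_ : (fun w => _) = (fun u : C => f (upd z j 0 + u *: delta_mx ord0 j))).
  by apply: (line_cder _).1; rewrite -updE.
by apply/funext => u; rewrite updE.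
Qed.

(** One coordinate after the other is allowed to leave the real line. *)
Lemma identityn (f : 'rV[C]_n -> C) (eps : R) z : 0 < eps ->
  (forall z, tube eps z -> differentiable f z) ->
  (forall x, f (toC x) = 0) -> tube (eps / 3) z -> f z = 0.
Proof.
move=> eps0 df f0.
have e3 : eps / 3 <= eps by rewrite ler_pdivrMr// ler_pMr// ler1n.
suff H l z' : tube (eps / 3) z' -> (forall k, k \notin l -> complex.Im (z' ord0 k) = 0) ->
    f z' = 0.
  by move=> zt; apply: (H (enum 'I_n) z zt) => k; rewrite mem_enum.
elim: l z' => [|j l IH] z' zt hz.
  rewrite (_ : z' = toC (\row_k complex.Re (z' ord0 k))) ?f0//.
  apply/rowP => k; rewrite !mxE; have := hz k isT.
  by case: (z' _ _) => a b /= ->.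
have E : z' = upd z' j (z' ord0 j).
  by apply/rowP => k; rewrite mxE; case: eqP => [->|].
rewrite E; apply: (@identity1 (fun w => f (upd z' j w)) eps _ eps0).
- move=> w we; apply: diff_upd; apply: df => k; rewrite mxE; case: eqP => // _.
  exact: lt_le_trans (zt k) e3.
- move=> t; apply: IH => k; rewrite mxE; case: eqP => [_|kj] //=.
    by rewrite normr0 divr_gt0.
  by move=> kl; apply: hz; rewrite inE negb_or kl andbT; apply/eqP.
- exact: zt.
Qed.

End identity.

(** * Division by a polynomial *)
Section division.
Context {R : realType} {n : nat}.
Local Notation C := R[i].
Implicit Types (z : 'rV[C]_n) (j k : 'I_n) (p q : mpoly n R) (m : multinom n).

(** An algebra that contains the coordinates, hence the polynomials; the width 1 of the
    tube is an arbitrary normalization. *)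
Definition subexp (g : 'rV[C]_n -> C) := (forall z, differentiable g z) /\
  forall de : R, 0 < de -> exists2 K : R, 0 <= K &
    forall z, tube 1 z -> nc (g z) <= K * expR (de * sumabs z).

Lemma subexp_cst (a : C) : subexp (fun=> a).
Proof.
split=> [z|de de0]; first exact: differentiable_cst.
exists (nc a) => [|z _]; first exact: nc_ge0.
rewrite ler_peMr ?nc_ge0// -expR0 ler_expR.
by rewrite mulr_ge0 ?(ltW de0)// sumabs_ge0.
Qed.

Lemma subexp_coord k : subexp (fun z => z ord0 k).
Proof.
split=> [z|de de0]; first exact: differentiable_coord.
exists (de^-1 + 1) => [|z zt]; first by rewrite addr_ge0// invr_ge0 ltW.
have s0 := sumabs_ge0 z; have h1 := sumabs_j z k; have h2 := ltW (zt k).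
apply: le_trans (nc_le _) _.
have h3 := expR_ge1Dx (de * sumabs z); have d1 : 0 <= de^-1 by rewrite invr_ge0 ltW.
have h4 : sumabs z = de^-1 * (de * sumabs z) by rewrite mulKf// gt_eqF.
have h5 : 0 <= de * sumabs z by rewrite mulr_ge0// ltW.
rewrite mulrDl mul1r lerD//; last by apply: (le_trans h2); lra.
apply: (le_trans h1); rewrite h4 ler_wpM2l// -h4; lra.
Qed.

Lemma subexpD f g : subexp f -> subexp g -> subexp (fun z => f z + g z).
Proof.
move=> [df bf] [dg bg]; split=> [z|de de0]; first exact: differentiableD.
have [K K0 hK] := bf _ de0; have [L L0 hL] := bg _ de0.
exists (K + L) => [|z zt]; first exact: addr_ge0.
by apply: le_trans (ncD _ _) _; rewrite mulrDl lerD ?hK ?hL.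
Qed.

Lemma subexpM f g : subexp f -> subexp g -> subexp (fun z => f z * g z).
Proof.
move=> [df bf] [dg bg]; split=> [z|de de0]; first exact: differentiableM.
have d2 : 0 < de / 2 by rewrite divr_gt0.
have [K K0 hK] := bf _ d2; have [L L0 hL] := bg _ d2.
exists (K * L) => [|z zt]; first exact: mulr_ge0.
rewrite ncM; apply: le_trans (ler_pM (nc_ge0 _) (nc_ge0 _) (hK z zt) (hL z zt)) _.
by rewrite mulrACA -expRD -mulrDl -splitr.
Qed.

Lemma subexp_sum (I : Type) (l : seq I) (f : I -> 'rV[C]_n -> C) :
  (forall i, subexp (f i)) -> subexp (fun z => \sum_(i <- l) f i z).
Proof.
move=> hf; elim: l => [|i l IH].
  by have := subexp_cst 0; congr subexp; apply/funext => z; rewrite big_nil.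
have := subexpD (hf i) IH; congr subexp; apply/funext => z; rewrite big_cons //.
Qed.

Lemma subexp_prod (I : Type) (l : seq I) (f : I -> 'rV[C]_n -> C) :
  (forall i, subexp (f i)) -> subexp (fun z => \prod_(i <- l) f i z).
Proof.
move=> hf; elim: l => [|i l IH].
  by have := subexp_cst 1; congr subexp; apply/funext => z; rewrite big_nil.
have := subexpM (hf i) IH; congr subexp; apply/funext => z; rewrite big_cons //.
Qed.

Lemma subexpX f (k : nat) : subexp f -> subexp (fun z => f z ^+ k).
Proof.
move=> hf; elim: k => [|k IH]; first exact: subexp_cst.
by have := subexpM hf IH; congr subexp; apply/funext => z; rewrite exprS.
Qed.

Lemma subexp_mpoly p : subexp (mpoly_at_i p).
Proof.
apply: subexp_sum => m; apply: subexpM; first exact: subexp_cst.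
apply: subexp_prod => j; apply: subexpX.
by apply: subexpM; [exact: subexp_cst|exact: subexp_coord].
Qed.

Lemma ncJc (z : C) : nc (conjc z) = nc z.
Proof. by case: z => a b; rewrite !nc_i sqrrN. Qed.

Lemma cdiffX (f : C -> C) (k : nat) w : differentiable f w ->
  differentiable (fun w : C => f w ^+ k) w.
Proof.
move=> df; elim: k => [|k IH]; first exact: differentiable_cst.
rewrite (_ : (fun w : C => _) = fun w => f w * f w ^+ k); first exact: differentiableM.
by apply/funext => u; rewrite exprS.
Qed.

Lemma cdiff_sum (I : Type) (l : seq I) (f : I -> C -> C) w :
  (forall i, differentiable (f i) w) -> differentiable (fun w => \sum_(i <- l) f i w) w.
Proof.
move=> df; elim: l => [|i l IH].
  rewrite (_ : (fun w => _) = fun=> 0); first exact: differentiable_cst.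
  by apply/funext => u; rewrite big_nil.
rewrite (_ : (fun w => _) = f i \+ fun w => \sum_(i <- l) f i w).
  exact: differentiableD.
by apply/funext => u; rewrite big_cons.
Qed.

Lemma cdiff_prod (I : Type) (l : seq I) (f : I -> C -> C) w :
  (forall i, differentiable (f i) w) -> differentiable (fun w => \prod_(i <- l) f i w) w.
Proof.
move=> df; elim: l => [|i l IH].
  rewrite (_ : (fun w => _) = fun=> 1); first exact: differentiable_cst.
  by apply/funext => u; rewrite big_nil.
rewrite (_ : (fun w => _) = f i \* fun w => \prod_(i <- l) f i w).
  exact: differentiableM.
by apply/funext => u; rewrite big_cons.
Qed.

(** Different powers of [w] in the coordinates separate the monomials of a
    polynomial: with [e j = D ^ j] the leading power of [w] in [p (curve w)] comes from
    one monomial only, and its coefficient does not depend on [z]. *)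
Definition curve (r : R) (e : 'I_n -> nat) z (w : C) : 'rV[C]_n :=
  \row_j (z ord0 j + r%:C * w ^+ e j).

Lemma curve_diff r e z w : differentiable (curve r e z) w.
Proof.
have H (l : seq 'I_n) : differentiable (fun w : C =>
    \sum_(j <- l) (z ord0 j + r%:C * w ^+ e j) *: (delta_mx ord0 j : 'rV[C]_n)) w.
  elim: l => [|j l IH].
    rewrite (_ : (fun w : C => _) = fun=> 0); first exact: differentiable_cst.
    by apply/funext => u; rewrite big_nil.
  rewrite (_ : (fun w : C => _) = (fun u : C =>
      (z ord0 j + r%:C * u ^+ e j) *: (delta_mx ord0 j : 'rV[C]_n)) \+ (fun w : C =>
    \sum_(j <- l) (z ord0 j + r%:C * w ^+ e j) *: (delta_mx ord0 j : 'rV[C]_n))).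
    apply: differentiableD => //; apply: differentiableZl.
    apply: differentiableD; first exact: differentiable_cst.
    by apply: differentiableM; [exact: differentiable_cst|exact: (cdiffX _ (f := id))].
  by apply/funext => u; rewrite /= big_cons.
rewrite (_ : curve r e z = fun u : C => \sum_(j <- index_enum 'I_n)
    (z ord0 j + r%:C * u ^+ e j) *: (delta_mx ord0 j : 'rV[C]_n)); first exact: H.
apply/funext => u; rewrite [LHS]row_sum_delta.
by apply: eq_bigr => j _; rewrite mxE.
Qed.

(** Uniqueness of the digits in base [D]. *)
Lemma digits_inj (D : nat) (l : seq 'I_n) (f g : 'I_n -> nat) : uniq l ->
  (forall j, f j < D)%N -> (forall j, g j < D)%N ->
  (\sum_(j <- l) f j * D ^ index j l = \sum_(j <- l) g j * D ^ index j l)%N ->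
  forall j, j \in l -> f j = g j.
Proof.
move=> + fD gD; elim: l => [//|k l IH] /= /andP[kl ul].
have E (h : 'I_n -> nat) : (\sum_(j <- k :: l) h j * D ^ (if k == j then 0 else (index j l).+1) =
    (\sum_(j <- l) h j * D ^ index j l) * D + h k)%N.
  rewrite big_cons eqxx expn0 muln1 addnC; congr (_ + _)%N.
  rewrite big_distrl big_seq [RHS]big_seq; apply: eq_bigr => j jl.
  rewrite ifF; first by rewrite expnSr mulnA.
  by apply/negbTE; apply: contraNneq kl => ->.
rewrite !E => H.
have fg : f k = g k.
  by move: (congr1 (modn^~ D) H); rewrite !modnMDl !modn_small.
have D0 : (0 < D)%N by exact: leq_ltn_trans (fD k).
move: H; rewrite fg => /addIn/eqP; rewrite eqn_pmul2r// => /eqP H j.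
by rewrite inE => /orP[/eqP ->//|]; exact: IH.
Qed.

Lemma seq_argmax (T : eqType) (s : seq T) (W : T -> nat) : s != [::] ->
  exists2 x, x \in s & forall y, y \in s -> (W y <= W x)%N.
Proof.
elim: s => [//|a s IH] _; have [->|sn] := eqVneq s [::].
  by exists a; rewrite ?mem_head// => y; rewrite inE => /eqP ->.
have [x xs hx] := IH sn; have [ax|xa] := leqP (W a) (W x).
  by exists x; [rewrite inE xs orbT|move=> y; rewrite inE => /orP[/eqP ->//|/hx]].
exists a; first exact: mem_head.
by move=> y; rewrite inE => /orP[/eqP ->//|/hx h]; exact: leq_trans (ltnW xa).
Qed.

(** [Q] is [w ^ N] times the conjugate of [p (curve (1 / conj w))], a polynomial in [w]:
    on the unit circle it has the modulus of [p (curve w)], and at 0 the conjugate of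
    the leading coefficient, which is the one of the monomial of largest weight. *)
Lemma reversal p : p != 0 -> exists2 e : 'I_n -> nat, (forall j, 0 < e j)%N &
  forall r : R, 0 < r -> exists2 A : R, 0 < A & forall z, exists Q : C -> C,
    [/\ forall w, differentiable Q w, nc (Q 0) = A &
        forall w, nc w = 1 -> nc (Q w) = nc (mpoly_at_i p (curve r e z w))].
Proof.
move=> p0; pose D := (mmeasure mdeg p).+1.
pose e (j : 'I_n) := (D ^ index j (enum 'I_n))%N.
have e0 j : (0 < e j)%N by rewrite expn_gt0.
exists e => // r r0; pose W m := (\sum_(j <- enum 'I_n) m j * e j)%N.
have sp : msupp p != [::] by rewrite msupp_eq0.
have [mx mxp hmx] := seq_argmax W sp.
have mD m : m \in msupp p -> forall j, (m j < D)%N.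
  move=> mp j; apply: leq_ltn_trans (ltnW (msize_mdeg_lt mp) : (mdeg m < D)%N).
  by rewrite mdegE (bigD1 j)//= leq_addr.
have Winj m : m \in msupp p -> W m = W mx -> m = mx.
  move=> mp h; apply/mnmP => j.
  exact: (digits_inj (enum_uniq 'I_n) (mD _ mp) (mD _ mxp) h (mem_enum _ j)).
pose b : C := 'i%C * r%:C.
have nb : nc b = r by rewrite ncM nc_ii mul1r nc_real gtr0_norm.
exists (nc (mcoeff mx p)%:C * r ^+ mdeg mx).
  rewrite mulr_gt0// ?exprn_gt0// nc_real normr_gt0.
  by move: mxp; rewrite mcoeff_msupp.
move=> z; pose F m (w : C) : C := \prod_(j <- enum 'I_n)
   (conjc ('i%C * z ord0 j) * w ^+ e j + conjc b) ^+ m j.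
pose Q (w : C) : C := \sum_(m <- msupp p) conjc (mcoeff m p)%:C * (w ^+ (W mx - W m) * F m w).
exists Q; split.
- move=> w; apply: cdiff_sum => m; apply: differentiableM; first exact: differentiable_cst.
  apply: differentiableM; first exact: (cdiffX _ (f := id)).
  apply: cdiff_prod => j; apply: cdiffX; apply: differentiableD; last exact: differentiable_cst.
  by apply: differentiableM; [exact: differentiable_cst|exact: (cdiffX _ (f := id))].
- rewrite /Q (bigD1_seq mx) ?msupp_uniq// big1_seq; last first.
    move=> m /andP[mmx mp]; rewrite expr0n subn_eq0.
    rewrite (_ : (_ <= _)%N = false) ?mul0r ?mulr0//; apply/negbTE; rewrite -ltnNge ltn_neqAle hmx// andbT.
    by apply: contra mmx => /eqP /(Winj _ mp) ->.
  rewrite [X in nc X]addr0 subnn expr0 mul1r ncM; congr (_ * _); first exact: ncJc.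
  rewrite /F (eq_bigr (fun j => conjc b ^+ mx j)); last first.
    by move=> j _; rewrite expr0n gtn_eqF// mulr0 add0r.
  by rewrite prodrXr big_enum -mdegE ncX ncJc nb.
move=> w w1; have wc : w * conjc w = 1.
  by rewrite -sqr_normc normCE w1 expr1n.
have FE m : F m w = w ^+ W m * conjc (\prod_(j <- enum 'I_n) ('i%C * (curve r e z w) ord0 j) ^+ m j).
  rewrite /F /W; elim: (enum _) => [|j l IH]; first by rewrite !big_nil expr0 mul1r rmorph1.
  rewrite !big_cons IH exprD [X in _ = _ * X]rmorphM [RHS]mulrACA; congr (_ * _).
  rewrite mulnC exprM rmorphXn -exprMn; congr (_ ^+ _).
  rewrite mxE mulrDr rmorphD mulrDr; congr (_ + _); first exact: mulrC.
  by rewrite mulrA -/b [X in _ = _ * X]rmorphM rmorphXn [RHS]mulrCA -exprMn wc expr1n mulr1.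
have -> : Q w = w ^+ W mx * conjc (mpoly_at_i p (curve r e z w)).
  rewrite /Q /mpoly_at_i /mmap rmorph_sum big_distrr big_seq [RHS]big_seq.
  apply: eq_bigr => m mp; rewrite FE [X in _ = _ * X]rmorphM.
  rewrite [X in _ * X = _]mulrA -exprD subnK ?hmx// [LHS]mulrCA; congr (_ * (_ * _)).
  by rewrite /mmap1 big_enum complexiE.
by rewrite ncM ncJc ncX w1 expr1n mul1r.
Qed.

Lemma curve_tube (eta : R) (e : 'I_n -> nat) : 0 < eta -> exists2 r : R, 0 < r < eta &
  forall z w, tube eta z -> nc w < 2 -> tube (eta + eta) (curve r e z w).
Proof.
move=> eta0; pose N := (\sum_j e j)%N; pose r := eta / 2 ^+ N.+1.
have r0 : 0 < r by rewrite divr_gt0// exprn_gt0.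
have rr (k : nat) : (k <= N)%N -> r * 2 ^+ k < eta.
  by move=> kN; rewrite /r mulrAC ltr_pdivrMr ?exprn_gt0// ltr_pM2l// ltr_eXn2l ?ltr1n// ltnS.
exists r => [|z w zt w2 k].
  by rewrite r0 -[r]mulr1 -(expr0 2) rr.
rewrite mxE; have -> : complex.Im (z ord0 k + r%:C * w ^+ e k) =
    complex.Im (z ord0 k) + complex.Im (r%:C * w ^+ e k).
  by case: (z _ _) (_ * _) => ? ? [].
apply: le_lt_trans (ler_normD _ _) _; rewrite ltrD//.
apply: le_lt_trans (Im_le _) _; rewrite ncM nc_real gtr0_norm// ncX.
have ek : (e k <= N)%N by rewrite /N (bigD1 k)//= leq_addr.
apply: le_lt_trans (rr _ ek); rewrite ler_pM2l//.
by apply: lerXn2r; rewrite ?nnegrE ?nc_ge0//; exact: ltW.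
Qed.

(** The maximum principle [mean_bound] for [Q * (g \o curve)], with [Q] from
    [reversal]. *)
Lemma malgrange p (eta : R) : p != 0 -> 0 < eta ->
  exists2 e : 'I_n -> nat, True & exists2 r : R, 0 < r < eta & exists2 A : R, 0 < A &
  (forall z w, tube eta z -> nc w = 1 -> tube (eta + eta) (curve r e z w)) /\
  forall (g : 'rV[C]_n -> C) z (B : R), (forall z, tube (eta + eta) z -> differentiable g z) ->
    tube eta z ->
    (forall w, nc w = 1 -> nc (g (curve r e z w) * mpoly_at_i p (curve r e z w)) <= B) ->
    A * nc (g z) <= B.
Proof.
move=> p0 eta0; have [e e0 He] := reversal p0; exists e => //.
have [r /andP[r0 re] hr] := curve_tube e eta0; exists r; first by rewrite r0.
have [A A0 HA] := He r r0; exists A => //; split.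
  by move=> z w zt w1; apply: hr => //; rewrite w1 ltr1n.
move=> g z B dg zt hB; have [Q [dQ Q0 hQ]] := HA z.
have c0 : curve r e z 0 = z.
  by apply/rowP => j; rewrite mxE expr0n gtn_eqF// mulr0 addr0.
have dG w : nc w < 2 -> differentiable (fun w => Q w * g (curve r e z w)) w.
  move=> w2; apply: differentiableM; first exact: dQ.
  apply: (@differentiable_comp _ _ _ _ (curve r e z) g); first exact: curve_diff.
  by apply: dg; exact: hr.
have := @mean_bound _ (fun w => Q w * g (curve r e z w)) 1 2 B.
rewrite c0 ncM Q0; apply => //.
- by rewrite ltr1n.
- by apply: differentiable_continuous; apply: dG; rewrite nc0.
- by move=> w _; exact: dG.
- by move=> w w1; rewrite ncM hQ// mulrC -ncM; exact: hB.
Qed.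

Lemma sumabs_curve (r : R) e z w : 0 < r -> nc w = 1 ->
  sumabs (curve r e z w) <= sumabs z + r *+ n.
Proof.
move=> r0 w1; rewrite -[X in _ *+ X](card_ord n) -sumr_const -big_split /=.
apply: ler_sum => k _; rewrite mxE.
have -> : complex.Re (z ord0 k + r%:C * w ^+ e k) =
    complex.Re (z ord0 k) + complex.Re (r%:C * w ^+ e k).
  by case: (z _ _) (_ * _) => ? ? [].
apply: le_trans (ler_normD _ _) _; rewrite lerD2l; apply: le_trans (Re_le _) _.
by rewrite ncM nc_real gtr0_norm// ncX w1 expr1n mulr1.
Qed.

(** The product of [k = h p - q] with [p] vanishes at real points, also where [p] does,
    hence near them; dividing by [p] through [malgrange] gives [k = 0]. A second use of
    [malgrange] bounds [h] by [h p = q]. *)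
Lemma tempered_ratio p q (h : 'rV[C]_n -> C) (eps : R) : p != 0 -> 0 < eps ->
  (forall z, tube eps z -> differentiable h z) ->
  (forall x, mpoly_at_i p (toC x) != 0 ->
     h (toC x) = mpoly_at_i q (toC x) / mpoly_at_i p (toC x)) ->
  tempered h /\ forall x, h (toC x) * mpoly_at_i p (toC x) = mpoly_at_i q (toC x).
Proof.
move=> p0 eps0 dh hpq; pose P := mpoly_at_i p; pose Q := mpoly_at_i q.
pose k z := h z * P z - Q z.
have dP z : differentiable P z by exact: (subexp_mpoly p).1.
have dQ z : differentiable Q z by exact: (subexp_mpoly q).1.
have dk z : tube eps z -> differentiable k z.
  by move=> zt; exact: (differentiableB (differentiableM (dh z zt) (dP z)) (dQ z)).
have dkP z : tube eps z -> differentiable (fun z => k z * P z) z.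
  by move=> zt; exact: (differentiableM (dk z zt) (dP z)).
have kP0 x : k (toC x) * P (toC x) = 0.
  have [P0|Pn] := eqVneq (P (toC x)) 0; first by rewrite P0 mulr0.
  by rewrite /k hpq// mulfVK// subrr mul0r.
have kP z : tube (eps / 3) z -> k z * P z = 0 := identityn eps0 dkP kP0.
(* the curves through the tube of width [eta] stay in the tube of width
   [eta + eta], where [identityn] applies and polynomials are bounded by [subexp] *)
pose eta := Num.min (eps / 6) (1 / 2).
have eta0 : 0 < eta by rewrite lt_min !divr_gt0.
have eta3 : eta + eta <= eps / 3.
  have : eta <= eps / 6 by rewrite ge_min lexx.
  lra.
have eta1 : eta + eta <= 1.
  have : eta <= 1 / 2 by rewrite ge_min lexx orbT.
  lra.
have etae : eta + eta <= eps by apply: le_trans eta3 _; lra.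
have [e _ [r /andP[r0 re] [A A0 [ct HM]]]] := malgrange p0 eta0.
have k0 z : tube eta z -> k z = 0.
  move=> zt; have : A * nc (k z) <= 0.
    apply: (HM k z 0 (fun z' zt' => dk z' (tubeW etae zt')) zt) => w w1;
    have ctw := ct z w zt w1; by rewrite (kP _ (tubeW eta3 ctw)) nc0.
  by rewrite pmulr_rle0// => h0; apply/eqP; rewrite -nc_eq0 eq_le h0 nc_ge0.
have hP z : tube eta z -> h z * P z = Q z.
  by move=> /k0/eqP; rewrite subr_eq0 => /eqP.
split; last by move=> x; apply: hP; exact: toC_tube.
pose eta' := eta / 2.
have eta'0 : 0 < eta' by rewrite divr_gt0.
have eta'E : eta' + eta' = eta by rewrite /eta' -splitr.
have [e' _ [r' /andP[r'0 re'] [A' A'0 [ct' HM']]]] := malgrange p0 eta'0.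
have eta'1 : eta' <= eps by apply: le_trans etae; lra.
exists eta' => //; split=> [z zt|de de0]; first by apply: dh; exact: tubeW zt.
have [K K0 hK] := (subexp_mpoly q).2 de de0.
exists (A'^-1 * (K * expR (de * (r' *+ n)))) => z zt.
rewrite -mulrA -ler_pdivrMl ?invr_gt0// invrK.
apply: HM' => //; first by move=> z' zt'; apply: dh; apply: tubeW zt'; lra.
move=> w w1; have ctw := ct' z w zt w1.
rewrite -/P hP -?eta'E//; apply: le_trans (hK _ _) _; first by apply: tubeW ctw; lra.
rewrite -mulrA ler_wpM2l// -expRD ler_expR -mulrDr ler_wpM2l ?(ltW de0)// addrC.
exact: sumabs_curve.
Qed.

End division.

(** * Translation invariance of Lebesgue measure on tuples *)
Section push.
Context {R : realType} {d d' : measure_display} {T : measurableType d} {T' : measurableType d'}.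
Variables (m : {measure set T -> \bar R}) (m' : {measure set T' -> \bar R}) (g : T -> T').
Hypothesis mg : measurable_fun setT g.
Hypothesis E : forall A, measurable A -> m' A = m (g @^-1` A).

Lemma Rint_push (f : T' -> R) : measurable_fun setT f ->
  Rintegral m' setT f = Rintegral m setT (f \o g).
Proof.
move=> mf; pose pf : {measure set T' -> \bar R} :=
  measure_function_pushforward__canonical__measure_function_Measure m mg.
have H (h : T' -> \bar R) : measurable_fun setT h -> (forall y, (0 <= h y)%E) ->
    (\int[m']_y h y = \int[m]_x h (g x))%E.
  move=> mh h0; transitivity (\int[pf]_y h y)%E.
    by apply: eq_measure_integral => A mA _; exact: E.
  by rewrite ge0_integral_pushforward.
have mf' : measurable_fun setT (EFin \o f) by exact: measurableT_comp.
rewrite /Rintegral; congr fine; rewrite integralE [in RHS]integralE; congr (_ - _)%E.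
  etransitivity; first exact: (H _ (measurable_funepos mf') (funepos_ge0 (EFin \o f))).
  by apply: eq_integral => x _; rewrite !(funeposE,funenegE).
etransitivity; first exact: (H _ (measurable_funeneg mf') (funeneg_ge0 (EFin \o f))).
by apply: eq_integral => x _; rewrite !(funeposE,funenegE).
Qed.

Lemma cint_push (f : T' -> R[i]) : cmeas setT f -> cint m' setT f = cint m setT (f \o g).
Proof. by move=> [fr fi]; rewrite /cint (Rint_push fr) (Rint_push fi). Qed.

End push.

Section translation.
Context {R : realType}.
Local Notation mR := (measurableTypeR R).
Local Notation leb := (@lebesgue_measure R).

Definition tshift n (c t : n.-tuple mR) : n.-tuple mR :=
  [tuple (tnth t j - tnth c j : R) | j < n].

Lemma measurable_tshift n (c : n.-tuple mR) : measurable_fun setT (tshift c).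
Proof.
apply/measurable_fun_tnthP => j.
rewrite (_ : _ \o _ = fun t : n.-tuple mR => (tnth t j - tnth c j : R)).
  by apply: measurable_funB; [exact: measurable_tnth|exact: measurable_cst].
by apply/funext => t; rewrite /= tnth_mktuple.
Qed.

Lemma tshift_cons n (c0 : mR) (c : n.-tuple mR) (a : mR) (t : n.-tuple mR) :
  tshift [tuple of c0 :: c] (tcons (a, t)) = tcons ((a - c0 : R), tshift c t).
Proof.
apply: eq_from_tnth => j; rewrite tnth_mktuple.
by case: (unliftP ord0 j) => [k ->|->]; rewrite ?tnthS ?tnth0 ?tnth_mktuple.
Qed.

Lemma lebesgue_tupleS n (A : set (n.+1.-tuple mR)) : measurable A ->
  lebesgue_tuple n.+1 A =
  (\int[leb]_a (lebesgue_tuple n (fun t => A (tcons (a, t)))))%E.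
Proof.
move=> mA; apply: eq_integral => a _ /=; congr (lebesgue_tuple n _).
by apply/funext => t; rewrite /xsection/=; apply/propext; rewrite in_setE.
Qed.

(** By induction on the dimension: sections of a translated set are translates of
    sections. *)
Lemma lebesgue_tuple_shift n (c : n.-tuple mR) A : measurable A ->
  lebesgue_tuple n A = lebesgue_tuple n (tshift c @^-1` A).
Proof.
elim: n c A => [|n IH] c A mA.
  by congr (lebesgue_tuple 0 _); apply/funext => t; rewrite /preimage/= (tuple0 t) (tuple0 (tshift _ _)).
case/tupleP: c => c0 c.
have mS : measurable (tshift [tuple of c0 :: c] @^-1` A).
  by rewrite -[X in measurable X]setTI; exact: measurable_tshift.
rewrite !lebesgue_tupleS//.
pose F (a : mR) := lebesgue_tuple n (fun t => A (tcons (a, t))).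
have mtA : measurable (@tcons R n @^-1` A).
  by rewrite -[X in measurable X]setTI; exact: measurable_tcons.
have sec a : xsection (@tcons R n @^-1` A) a = (fun t => A (tcons (a, t))).
  by apply/funext => t; apply/propext; rewrite /xsection/= in_setE.
have mF : measurable_fun setT F.
  have := measurable_fun_xsection (lebesgue_tuple n) mtA; congr measurable_fun.
  by apply/funext => a; rewrite /= sec.
have ms a : measurable (fun t => A (tcons (a, t))).
  by rewrite -sec; exact: measurable_xsection.
rewrite (@ge0_int_affine R 1 (- c0) (oner_neq0 R) F mF)// normr1 mul1e.
apply: eq_integral => a _; rewrite /F (IH c _ (ms _)) /aff mul1r.
by congr (lebesgue_tuple n _); apply/funext => t; rewrite /preimage/= tshift_cons.
Qed.

Lemma cint_translate n (x : 'rV[R]_n) (F : 'rV[R]_n -> R[i]) :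
  cmeas setT (F \o @row_of_tuple R n) ->
  cint (lebesgue_tuple n) setT (fun t => F (row_of_tuple t - x)) =
  cint (lebesgue_tuple n) setT (fun t => F (row_of_tuple t)).
Proof.
move=> mF; pose c : n.-tuple mR := [tuple x ord0 j | j < n].
rewrite [RHS](cint_push (measurable_tshift c) (lebesgue_tuple_shift c) mF).
apply: eq_cint => t _; congr F; apply/rowP => j.
by rewrite !mxE !tnth_mktuple.
Qed.

End translation.

(** * Laws and characteristic functions of random vectors *)
Section sign_iteration.
Context {R : realType}.
Implicit Types (s : R).

(** Iterating this polynomial on [-1, 1] converges to the sign; polynomials are used
    because they turn trigonometric polynomials into trigonometric polynomials. *)
Definition rmap s : R := (3 * s - s ^+ 3) / 2.

Lemma rmap_itv s : `|s| <= 1 -> `|rmap s| <= 1.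
Proof.
rewrite !ler_norml /rmap => /andP[h1 h2]; apply/andP; split.
  rewrite ler_pdivlMr//; have : 0 <= (1 + s) ^+ 2 * (2 - s) by rewrite mulr_ge0 ?sqr_ge0//; lra.
  nra.
rewrite ler_pdivrMr//; have : 0 <= (1 - s) ^+ 2 * (2 + s) by rewrite mulr_ge0 ?sqr_ge0//; lra.
nra.
Qed.

Lemma rmapN s : rmap (- s) = - rmap s.
Proof. by rewrite /rmap; field. Qed.

Lemma iter_rmapN m s : iter m rmap (- s) = - iter m rmap s.
Proof. by elim: m => [//|m IH] /=; rewrite IH rmapN. Qed.

Lemma iter_rmap_itv m s : `|s| <= 1 -> `|iter m rmap s| <= 1.
Proof. by move=> h; elim: m => [//|m IH] /=; exact: rmap_itv. Qed.

(** [1 - rmap x = (1 - x) (1 - x / 2 - x ^ 2 / 2)], and the second factor is at most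
    [1 - s / 2] once [x >= s]. *)
Lemma iter_rmap_pos m s : 0 < s <= 1 ->
  s <= iter m rmap s <= 1 /\ 1 - iter m rmap s <= (1 - s / 2) ^+ m.
Proof.
move=> /andP[s0 s1]; elim: m => [|m [/andP[h1 h2] h3]]; first by rewrite /= lexx s1; split=> //; lra.
rewrite [iter m.+1 _ _]/=; set x := iter m rmap s in h1 h2 h3 *; rewrite /rmap.
have x0 : 0 < x by exact: lt_le_trans h1.
have x2 : x * x <= 1 by rewrite mulr_ile1// ltW.
have E1 : (3 * x - x ^+ 3) / 2 = x + x * (1 - x * x) / 2 by field.
have E2 : 1 - (3 * x - x ^+ 3) / 2 = (1 - x) * (1 - x / 2 - x ^+ 2 / 2) by field.
split.
  apply/andP; split.
    by rewrite E1 (le_trans h1)// lerDl divr_ge0// mulr_ge0 ?(ltW x0)// subr_ge0.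
  rewrite -subr_ge0 E2 mulr_ge0 ?subr_ge0//.
  by rewrite expr2; lra.
rewrite E2 [leRHS]exprSr; apply: ler_pM => //; rewrite ?subr_ge0//.
  by rewrite expr2; lra.
by have := sqr_ge0 x; lra.
Qed.

Lemma iter_rmap_cvg s : `|s| <= 1 -> (fun m => iter m rmap s) @ \oo --> (Num.sg s : R).
Proof.
have H t : 0 < t <= 1 -> (fun m => iter m rmap t) @ \oo --> (1 : R).
  move=> ht; have [t0 t1] := andP ht.
  have c1 : (fun m => (1 - (1 - t / 2) ^+ m)) @ \oo --> (1 : R).
    rewrite -[X in _ --> X]subr0; apply: cvgB; first exact: cvg_cst.
    by apply: cvg_expr; rewrite ltr_norml; apply/andP; split; lra.
  apply: (@squeeze_cvgr _ _ _ _ (fun m => 1 - (1 - t / 2) ^+ m) (fun=> 1)) => //.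
    apply: nearW => m; have [/andP[_ h1] h2] := iter_rmap_pos m ht.
    by rewrite h1 andbT lerBlDr addrC -lerBlDr.
  exact: cvg_cst.
move=> s1; have [s0|s0|->] := ltrgt0P s.
- by rewrite gtr0_sg//; apply: H; rewrite s0; move: s1; rewrite gtr0_norm.
- rewrite ltr0_sg// (_ : (fun m => _) = fun m => - iter m rmap (- s)).
    by apply: cvgN; apply: H; rewrite oppr_gt0 s0; move: s1; rewrite ltr0_norm.
  by apply/funext => m; rewrite iter_rmapN opprK.
- rewrite sgr0 (_ : (fun m => _) = fun=> 0); first exact: cvg_cst.
  apply/funext => m; elim: m => [//|m IH]; rewrite [LHS]/= IH /rmap expr0n/=; lra.
Qed.

(** Sends the signs 1, 0, -1 to 1, 0, 0, so that the limit is the indicator of an open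
    half-line. *)
Definition pospart s : R := (s + s ^+ 2) / 2.

Lemma pospart_sg s : pospart (Num.sg s) = (0 < s)%R%:R.
Proof.
rewrite /pospart; have [h|h|->] := ltrgt0P s.
- by rewrite gtr0_sg// expr1n mulr1n; field.
- by rewrite ltr0_sg// mulr0n; field.
- by rewrite sgr0 expr0n /= addr0 mul0r.
Qed.

Lemma pospart_itv s : `|s| <= 1 -> `|pospart s| <= 1.
Proof. by rewrite /pospart !ler_norml => /andP[h1 h2]; apply/andP; split; nra. Qed.

Lemma pospart_cvg s : `|s| <= 1 ->
  (fun m => pospart (iter m rmap s)) @ \oo --> ((0 < s)%R%:R : R).
Proof.
move=> h; have H := iter_rmap_cvg h; rewrite -pospart_sg.
by apply: cvgMl; apply: cvgD => //; apply: cvgM.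
Qed.

Lemma cvg_prodr (I : Type) (r : seq I) (u : I -> nat -> R) (l : I -> R) :
  (forall i, u i @ \oo --> l i) ->
  (fun m => \prod_(i <- r) u i m) @ \oo --> \prod_(i <- r) l i.
Proof.
move=> h; elim: r => [|i r IH].
  rewrite big_nil (_ : (fun m => _) = fun=> 1); first exact: cvg_cst.
  by apply/funext => m; rewrite big_nil.
rewrite big_cons (_ : (fun m => _) = fun m => u i m * \prod_(j <- r) u j m).
  exact: cvgM.
by apply/funext => m; rewrite big_cons.
Qed.

Lemma norm_prod_le1 (I : Type) (r : seq I) (u : I -> R) :
  (forall i, `|u i| <= 1) -> `|\prod_(i <- r) u i| <= 1.
Proof.
move=> h; elim: r => [|i r IH]; first by rewrite big_nil normr1.
by rewrite big_cons normrM mulr_ile1.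
Qed.

(** The sign of [sin (t / N)] is that of [t] as soon as [|t| < N], so indicators of
    half-lines are limits of functions of sines. *)
Lemma sin_pos_cvg (t : R) :
  (fun N : nat => ((0 < sin (t / N.+1%:R))%R%:R : R)) @ \oo --> ((0 < t)%R%:R : R).
Proof.
apply/cvgrPdist_le => e e0; near=> N.
suff -> : (0 < sin (t / N.+1%:R)) = (0 < t) by rewrite subrr normr0 ltW.
have N0 : (0 : R) < N.+1%:R by [].
have tN : `|t| < N.+1%:R.
  near: N; exists (Num.truncn `|t|) => // N /= hN.
  by rewrite (lt_le_trans (truncnS_gt _))// ler_nat ltnS.
have H (u : R) : 0 < u -> u < N.+1%:R -> 0 < sin (u / N.+1%:R).
  move=> u0 uN; apply: sin2_gt0; rewrite divr_gt0//= ltr_pdivrMr//.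
  by rewrite (lt_trans uN)// ltr_pMl// ltr1n.
have [t0|t0|->] := ltrgt0P t.
- by apply: H => //; move: tN; rewrite gtr0_norm.
- have := H (- t); rewrite oppr_gt0 t0 mulNr sinN oppr_gt0 => /(_ isT).
  move: tN; rewrite ltr0_norm// => h /(_ h) h'.
  by apply/negbTE; rewrite -leNgt ltW.
- by rewrite mul0r sin0 ltxx.
Unshelve. all: by end_near.
Qed.

End sign_iteration.

Section law.
Context {R : realType} {d : measure_display} {Om : measurableType d}.
Variables (P : probability Om R) (k : nat) (X Y : 'I_k -> Om -> R).
Local Notation C := R[i].
Local Notation V := ('I_k -> R).
Hypothesis mX : forall j, measurable_fun setT (X j).
Hypothesis mY : forall j, measurable_fun setT (Y j).
Implicit Types (F G : V -> C) (c v : V).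

Definition wave c v : C := cexp ('i%C * (\sum_j c j * v j)%:C).

Hypothesis EXY : forall c, cint P setT (fun w => wave c (X^~ w)) =
  cint P setT (fun w => wave c (Y^~ w)).

(** The class on which the approximation argument runs: it contains the waves by
    hypothesis and is closed under linear combinations and bounded limits. *)
Definition agree F := exists2 M : R, (forall v, nc (F v) <= M) &
  [/\ cmeas setT (fun w => F (X^~ w)), cmeas setT (fun w => F (Y^~ w)) &
   cint P setT (fun w => F (X^~ w)) = cint P setT (fun w => F (Y^~ w))].

Lemma agree_intable F M (Z : 'I_k -> Om -> R) : (forall v, nc (F v) <= M) ->
  cmeas setT (fun w => F (Z^~ w)) -> cintable P setT (fun w => F (Z^~ w)).
Proof.
move=> FM mF; apply: (le_cintable (G := fun=> M)) => //.
by apply: finite_measure_integrable_cst.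
Qed.

Lemma agree_lin (a : C) F G : agree F -> agree G -> agree (fun v => a * F v + G v).
Proof.
move=> [M FM [fX fY fE]] [N GN [gX gY gE]]; exists (nc a * M + N).
  by move=> v; rewrite (le_trans (ncD _ _))// lerD// ncM ler_wpM2l// nc_ge0.
split; try by apply: cmeasD => //; apply: cmeasM => //; exact: cmeas_cst.
have i1 := agree_intable FM fX; have i2 := agree_intable FM fY.
have i3 := agree_intable GN gX; have i4 := agree_intable GN gY.
by rewrite !cintD//; try exact: cintableZ; rewrite !cintZ// fE gE.
Qed.

Lemma agree_lim (F_ : nat -> V -> C) F (M : R) : (forall m v, nc (F_ m v) <= M) ->
  (forall m, agree (F_ m)) -> (forall v, clim (F_ ^~ v) (F v)) -> agree F.
Proof.
move=> FM aF cF.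
have bF v : nc (F v) <= M.
  apply/ler_addgt0Pr => e e0; have [m0 _ hm] := cF v e e0.
  rewrite -[F v](subrK (F_ m0 v)) (le_trans (ncD _ _))// addrC lerD//.
  by rewrite ncBC; apply: hm; exact: leqnn.
exists M => //.
have mFX : cmeas setT (fun w => F (X^~ w)).
  apply: (cmeas_lim (f_ := fun m w => F_ m (X^~ w))) => // m.
  by have [? _ []] := aF m.
have mFY : cmeas setT (fun w => F (Y^~ w)).
  apply: (cmeas_lim (f_ := fun m w => F_ m (Y^~ w))) => // m.
  by have [? _ []] := aF m.
split=> //.
have iM : P.-integrable setT (EFin \o (fun=> M)) by exact: finite_measure_integrable_cst.
have lX : clim (fun m => cint P setT (fun w => F_ m (X^~ w))) (cint P setT (fun w => F (X^~ w))).
  by apply: (cint_dct _ _ _ iM) => // m; have [? _ []] := aF m.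
have lY : clim (fun m => cint P setT (fun w => F_ m (Y^~ w))) (cint P setT (fun w => F (Y^~ w))).
  by apply: (cint_dct _ _ _ iM) => // m; have [? _ []] := aF m.
apply: (clim_unique lX); rewrite (_ : (fun m => _) = fun m => cint P setT (fun w => F_ m (Y^~ w)))//.
by apply/funext => m; have [? _ []] := aF m.
Qed.

Lemma agree_wave c : agree (wave c).
Proof.
exists 1; first by move=> v; rewrite nc_cexp /= mul0r mul1r subrr expR0.
have H (Z : 'I_k -> Om -> R) : (forall j, measurable_fun setT (Z j)) ->
    cmeas setT (fun w => wave c (Z^~ w)).
  move=> mZ; apply: cmeas_cexp; apply: (cmeasM measurableT (cmeas_cst _ _)).
  by apply: cmeas_real; apply: measurable_sum => j; apply: measurable_funM.
by split; [exact: H|exact: H|exact: EXY].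
Qed.

Inductive trig : (V -> C) -> Prop :=
| trig_wave c : trig (wave c)
| trig_lin (a : C) F G : trig F -> trig G -> trig (fun v => a * F v + G v).

Lemma trig_agree F : trig F -> agree F.
Proof. by elim=> [c|a F1 G1 _ h1 _ h2]; [exact: agree_wave|exact: agree_lin]. Qed.

Lemma trig_ext F G : trig F -> F =1 G -> trig G.
Proof. by move=> h /funext <-. Qed.

Lemma waveD c c' v : wave c v * wave c' v = wave (fun j => c j + c' j) v.
Proof.
rewrite /wave -cexpD -mulrDr -(rmorphD (real_complex R)) -big_split /=.
by congr (cexp (_ * _%:C)); apply: eq_bigr => j _; rewrite mulrDl.
Qed.

Lemma trig_cst (a : C) : trig (fun=> a).
Proof.
have h0 : wave (fun=> 0) =1 fun=> 1.
  by move=> v; rewrite /wave big1 ?mulr0 ?cexp0// => j _; rewrite mul0r.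
apply: (trig_ext (trig_lin (a - 1) (trig_wave (fun=> 0)) (trig_wave (fun=> 0)))) => v.
by rewrite !h0 mulr1 subrK.
Qed.

Lemma trigM F G : trig F -> trig G -> trig (fun v => F v * G v).
Proof.
move=> tF tG; elim: tF => [c|a F1 F2 _ h1 _ h2].
  elim: tG => [c'|a F1 F2 _ h1 _ h2].
    by apply: trig_ext (trig_wave (fun j => c j + c' j)) _ => v; rewrite waveD.
  by apply: trig_ext (trig_lin a h1 h2) _ => v; ring.
by apply: trig_ext (trig_lin a h1 h2) _ => v; ring.
Qed.

Definition rtrig (f : V -> R) := trig (fun v => (f v)%:C).

Lemma rtrig_lin (a : R) f g : rtrig f -> rtrig g -> rtrig (fun v => a * f v + g v).
Proof.
move=> hf hg; apply: trig_ext (trig_lin a%:C hf hg) _ => v.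
by rewrite -(rmorphM (real_complex R)) -(rmorphD (real_complex R)).
Qed.

Lemma rtrigM f g : rtrig f -> rtrig g -> rtrig (fun v => f v * g v).
Proof.
move=> hf hg; apply: trig_ext (trigM hf hg) _ => v.
by rewrite -(rmorphM (real_complex R)).
Qed.

Lemma rtrig_cst (a : R) : rtrig (fun=> a).
Proof. exact: trig_cst. Qed.

Lemma rtrig_ext f g : rtrig f -> f =1 g -> rtrig g.
Proof. by move=> h /funext <-. Qed.

Lemma rtrig_sin (b t : R) j : rtrig (fun v => sin ((v j - b) / t)).
Proof.
pose c (s : R) : V := fun i => if i == j then s / t else 0.
have H s v : wave (c s) v = cexp ('i%C * (s / t * v j)%:C).
  rewrite /wave (bigD1 j)//= /c eqxx big1 ?addr0// => i /negbTE ->.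
  by rewrite mul0r.
have E (x : R) : cexp ('i%C * x%:C) = cos x +i* sin x.
  rewrite /cexp (_ : complex.Re ('i%C * x%:C) = 0); last by rewrite /=; ring.
  rewrite (_ : complex.Im ('i%C * x%:C) = x); last by rewrite /=; ring.
  by rewrite expR0 mul1r.
pose a : C := cexp ('i%C * (- (b / t))%:C) / (2 * 'i%C).
pose a' : C := - (cexp ('i%C * (b / t)%:C) / (2 * 'i%C)).
(* [sin x = (exp (i x) - exp (- i x)) / (2 i)], the phase of [b] being absorbed in
   the coefficients *)
have T := trig_lin a (trig_wave (c 1)) (trig_lin a' (trig_wave (c (-1))) (trig_cst 0)).
apply: trig_ext T _ => v; rewrite !H /a /a' addr0.
set I2 : C := (2 * 'i%C)^-1.
rewrite !mulNr ![_ * I2 * _]mulrAC -!cexpD -mulrBl -!mulrDr -!(rmorphD (real_complex R)).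
pose th := (v j - b) / t.
rewrite (_ : - (b / t) + 1 / t * v j = th); last by rewrite /th; ring.
rewrite (_ : b / t - 1 / t * v j = - th); last by rewrite /th; ring.
rewrite !E cosN sinN -/th (_ : _ - _ = (sin th)%:C * (2 * 'i%C)); last first.
  by apply/eqP; rewrite eq_complex /=; apply/andP; split; apply/eqP; ring.
rewrite /I2 mulfK// mulf_neq0 ?pnatr_eq0//.
by rewrite eq_complex /= oner_eq0 andbF.
Qed.

Lemma rtrig_prod (I : Type) (r : seq I) (f : I -> V -> R) : (forall i, rtrig (f i)) ->
  rtrig (fun v => \prod_(i <- r) f i v).
Proof.
move=> h; elim: r => [|i r IH].
  by apply: rtrig_ext (rtrig_cst 1) _ => v; rewrite big_nil.
by apply: rtrig_ext (rtrigM (h i) IH) _ => v; rewrite big_cons.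
Qed.

Lemma rtrig_rmap m f : rtrig f -> rtrig (fun v => iter m rmap (f v)).
Proof.
move=> hf; elim: m => [//|m IH] /=.
apply: rtrig_ext (rtrig_lin (3 / 2) IH (rtrig_lin (- 2^-1) (rtrigM IH (rtrigM IH IH)) (rtrig_cst 0))) _ => v.
by rewrite /rmap; field.
Qed.

Lemma rtrig_pospart f : rtrig f -> rtrig (fun v => pospart (f v)).
Proof.
move=> hf; apply: rtrig_ext (rtrig_lin 2^-1 hf (rtrig_lin 2^-1 (rtrigM hf hf) (rtrig_cst 0))) _ => v.
by rewrite /pospart; field.
Qed.

Lemma clim_real (u : nat -> R) (l : R) : u @ \oo --> l -> clim (fun m => (u m)%:C : C) l%:C.
Proof.
move=> /cvgrPdist_le h e e0; have [m0 _ hm] := h e e0; exists m0 => // m mm.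
by rewrite -(rmorphB (real_complex R)) nc_real distrC; exact: hm.
Qed.

(** Two bounded limits: the iteration index tends to infinity for a fixed period
    [N], then [N] does. *)
Lemma agree_orthant (b : V) :
  agree (fun v => (\prod_j (0 < v j - b j)%R%:R : R)%:C).
Proof.
have nb (I : Type) (r : seq I) (f : I -> bool) : nc (\prod_(i <- r) (f i)%:R : R)%:C <= 1 :> R.
  by rewrite nc_real; apply: norm_prod_le1 => i; case: (f i); rewrite ?normr1 ?normr0.
have s1 (x : R) : `|sin x| <= 1 by rewrite ler_norml sin_geN1 sin_le1.
apply: (@agree_lim (fun N v => (\prod_j (0 < sin ((v j - b j) / N.+1%:R))%R%:R : R)%:C) _ 1).
- by move=> N v; exact: nb.
- move=> N; apply: (@agree_lim (fun m v =>
     (\prod_j pospart (iter m rmap (sin ((v j - b j) / N.+1%:R))) : R)%:C) _ 1).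
  + move=> m v; rewrite nc_real; apply: norm_prod_le1 => j.
    by apply: pospart_itv; exact: iter_rmap_itv.
  + move=> m; apply: trig_agree; apply: rtrig_prod => j; apply: rtrig_pospart.
    by apply: rtrig_rmap; exact: rtrig_sin.
  + by move=> v; apply: clim_real; apply: cvg_prodr => j; exact: pospart_cvg.
- by move=> v; apply: clim_real; apply: cvg_prodr => j; exact: sin_pos_cvg.
Qed.

(** The probability of an orthant is the expectation of a product of indicators of
    half-lines, to which [agree_orthant] applies. *)
Lemma orthant_law (b : V) :
  P [set w | forall j, b j < X j w] = P [set w | forall j, b j < Y j w].
Proof.
have [M _ [_ _ E]] := agree_orthant b.
have H (Z : 'I_k -> Om -> R) : (forall j, measurable_fun setT (Z j)) ->
    P [set w | forall j, b j < Z j w] \is a fin_num /\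
    cint P setT (fun w => (\prod_j (0 < Z j w - b j)%R%:R : R)%:C : C) =
    (fine (P [set w | forall j, b j < Z j w]))%:C.
  move=> mZ; set A := [set w | _].
  have mA : measurable A.
    rewrite (_ : A = \bigcap_(j in [set: 'I_k]) (Z j @^-1` `]b j, +oo[)); last first.
      apply/seteqP; split => w /= h j; first by move=> _; rewrite /= in_itv/= andbT; exact: h.
      by have := h j I; rewrite /= in_itv/= andbT.
    apply: fin_bigcap_measurable; first exact: finite_finset.
    by move=> j _; rewrite -[X in measurable X]setTI; exact: mZ.
  split; first exact: fin_num_measure.
  rewrite /cint /=; congr (_ +i* _); last by rewrite /Rintegral integral0.
  rewrite /Rintegral -[in RHS](setIT A) -integral_indic//.
  congr fine; apply: eq_integral => w _ /=; congr EFin.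
  rewrite indicE; have [hw|hw] := pselect (A w).
    by rewrite mem_set// big1// => j _; rewrite subr_gt0 hw.
  rewrite memNset//; move: hw => /existsNP[j /negP hj].
  by rewrite (bigD1 j)//= subr_gt0 (negbTE hj) mul0r.
have [fX eX] := H X mX; have [fY eY] := H Y mY.
by move: E; rewrite eX eY => -[] E; rewrite -(fineK fX) -(fineK fY) E.
Qed.

End law.

(** * Laws of real processes *)
Section cylinders.
Context {R : realType} {n : nat}.
Local Notation C := R[i].
Local Notation Q := (Qcyl R n).
Local Notation hyp := (hyperfunction R n).
Implicit Types (phi psi : testfun R n) (u : hyp).

Lemma measurable_eval phi (B : set C) : <<s [set O : set C | open O] >> B ->
  measurable ([set u : hyp | B (u phi)] : set Q).
Proof.
move=> mB; apply: sub_sigma_algebra; exists 1%N, (fun=> phi), B; split=> //.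
by apply/seteqP; split=> [u h j //|u /(_ ord0)].
Qed.

Lemma measurable_Re_eval phi : measurable_fun setT (fun u : Q => complex.Re ((u : hyp) phi)).
Proof.
apply: (measurability _ (RGenOInfty.measurableE R)) => _ [_ [b ->]] <-.
rewrite setTI; apply: (@measurable_eval phi (@complex.Re R @^-1` `]b, +oo[%classic)).
apply: sub_sigma_algebra; apply: open_comp; last exact: interval_open.
by move=> z _; exact: Re_continuous.
Qed.

Lemma hyperZ u (a : C) phi : u (a *: phi) = a * u phi.
Proof. by rewrite linearZ. Qed.

Lemma hyperD u phi psi : u (phi + psi) = u phi + u psi.
Proof. by rewrite linearD. Qed.

Lemma Re_mulNi (z : C) : complex.Re (- 'i%C * z) = complex.Im z.
Proof. by case: z => a b /=; ring. Qed.

Lemma cmeas_eval phi : cmeas setT (fun u : Q => (u : hyp) phi).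
Proof.
split; first exact: measurable_Re_eval.
have := measurable_Re_eval (- 'i%C *: phi); congr measurable_fun.
by apply/funext => u; rewrite hyperZ Re_mulNi.
Qed.

(** Half-spaces are taken for all complex test functions: imaginary parts are real
    parts at [- i phi], so these sets determine the values of a functional
    completely. *)
Definition orthants : set (set Q) := [set A | exists k (phi : 'I_k -> testfun R n) (b : 'I_k -> R),
  A = [set u : hyp | forall j, b j < complex.Re (u (phi j))]].

Lemma orthants_setI : setI_closed orthants.
Proof.
move=> _ _ [k [phi [b ->]]] [l [psi [c ->]]].
exists (k + l)%N, (fun j => match fintype.split j with inl i => phi i | inr i => psi i end),
  (fun j => match fintype.split j with inl i => b i | inr i => c i end).
apply/seteqP; split=> [u [h1 h2] j|u h].
  by case: (fintype.split j) => i; [exact: h1|exact: h2].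
split=> j; first by have := h (unsplit (inl j)); rewrite unsplitK.
by have := h (unsplit (inr j)); rewrite unsplitK.
Qed.

Local Notation TG := (g_sigma_algebraType orthants).

Lemma orthants_Re phi : measurable_fun setT (fun u : TG => complex.Re ((u : hyp) phi)).
Proof.
apply: (measurability _ (RGenOInfty.measurableE R)) => _ [_ [b ->]] <-.
rewrite setTI; apply: sub_sigma_algebra; exists 1%N, (fun=> phi), (fun=> b).
by apply/seteqP; split=> [u /= h j|u /(_ ord0)]; [move: h|move=> h]; rewrite /= in_itv/= andbT.
Qed.

Lemma orthants_Im phi : measurable_fun setT (fun u : TG => complex.Im ((u : hyp) phi)).
Proof.
have := orthants_Re (- 'i%C *: phi); congr measurable_fun.
by apply/funext => u; rewrite hyperZ Re_mulNi.
Qed.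

Lemma measurable_near (f : TG -> R) (q r : R) : measurable_fun setT f ->
  measurable [set u | `|f u - q| < r].
Proof.
move=> mf; rewrite (_ : [set u | _] = setT `&` f @^-1` `]q - r, q + r[); first exact: mf.
apply/seteqP; split=> [u /= h|u [_ /=]]; last by rewrite in_itv/= ltr_distl.
by split=> //; move: h; rewrite in_itv/= ltr_distl.
Qed.

(** An open set of the plane is a countable union of squares with rational
    centers. *)
Lemma orthants_open phi (O : set C) : open O -> measurable ([set u : hyp | O (u phi)] : set TG).
Proof.
move=> oO.
pose S (q1 q2 : rat) (m : nat) : set TG :=
  [set u : hyp | `|complex.Re (u phi) - ratr q1| < m.+1%:R^-1] `&`
  [set u : hyp | `|complex.Im (u phi) - ratr q2| < m.+1%:R^-1].
pose good (q1 q2 : rat) (m : nat) := forall z : C,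
  `|complex.Re z - ratr q1| < m.+1%:R^-1 -> `|complex.Im z - ratr q2| < m.+1%:R^-1 -> O z.
pose T q1 q2 m : set TG := if `[< good q1 q2 m >] then S q1 q2 m else set0.
rewrite (_ : [set u | _] = \bigcup_q1 \bigcup_q2 \bigcup_m T q1 q2 m).
  apply: bigcupT_measurable_rat => q1; apply: bigcupT_measurable_rat => q2.
  apply: bigcupT_measurable => m; rewrite /T; case: asboolP => _; last exact: measurable0.
  by apply: measurableI; apply: measurable_near; [exact: orthants_Re|exact: orthants_Im].
apply/seteqP; split=> [u /= Ou|u [q1 _ [q2 _ [m _]]]]; last first.
  by rewrite /T; case: asboolP => // g [h1 h2]; exact: g.
have /nbhs_ballP[e' /posCE[e e0 ->] eO] := open_nbhs_nbhs (conj oO Ou).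
pose m := Num.truncn (4 / e).
have m0 : (0 : R) < m.+1%:R^-1 by rewrite invr_gt0.
have me : 4 * m.+1%:R^-1 < e.
  by rewrite ltr_pdivrMr// mulrC -ltr_pdivrMr//; exact: truncnS_gt.
have H (x : R) : exists q : rat, `|x - ratr q| < m.+1%:R^-1.
  have [|q] := @rat_in_itvoo R (x - m.+1%:R^-1) (x + m.+1%:R^-1).
    by rewrite ltrBlDr -addrA ltrDl addr_gt0.
  by rewrite in_itv/= -ltr_distl distrC => hq; exists q.
have [q1 h1] := H (complex.Re (u phi)); have [q2 h2] := H (complex.Im (u phi)).
exists q1 => //; exists q2 => //; exists m => //; rewrite /T; case: asboolP => // -[].
move=> z z1 z2; apply: eO; rewrite -ball_normE /= normCz_lt.
apply: le_lt_trans me; apply: le_trans (nc_le _) _.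
have -> : complex.Re (u phi - z) = (complex.Re (u phi) - ratr q1) - (complex.Re z - ratr q1).
  by case: (u phi) (z) => ? ? [] /= *; ring.
have -> : complex.Im (u phi - z) = (complex.Im (u phi) - ratr q2) - (complex.Im z - ratr q2).
  by case: (u phi) (z) => ? ? [] /= *; ring.
rewrite (_ : 4 * _ = (m.+1%:R^-1 + m.+1%:R^-1) + (m.+1%:R^-1 + m.+1%:R^-1)); last by ring.
by apply: lerD; apply: le_trans (ler_normB _ _) _; apply: lerD; exact: ltW.
Qed.

Lemma orthants_gen : (measurable : set (set Q)) = <<s orthants >>.
Proof.
apply/seteqP; split.
  apply: smallest_sub; first exact: (@sigma_algebra_measurable _ TG).
  move=> _ [k [phi [B [mB ->]]]].
  rewrite (_ : [set u | _] = \bigcap_(j in [set: 'I_k]) [set u : hyp | B (u (phi j))]); last first.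
    by apply/seteqP; split=> u h j; [move=> _; exact: h|exact: (h j I)].
  apply: (fin_bigcap_measurable (T := TG)); first exact: finite_finset.
  move=> j _.
  have sa := sigma_algebra_image (fun u : TG => (u : hyp) (phi j)) (@sigma_algebra_measurable _ TG).
  have := smallest_sub sa; rewrite /image_set_system => h.
  have := h _ _ _ mB; rewrite /= setTI; apply => O oO /=.
  by rewrite setTI; exact: orthants_open.
apply: smallest_sub; first exact: (@sigma_algebra_measurable _ Q).
move=> _ [k [phi [b ->]]].
rewrite (_ : [set u | _] = \bigcap_(j in [set: 'I_k])
    ((fun u : Q => complex.Re ((u : hyp) (phi j))) @^-1` `]b j, +oo[)); last first.
  apply/seteqP; split=> u /= h j; first by move=> _; rewrite /= in_itv/= andbT; exact: h.
  by have := h j I; rewrite /= in_itv/= andbT.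
apply: (fin_bigcap_measurable (T := Q)); first exact: finite_finset.
move=> j _; rewrite -[X in measurable X]setTI.
exact: (measurable_Re_eval (phi j)).
Qed.

Lemma goodRe (phi : testfun R n) (a b : C) :
  good (fun x => a * phi x + b * conjc (phi x)).
Proof.
apply: (good_lin a (testfun_good phi)); apply: (goodZ b).
exact: (good_cj (testfun_good phi)).
Qed.

Definition ReT phi : testfun R n := Testfun (good_Pstar (goodRe phi 2^-1 2^-1)).
Definition ImT phi : testfun R n := Testfun (good_Pstar (goodRe phi (- 'i%C / 2) ('i%C / 2))).

Lemma ReT_real phi : real_testfun (ReT phi).
Proof. by move=> x /=; rewrite -mulrDr addcJ mulrA mulVf ?pnatr_eq0// mul1r. Qed.

Lemma ImT_real phi : real_testfun (ImT phi).
Proof.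
move=> x /=; rewrite (_ : _ + _ = (complex.Im (phi x))%:C)//.
rewrite ImJ_sub; ring.
Qed.

Lemma ReImT phi : phi = ReT phi + 'i%C *: ImT phi.
Proof.
apply/val_inj/funext => x /=; rewrite -[RHS]/(ReT phi x + 'i%C * ImT phi x) /=.
have i2 : 'i%C * 'i%C = -1 :> C by rewrite -expr2 sqr_i.
rewrite mulrDr !mulrA mulrN i2 !mulN1r opprK mulNr.
by field.
Qed.

(** A real functional commutes with taking real parts, so that its law is already
    determined by real test functions. *)
Lemma real_hyper_Re u phi : real_hyperfunction u ->
  u (ReT phi) = (complex.Re (u phi))%:C.
Proof.
move=> ru; have h1 := ru _ (ReT_real phi); have h2 := ru _ (ImT_real phi).
rewrite [in RHS](ReImT phi) hyperD hyperZ.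
by move: h1 h2; case: (u (ReT _)) => a b /= ->; case: (u (ImT _)) => c e /= ->; apply/eqP;
  rewrite eq_complex /=; apply/andP; split; apply/eqP; ring.
Qed.

(** Linear combinations of coordinates of a process are values at one test function,
    so the characteristic functional contains the characteristic functions of all
    finite families of coordinates. *)
Lemma law_unique {d} {Om : measurableType d} (P : probability Om R) (X Y : {mfun Om >-> Q}) :
  (forall w, real_hyperfunction (X w)) -> (forall w, real_hyperfunction (Y w)) ->
  (forall phi, real_testfun phi ->
    cint P setT (fun w => cexp ('i%C * (X w : hyp) phi)) =
    cint P setT (fun w => cexp ('i%C * (Y w : hyp) phi))) ->
  forall A : set Q, measurable A -> distribution P X A = distribution P Y A.
Proof.
move=> rX rY E A mA.
apply: (@measure_unique _ R Q orthants (fun=> setT) orthants_gen orthants_setI) => //.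
- move=> _; exists 0%N, (fun=> 0), (fun=> 0).
  by apply/seteqP; split=> // u _ [].
- by rewrite bigcup_const//; exists 0%N.
- move=> _ [k [phi [b ->]]].
  pose XX (Z : {mfun Om >-> Q}) (j : 'I_k) w := complex.Re ((Z w : hyp) (phi j)).
  have mXX Z j : measurable_fun setT (XX Z j).
    exact: (measurableT_comp (measurable_Re_eval (phi j)) (measurable_funPT Z)).
  have W (Z : {mfun Om >-> Q}) c : (forall w, real_hyperfunction (Z w)) ->
      (fun w => wave c ((XX Z)^~ w)) =
      (fun w => cexp ('i%C * (Z w : hyp) (ReT (\sum_j (c j)%:C *: phi j)))).
    move=> rZ; apply/funext => w; rewrite /wave real_hyper_Re//; congr (cexp (_ * _%:C)).
    rewrite linear_sum (raddf_sum (@complex.Re R : {additive _ -> _})); apply: eq_bigr => j _.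
    rewrite hyperZ /XX; case: (_ (phi j)) => a e /=; ring.
  have := orthant_law (mXX X) (mXX Y) _ b; apply => c.
  by rewrite (W X c rX) (W Y c rY); apply: E; exact: ReT_real.
- by move=> _; rewrite /= /distribution /pushforward preimage_setT probability_setT ltry.
Qed.

End cylinders.

(** * The solution *)
Section solution.
Context {R : realType} {n : nat}.
Local Notation C := R[i].
Local Notation Q := (Qcyl R n).
Local Notation hyp := (hyperfunction R n).
Local Notation fn := ('rV[R]_n -> C).

Section operator.
Variable A : fn -> fn.
Hypothesis bA : bop A.
Hypothesis lA : forall (a : C) phi psi, good phi -> good psi ->
  A (fun x => a * phi x + psi x) = fun x => a * A phi x + A psi x.

Lemma measurable_lift_hyper : measurable_fun setT (lift_hyper bA lA : Q -> Q).
Proof.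
apply: (measurability (cylinder : set (set Q))) => // _ [_ [k [phi [B [mB ->]]]] <-].
rewrite setTI; apply: sub_sigma_algebra.
by exists k, (fun j => lift bA (phi j)), B.
Qed.

End operator.

Lemma measurable_shift_hyper t : measurable_fun setT (shift_hyper t : Q -> Q).
Proof.
apply: (measurability (cylinder : set (set Q))) => // _ [_ [k [phi [B [mB ->]]]] <-].
rewrite setTI; apply: sub_sigma_algebra.
by exists k, (fun j => shift_testfun t (phi j)), B.
Qed.

Lemma char_functionalE {d} {Om : measurableType d} (P : probability Om R)
    (X : {mfun Om >-> Q}) phi :
  char_functional P X phi = cint P setT (fun w => cexp ('i%C * (X w : hyp) phi)).
Proof.
have mF : cmeas setT (fun u : Q => cexp ('i%C * (u : hyp) phi)).
  by apply: cmeas_cexp; apply: (cmeasM measurableT (cmeas_cst _ _)); exact: cmeas_eval.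
by rewrite -[RHS](cint_push (m' := distribution P X) (measurable_funPT X) _ mF).
Qed.

Lemma Dadjoint_testfun (p : mpoly n R) (phi : testfun R n) :
  exists psi : testfun R n, psi = Dadjoint p phi :> fn.
Proof. by exists (Testfun (good_Pstar (good_Dadjoint p (testfun_good phi)))). Qed.

Lemma levy_shift t (g : C -> C) (chi : testfun R n) :
  Cintegrable (lebesgue_tuple n) (fun u => g (chi (row_of_tuple u))) ->
  Cintegral (lebesgue_tuple n) (fun u => g (shift_testfun t chi (row_of_tuple u))) =
  Cintegral (lebesgue_tuple n) (fun u => g (chi (row_of_tuple u))).
Proof.
move=> i1; have := @cint_translate R n t (fun x => g (chi x)); apply.
exact: cintable_meas i1.
Qed.

Lemma char_functional_shift {d} {Om : measurableType d} (P : probability Om R) a gamma nu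
    (L : {mfun Om >-> Q}) t (chi : testfun R n) : levy_white_noise P a gamma nu L ->
  real_testfun chi ->
  char_functional P L (shift_testfun t chi) = char_functional P L chi.
Proof.
move=> [_ _ _ H] rchi; have [i1 E1] := H chi rchi.
have [_ E2] := H (shift_testfun t chi) (fun x => rchi (x - t)).
rewrite E1; etransitivity; first exact: E2.
by apply: (congr1 (@cexp R)); exact: levy_shift i1.
Qed.

End solution.

Theorem theorem3p12 (R : realType) (n : nat)
    (d : measure_display) (Omega : measurableType d) (P : probability Omega R)
    (a gamma : R) (nu : {measure set (measurableTypeR R) -> \bar R})
    (L : {mfun Omega >-> Qcyl R n}) (p q : mpoly n R) (eps : R) :
  levy_white_noise P a gamma nu L ->
  p != 0 ->
  0 < eps ->
  (exists2 h : 'rV[R[i]]_n -> R[i], holomorphic_on (strip eps) h &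
    forall xi : 'rV[R]_n, mpoly_at_i p (toC xi) != 0 ->
      h (toC xi) = mpoly_at_i q (toC xi) / mpoly_at_i p (toC xi)) ->
  exists s : {mfun Omega >-> Qcyl R n},
    [/\ forall w, real_hyperfunction (s w),
        stationary P s,
        solves p q L s &
        (forall z, strip eps z -> mpoly_at_i p z != 0) ->
        forall s' : {mfun Omega >-> Qcyl R n}, solves p q L s' -> s' =1 s].
Proof.
move=> HLw p0 eps0 [h hol hpq]; have [_ _ rL _] := HLw.
pose e1 := @shrink R n eps; have e10 : 0 < e1 := shrink_gt0 eps0.
have e1s (z : 'rV[R[i]]_n) : tube e1 z -> strip eps z.
  move=> /(tube_strip eps0) zt; apply: lt_le_trans zt _.
  by rewrite ler_pdivrMr// ler_pMr// ler1n.
have [tm hp] := tempered_ratio p0 e10 (fun (z : 'rV[R[i]]_n) (zt : tube e1 z) => hol z (e1s z zt)) hpq.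
pose A := realify (mult h).
have bA : bop A := bop_realify (bop_mult tm).
have lA := realify_lin (mult_lin tm) : forall (a : R[i]) phi psi, good phi -> good psi ->
  A (fun x => a * phi x + psi x) = fun x => a * A phi x + A psi x.
pose S w : Qcyl R n := lift_hyper bA lA (L w).
have mS : measurable_fun setT S.
  exact: (measurableT_comp (measurable_lift_hyper bA lA) (measurable_funPT L)).
pose s : {mfun Omega >-> Qcyl R n} := HB.pack S (isMeasurableFun.Build _ _ _ _ S mS).
have lreal phi : real_testfun phi -> real_testfun (lift bA phi).
  move=> rphi; apply: realify_real; apply/funext => x; rewrite /cj.
  by have := rphi x; case: (phi x) => u v /= ->; rewrite oppr0.
have rs w : real_hyperfunction (s w).
  by move=> phi rphi; apply: rL; exact: lreal.
have lsol phi w (psi chi : testfun R n) : psi = Dadjoint p phi :> (_ -> _) ->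
    chi = Dadjoint q phi :> (_ -> _) -> good phi -> s w psi = L w chi.
  move=> epsi echi gphi; rewrite -[LHS]/((L w : hyperfunction R n) (lift bA psi)).
  congr (hyper_val (L w) _); apply/val_inj; rewrite /= epsi echi.
  by apply: realify_Dadjoint gphi => chi'; exact: mult_Dadjoint.
exists s; split=> //.
- move=> t B mB; pose Sh w : Qcyl R n := shift_hyper t (s w).
  have mSh : measurable_fun setT Sh.
    exact: (measurableT_comp (measurable_shift_hyper t) mS).
  pose sh : {mfun Omega >-> Qcyl R n} := HB.pack Sh (isMeasurableFun.Build _ _ _ _ Sh mSh).
  have rsh w : real_hyperfunction (sh w) by move=> phi rphi; apply: rs => x; exact: rphi.
  apply: (law_unique (X := sh) (Y := s) rsh rs _ mB) => phi rphi.
  have lsh : lift bA (shift_testfun t phi) = shift_testfun t (lift bA phi).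
    apply/val_inj; rewrite /=; apply: realify_shift; last exact: testfun_good.
    by move=> psi; exact: mult_shift.
  transitivity (char_functional P L (shift_testfun t (lift bA phi))).
    by rewrite char_functionalE -lsh.
  transitivity (char_functional P L (lift bA phi)); last by rewrite char_functionalE.
  exact: (char_functional_shift t HLw (lreal _ rphi)).
- move=> w phi; have [psi epsi] := Dadjoint_testfun p phi.
  have [chi echi] := Dadjoint_testfun q phi.
  rewrite -epsi -echi !pairingE; apply: (lsol phi) => //; exact: testfun_good.
- move=> pn0 s' hs' w; apply: hyperfunctionP => phi.
  have p1 (x : 'rV[R]_n) : mpoly_at_i (1 : mpoly n R) (toC x) = 1 by rewrite /mpoly_at_i rmorph1.
  have dV (z : 'rV[R[i]]_n) : tube e1 z -> differentiable (fun z => (mpoly_at_i p z)^-1) z.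
    by move=> zt; apply: differentiableV; [exact: (subexp_mpoly p).1|exact/pn0/e1s].
  have [tm1 hp1] := tempered_ratio (q := 1) p0 e10 dV
    (fun x _ => esym (etrans (congr1 (fun u => u / _) (p1 x)) (mul1r _))).
  have gpsi := good_mult tm1 (testfun_good phi).
  pose psi := Testfun (good_Pstar gpsi).
  have ephi : phi = Dadjoint p psi :> (_ -> _).
    apply: esym; apply: (Dadjoint_mult tm1) (testfun_good phi) => x.
    by rewrite hp1.
  have [chi echi] := Dadjoint_testfun q psi.
  have := hs' w psi; rewrite -ephi -echi !pairingE => ->.
  by rewrite (lsol psi w phi chi ephi echi gpsi).
Qed.
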